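(* Let $F$ be any field, let $n\geq 1$ be an integer, and let $\mathcal{P}^1(\mathcal{O}(n))$ be the first order module of principal parts of $\mathcal{O}(n)$ on $\mathbf{P}^1_F$. Then $\mathcal{P}^1(\mathcal{O}(n))$ is locally free both as a left and as a right $\mathcal{O}_{\mathbf{P}^1}$-module, and: (i) if the characteristic of $F$ does not divide $n$, then $\mathcal{P}^1(\mathcal{O}(n))\cong \mathcal{O}(n-1)\oplus\mathcal{O}(n-1)$ as left $\mathcal{O}_{\mathbf{P}^1}$-module and $\mathcal{P}^1(\mathcal{O}(n))\cong \mathcal{O}(n)\oplus\mathcal{O}(n-2)$ as right $\mathcal{O}_{\mathbf{P}^1}$-module; (ii) if the characteristic of $F$ divides $n$, then $\mathcal{P}^1(\mathcal{O}(n))\cong \mathcal{O}(n)\oplus\mathcal{O}(n-2)$ both as left and as right $\mathcal{O}_{\mathbf{P}^1}$-module.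
   Context: Let $X$ be a separated smooth scheme over a base scheme $S$ (here $X=\mathbf{P}^1_F$, $S=\operatorname{Spec}F$), let $p,q:X\times_S X\to X$ be the first and second projections, and let $\mathcal{I}\subset\mathcal{O}_{X\times_S X}$ be the ideal sheaf of the diagonal $\Delta$. For $k\ge 0$ put $\mathcal{O}_{\Delta^k}=\mathcal{O}_{X\times_S X}/\mathcal{I}^{k+1}$. For a quasi-coherent $\mathcal{O}_X$-module $\mathcal{E}$, the $k$-th order module of principal parts is $\mathcal{P}^k(\mathcal{E})=p_*(\mathcal{O}_{\Delta^k}\otimes q^*\mathcal{E})$. Its left $\mathcal{O}_X$-module structure is the one it has as a push-forward along $p$. Since $\mathcal{O}_{\Delta^k}\otimes q^*\mathcal{E}$ is supported on $\Delta$, the sheaf $p_*(\mathcal{O}_{\Delta^k}\otimes q^*\mathcal{E})$ is canonically isomorphic, as a sheaf of abelian groups, to $q_*(\mathcal{O}_{\Delta^k}\otimes q^*\mathcal{E})\cong q_*(\mathcal{O}_{\Delta^k})\otimes\mathcal{E}$; the right $\mathcal{O}_X$-module structure on $\mathcal{P}^k(\mathcal{E})$ is the one coming from the push-forward along $q$. A field of characteristic zero is regarded as having characteristic not dividing $n$. *)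

(* Defs.v *)
From HB Require Import structures.
From mathcomp Require Import all_boot all_order all_algebra.
From mathcomp Require Import boolp classical_sets functions topology_structure.
From mathcomp Require Import mpoly zify.

Set Implicit Arguments.
Unset Strict Implicit.
Unset Printing Implicit Defensive.

Import GRing.Theory.

Local Open Scope classical_set_scope.
Local Open Scope ring_scope.

Record opens (T : topologicalType) := Opens {
  opens_set :> set T;
  opens_open : open opens_set }.

Definition opens_pre (T T' : topologicalType) (f : T -> T')
    (f_cont : continuous f) (U : opens T') : opens T :=
  Opens ((@continuousP T T' f).1 f_cont U (opens_open U)).

Definition opensT (T : topologicalType) : opens T := Opens (@openT T).

(* The family [C] in the last two clauses is an open cover of [U].  A family of
   sections [s] is total; its values outside [C] are irrelevant. *)
Definition is_sheaf (T : topologicalType) (A : opens T -> Type)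
    (res : forall U V : opens T, V `<=` U -> A U -> A V) : Prop :=
  [/\ forall (U : opens T) (h : U `<=` U) (s : A U), res U U h s = s,
      forall (U V W : opens T) (h : V `<=` U) (k : W `<=` V) (l : W `<=` U)
        (s : A U), res V W k (res U V h s) = res U W l s,
      forall (U : opens T) (C : set (opens T)),
        (forall V, C V -> V `<=` U) -> U `<=` \bigcup_(V in C) V ->
        forall s t : A U,
        (forall (V : opens T) (h : V `<=` U), C V -> res U V h s = res U V h t) ->
        s = t
    & forall (U : opens T) (C : set (opens T)),
        (forall V, C V -> V `<=` U) -> U `<=` \bigcup_(V in C) V ->
        forall s : forall V, A V,
        (forall (V V' W : opens T) (h : W `<=` V) (h' : W `<=` V'),
           C V -> C V' -> res V W h (s V) = res V' W h' (s V')) ->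
        exists t : A U,
        forall (V : opens T) (h : V `<=` U), C V -> res U V h t = s V].

Record ringedSpace := RingedSpace {
  rs_top :> topologicalType;
  rs_sec : opens rs_top -> comPzRingType;
  rs_res : forall U V : opens rs_top, V `<=` U -> {rmorphism rs_sec U -> rs_sec V};
  rs_sheaf : is_sheaf (A := rs_sec) (fun U V h s => rs_res h s) }.

Arguments rs_res {r U V} h.

Record rsMorphism (X Y : ringedSpace) := RSMorphism {
  mor_fun :> X -> Y;
  mor_cont : continuous mor_fun;
  mor_sharp : forall U : opens Y,
    {rmorphism rs_sec U -> rs_sec (opens_pre mor_cont U)};
  mor_nat : forall (U V : opens Y) (h : V `<=` U)
      (h' : opens_pre mor_cont V `<=` opens_pre mor_cont U) (s : rs_sec U),
    rs_res h' (mor_sharp U s) = mor_sharp V (rs_res h s) }.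

Arguments mor_cont {X Y} r.
Arguments mor_sharp {X Y} r U.

Definition mor_pre (X Y : ringedSpace) (f : rsMorphism X Y) (U : opens Y) :
  opens X := opens_pre (mor_cont f) U.

Record omodule (X : ringedSpace) := OModule {
  om_sec :> forall U : opens X, lmodType (rs_sec U);
  om_res : forall U V : opens X, V `<=` U -> om_sec U -> om_sec V;
  om_resP : forall (U V : opens X) (h : V `<=` U) (a : rs_sec U) (s t : om_sec U),
    om_res h (a *: s + t) = rs_res h a *: om_res h s + om_res h t;
  om_sheaf : is_sheaf om_res }.

Arguments om_res {X} o {U V} h s.

Record omHom (X : ringedSpace) (M N : omodule X) := OmHom {
  hom_fun :> forall U : opens X, {linear M U -> N U};
  hom_nat : forall (U V : opens X) (h : V `<=` U) (s : M U),
    om_res N h (hom_fun U s) = hom_fun V (om_res M h s) }.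

Record omBilinear (X : ringedSpace) (M N L : omodule X) := OmBilinear {
  bil_fun :> forall U : opens X, M U -> N U -> L U;
  bil_linl : forall (U : opens X) (t : N U),
    linear (fun s : M U => bil_fun s t);
  bil_linr : forall (U : opens X) (s : M U), linear (bil_fun s);
  bil_nat : forall (U V : opens X) (h : V `<=` U) (s : M U) (t : N U),
    om_res L h (bil_fun s t) = bil_fun (om_res M h s) (om_res N h t) }.

(* [M|_U] and [N|_U] are isomorphic. *)
Definition om_iso_on (X : ringedSpace) (U : opens X) (M N : omodule X) : Prop :=
  exists phi : forall V : opens X, V `<=` U -> {linear M V -> N V},
    (forall (V : opens X) (h : V `<=` U), bijective (phi V h)) /\
    (forall (V W : opens X) (h : V `<=` U) (k : W `<=` U) (l : W `<=` V) (s : M V),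
       om_res N l (phi V h s) = phi W k (om_res M l s)).

Definition om_iso (X : ringedSpace) (M N : omodule X) : Prop :=
  om_iso_on (opensT X) M N.

Section Constructions.
Variable X : ringedSpace.

Section StructureSheaf.

Let ores (U V : opens X) (h : V `<=` U) (s : (rs_sec U)^o) : (rs_sec V)^o :=
  rs_res h s.

Lemma om_structure_resP (U V : opens X) (h : V `<=` U) (a : rs_sec U)
  (s t : (rs_sec U)^o) :
  ores h (a *: s + t) = rs_res h a *: ores h s + ores h t.
Proof. by rewrite /ores rmorphD rmorphM. Qed.

Definition om_structure : omodule X :=
  @OModule X (fun U => (rs_sec U)^o) ores om_structure_resP (rs_sheaf X).

End StructureSheaf.

Section DirectSum.
Variables M N : omodule X.

Let dres (U V : opens X) (h : V `<=` U) (s : M U * N U) : M V * N V :=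
  (om_res M h s.1, om_res N h s.2).

Lemma om_dsum_resP (U V : opens X) (h : V `<=` U) (a : rs_sec U)
  (s t : (M U * N U)%type) :
  dres h (a *: s + t) = rs_res h a *: dres h s + dres h t.
Proof. by rewrite /dres /= !om_resP. Qed.

Lemma om_dsum_sheaf : is_sheaf dres.
Proof.
case: (om_sheaf M) => M1 M2 M3 M4; case: (om_sheaf N) => N1 N2 N3 N4; split.
- by move=> U h [s t]; rewrite /dres /= M1 N1.
- by move=> U V W h k l [s t]; rewrite /dres /= (M2 _ _ _ _ _ l) (N2 _ _ _ _ _ l).
- move=> U C CU UC [s s'] [t t'] st; congr pair.
    by apply: (M3 U C CU UC) => V h CV; case: (st V h CV).
  by apply: (N3 U C CU UC) => V h CV; case: (st V h CV).
- move=> U C CU UC s sP.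
  have [|t tP] := M4 U C CU UC (fun V => (s V).1).
    by move=> V V' W h h' CV CV'; case: (sP V V' W h h' CV CV').
  have [|t' t'P] := N4 U C CU UC (fun V => (s V).2).
    by move=> V V' W h h' CV CV'; case: (sP V V' W h h' CV CV').
  exists (t, t') => V h CV; rewrite /dres /= tP// t'P//.
  by rewrite -surjective_pairing.
Qed.

Definition om_dsum : omodule X :=
  @OModule X (fun U => (M U * N U)%type) dres om_dsum_resP om_dsum_sheaf.

End DirectSum.

Section Free.
Variable r : nat.

Let fres (U V : opens X) (h : V `<=` U) (s : {ffun 'I_r -> (rs_sec U)^o}) :
    {ffun 'I_r -> (rs_sec V)^o} :=
  [ffun i => rs_res h (s i)].

Lemma om_free_resP (U V : opens X) (h : V `<=` U) (a : rs_sec U)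
  (s t : {ffun 'I_r -> (rs_sec U)^o}) :
  fres h (a *: s + t) = rs_res h a *: fres h s + fres h t.
Proof. by apply/ffunP => i; rewrite !ffunE rmorphD rmorphM. Qed.

Lemma om_free_sheaf : is_sheaf fres.
Proof.
case: (rs_sheaf X) => X1 X2 X3 X4; split.
- by move=> U h s; apply/ffunP => i; rewrite ffunE X1.
- by move=> U V W h k l s; apply/ffunP => i; rewrite !ffunE (X2 _ _ _ _ _ l).
- move=> U C CU UC s t st; apply/ffunP => i; apply: (X3 U C CU UC) => V h CV.
  by have /ffunP/(_ i) := st V h CV; rewrite !ffunE.
- move=> U C CU UC s sP.
  have H i : exists t : rs_sec U, forall (V : opens X) (h : V `<=` U),
      C V -> rs_res h t = s V i.
    apply: (X4 U C CU UC (fun V => s V i)) => V V' W h h' CV CV'.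
    by have /ffunP/(_ i) := sP V V' W h h' CV CV'; rewrite !ffunE.
  have [t tP] := choice H.
  by exists [ffun i => t i] => V h CV; apply/ffunP => i; rewrite !ffunE tP.
Qed.

Definition om_free : omodule X :=
  @OModule X (fun U => {ffun 'I_r -> (rs_sec U)^o}) fres om_free_resP
    om_free_sheaf.

End Free.

End Constructions.

Definition locally_free (X : ringedSpace) (M : omodule X) : Prop :=
  forall x : X, exists2 U : opens X, opens_set U x &
  exists r : nat, om_iso_on U M (om_free X r).

Definition restrict_scalars (R S : comPzRingType) (f : {rmorphism R -> S})
  (M : lmodType S) : Type := M.

Section RestrictScalars.
Variables (R S : comPzRingType) (f : {rmorphism R -> S}) (M : lmodType S).

HB.instance Definition _ := GRing.Zmodule.on (restrict_scalars f M).

Let rscale (a : R) (s : restrict_scalars f M) : restrict_scalars f M :=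
  f a *: (s : M).

Fact rscaleA a b s : rscale a (rscale b s) = rscale (a * b) s.
Proof. by rewrite /rscale scalerA rmorphM. Qed.
Fact rscale1 : left_id 1 rscale.
Proof. by move=> s; rewrite /rscale rmorph1 scale1r. Qed.
Fact rscaleDr : right_distributive rscale +%R.
Proof. by move=> a s t; rewrite /rscale scalerDr. Qed.
Fact rscaleDl s : {morph rscale^~ s : a b / a + b}.
Proof. by move=> a b; rewrite /rscale rmorphD scalerDl. Qed.

HB.instance Definition _ := GRing.Zmodule_isLmodule.Build R
  (restrict_scalars f M) rscaleA rscale1 rscaleDr rscaleDl.

End RestrictScalars.

Section Pushforward.
Variables (X Y : ringedSpace) (f : rsMorphism X Y) (M : omodule X).

Let psec (U : opens Y) : lmodType (rs_sec U) :=
  restrict_scalars (mor_sharp f U) (M (mor_pre f U)).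

Let pre_sub (U V : opens Y) (h : V `<=` U) : mor_pre f V `<=` mor_pre f U :=
  fun x => h (f x).

Let pres (U V : opens Y) (h : V `<=` U) (s : psec U) : psec V :=
  om_res M (pre_sub h) s.

Lemma pushforward_resP (U V : opens Y) (h : V `<=` U) (a : rs_sec U)
  (s t : psec U) :
  pres h (a *: s + t) = rs_res h a *: pres h s + pres h t.
Proof.
rewrite /pres.
transitivity (om_res M (pre_sub h)
  (mor_sharp f U a *: (s : M (mor_pre f U)) + (t : M (mor_pre f U)))) => //.
by rewrite om_resP (mor_nat h).
Qed.

Lemma pushforward_sheaf : is_sheaf pres.
Proof.
case: (om_sheaf M) => M1 M2 M3 M4; split.
- by move=> U h s; apply: M1.
- by move=> U V W h k l s; apply: M2.
- move=> U C CU UC s t st.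
  apply: (M3 (mor_pre f U) [set mor_pre f V | V in C]).
  + by move=> W [V CV eV]; rewrite -eV; apply: pre_sub; apply: CU.
  + by move=> x /UC [V CV Vx]; exists (mor_pre f V) => //; exists V.
  + move=> W h [V CV eV]; move: h; rewrite -eV => h.
    have := st V (CU _ CV) CV; rewrite /pres.
    by rewrite (Prop_irrelevance (pre_sub (CU V CV)) h).
- move=> U C CU UC s sP.
  pose s' (W : opens X) : M W :=
    match pselect (exists2 V, C V & mor_pre f V = W) with
    | left e => let: exist2 V _ eV := cid2 e in
       ecast W (M W) eV (s V : M (mor_pre f V))
    | right _ => 0
    end.
  have s'E V : C V -> s' (mor_pre f V) = s V.
    move=> CV; rewrite /s'; case: pselect => [e|[]]; last by exists V.
    case: cid2 => V' CV' eV.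
    have hV : mor_pre f V `<=` mor_pre f V by [].
    have hV' : mor_pre f V `<=` mor_pre f V' by rewrite eV.
    have agree : om_res M hV' (s V' : M (mor_pre f V')) =
        om_res M hV (s V : M (mor_pre f V)).
      apply: (M3 _ [set mor_pre f W | W in
         [set W : opens Y | W `<=` V /\ W `<=` V']]).
      + by move=> Z [W [WV _] eW]; rewrite -eW; apply: pre_sub.
      + move=> x Vx; have V'x : opens_set V' (f x) by have := hV' _ Vx.
        pose W := Opens (openI (opens_open V) (opens_open V')).
        by exists (mor_pre f W) => //; exists W => //; split=> y [].
      + move=> Z h [W [WV WV'] eW]; move: h; rewrite -eW => h.
        rewrite (M2 _ _ _ _ _ (pre_sub WV')) (M2 _ _ _ _ _ (pre_sub WV)).
        by have := sP V' V W WV' WV CV' CV; rewrite /pres.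
    rewrite M1 in agree; rewrite -agree.
    move: hV' {agree}; move: (s V' : M (mor_pre f V')) => u.
    by case: _ / eV => hV'; rewrite M1.
  have [||W W' Z h h' [V CV eV] [V' CV' eV']|t tP] :=
    M4 (mor_pre f U) [set mor_pre f V | V in C] _ _ s'.
  + by move=> W [V CV eV]; rewrite -eV; apply: pre_sub; apply: CU.
  + by move=> x /UC [V CV Vx]; exists (mor_pre f V) => //; exists V.
  + move: h h'; rewrite -eV -eV' => h h'; rewrite !s'E//.
    pose O := Opens (openI (opens_open V) (opens_open V')).
    have OV : O `<=` V by move=> y [].
    have OV' : O `<=` V' by move=> y [].
    have ZO : Z `<=` mor_pre f O by move=> x Zx; split; [apply: h|apply: h'].
    rewrite -(M2 _ _ _ (pre_sub OV) ZO h) -(M2 _ _ _ (pre_sub OV') ZO h').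
    by have := sP V V' O OV OV' CV CV'; rewrite /pres => ->.
  + exists t => V h CV; rewrite /pres tP ?s'E//.
    by exists V.
Qed.

Definition pushforward : omodule Y :=
  @OModule Y psec pres pushforward_resP pushforward_sheaf.

End Pushforward.

(* [(G, eta)] is the inverse image [f^* E], with the unit
   [eta : E -> f_* f^* E] of the adjunction between [f^*] and [f_*]. *)
Definition is_pullback (X Y : ringedSpace) (f : rsMorphism X Y) (E : omodule Y)
    (G : omodule X) (eta : omHom E (pushforward f G)) : Prop :=
  forall (L : omodule X) (h : omHom E (pushforward f L)),
    (exists g : omHom G L,
       forall (U : opens Y) (s : E U), g (mor_pre f U) (eta U s) = h U s) /\
    (forall g g' : omHom G L,
       (forall (U : opens Y) (s : E U),
          g (mor_pre f U) (eta U s) = g' (mor_pre f U) (eta U s)) ->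
       forall (V : opens X) (t : G V), g V t = g' V t).

Definition is_tensor (X : ringedSpace) (M N T : omodule X)
    (tau : omBilinear M N T) : Prop :=
  forall (L : omodule X) (b : omBilinear M N L),
    (exists g : omHom T L,
       forall (U : opens X) (s : M U) (t : N U), g U (tau U s t) = b U s t) /\
    (forall g g' : omHom T L,
       (forall (U : opens X) (s : M U) (t : N U),
          g U (tau U s t) = g' U (tau U s t)) ->
       forall (U : opens X) (t : T U), g U t = g' U t).

(* The kernel of [O_Y -> f_* O_X]; for a closed immersion [f] this is the ideal
   sheaf of its image. *)
Definition kernel_ideal (X Y : ringedSpace) (f : rsMorphism X Y)
    (U : opens Y) : set (rs_sec U) :=
  [set a | mor_sharp f U a = 0].

(* The [k]-th power of an ideal sheaf [J], that is the sheaf associated with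
   [V |-> J(V)^k], as a subsheaf of the structure sheaf. *)
Definition ideal_power (Y : ringedSpace)
    (J : forall U : opens Y, set (rs_sec U)) (k : nat)
    (U : opens Y) : set (rs_sec U) :=
  [set a | forall y : Y, opens_set U y ->
     exists (V : opens Y) (h : V `<=` U), opens_set V y /\
     exists (N : nat) (b : 'I_N -> rs_sec V) (c : 'I_N -> 'I_k -> rs_sec V),
       (forall i j, J V (c i j)) /\
       rs_res h a = \sum_(i < N) b i * \prod_(j < k) c i j].

(* [pi : O_Y -> Q] is an epimorphism of sheaves with kernel [J]. *)
Definition is_quotient (Y : ringedSpace) (J : forall U : opens Y, set (rs_sec U))
    (Q : omodule Y) (pi : omHom (om_structure Y) Q) : Prop :=
  (forall (U : opens Y) (a : rs_sec U), pi U a = 0 <-> J U a) /\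
  (forall (U : opens Y) (s : Q U) (y : Y), opens_set U y ->
     exists (V : opens Y) (h : V `<=` U), opens_set V y /\
     exists a : rs_sec V, pi V a = om_res Q h s).

(* [G] is [O_{Delta^k} (x) q^* E], where [O_{Delta^k} = O_Y / I^(k+1)] and [I]
   is the ideal sheaf of the diagonal [Delta : X -> Y], with [Y = X x X]. *)
Definition is_infinitesimal_nbhd_module (X Y : ringedSpace)
    (Delta : rsMorphism X Y) (q : rsMorphism Y X) (k : nat) (E : omodule X)
    (G : omodule Y) : Prop :=
  exists (ODk : omodule Y) (pi : omHom (om_structure Y) ODk),
    is_quotient (ideal_power (kernel_ideal Delta) k.+1) pi /\
  exists (qE : omodule Y) (eta : omHom E (pushforward q qE)),
    is_pullback eta /\
  exists tau : omBilinear ODk qE G, is_tensor tau.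

(* (P^1)^r is the multihomogeneous spectrum of F[x_i, y_i | i < r], graded by
   Z^r with x_i, y_i in degree e_i: [x_i : y_i] are the homogeneous coordinates
   on the i-th factor.  P^1 is the case r = 1, P^1 x P^1 the case r = 2. *)
Section MultiProj.
Variables (F : fieldType) (r : nat).

Local Notation S := {mpoly F[r + r]}.
Local Notation K := {fraction {mpoly F[r + r]}}.

Definition xvar (i : 'I_r) : S := 'X_(lshift r i).
Definition yvar (i : 'I_r) : S := 'X_(rshift r i).

Definition mnm_mdeg (m : 'X_{1..r + r}) (i : 'I_r) : nat :=
  m (lshift r i) + m (rshift r i).

Definition mhomog (e : 'I_r -> nat) (p : S) : Prop :=
  forall m, m \in msupp p -> mnm_mdeg m =1 e.

Definition mhomog_part (e : 'I_r -> nat) (p : S) : S :=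
  \sum_(m <- msupp p | [forall i, mnm_mdeg m i == e i]) p@_m *: 'X_[m].

Record mproj : Type := MProj {
  mproj_ideal : {pred S};
  mproj_idealr : idealr_closed mproj_ideal;
  mproj_prime : prime_idealr_closed mproj_ideal;
  mproj_homog : forall e p, p \in mproj_ideal -> mhomog_part e p \in mproj_ideal;
  mproj_relevant : forall i,
    ~~ ((xvar i \in mproj_ideal) && (yvar i \in mproj_ideal)) }.

HB.instance Definition _ := gen_eqMixin mproj.
HB.instance Definition _ := gen_choiceMixin mproj.

Definition mproj_open : set_system mproj :=
  [set A | forall P, A P -> exists e b,
     [/\ mhomog e b, b \notin mproj_ideal P
       & forall Q, b \notin mproj_ideal Q -> A Q]].

Lemma mhomogM e e' p q : mhomog e p -> mhomog e' q ->
  mhomog (fun i => e i + e' i)%N (p * q).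
Proof.
move=> hp hq m /msuppM_le/allpairsP[[m1 m2] /= [/hp h1 /hq h2 ->]] i.
by rewrite -h1 -h2 /mnm_mdeg !mnmDE addnACA.
Qed.

Lemma mhomogD e p q : mhomog e p -> mhomog e q -> mhomog e (p + q).
Proof.
by move=> hp hq m /msuppD_le; rewrite mem_cat => /orP[/hp|/hq].
Qed.

Lemma mhomogN e p : mhomog e p -> mhomog e (- p).
Proof. by move=> hp m; rewrite (perm_mem (msuppN p)) => /hp. Qed.

Lemma mhomog0 e : mhomog e 0.
Proof. by move=> m; rewrite msupp0. Qed.

Lemma mhomog1 : mhomog (fun=> 0%N) 1.
Proof.
move=> m; rewrite msupp1 inE => /eqP -> i.
by rewrite /mnm_mdeg !mnm0E.
Qed.

Section Point.
Variable P : mproj.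
Implicit Types p q : S.

Lemma mproj0 : 0 \in mproj_ideal P. Proof. by case: (mproj_idealr P). Qed.

Lemma mproj1 : 1 \notin mproj_ideal P. Proof. by case: (mproj_idealr P). Qed.

Lemma mprojMD a p q : p \in mproj_ideal P -> q \in mproj_ideal P ->
  a * p + q \in mproj_ideal P.
Proof. by case: (mproj_idealr P) => _ _; apply. Qed.

Lemma mprojM_notin p q : p \notin mproj_ideal P -> q \notin mproj_ideal P ->
  p * q \notin mproj_ideal P.
Proof.
by move=> pP qP; apply/negP => /mproj_prime; rewrite (negbTE pP) (negbTE qP).
Qed.

Lemma mproj_notin0 p : p \notin mproj_ideal P -> p != 0.
Proof. by apply: contraNneq => ->; exact: mproj0. Qed.

End Point.

Lemma mproj_openT : mproj_open setT.
Proof.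
move=> P _; exists (fun=> 0%N), 1; split=> //; first exact: mhomog1.
exact: mproj1.
Qed.

Lemma mproj_openI : setI_closed mproj_open.
Proof.
move=> A B Ao Bo P [/Ao[e [b [eb bP bA]]] /Bo[e' [b' [eb' b'P b'B]]]].
exists (fun i => e i + e' i)%N, (b * b'); split.
- exact: mhomogM.
- exact: mprojM_notin.
- move=> Q bb'Q; split.
    apply: bA; apply: contra bb'Q => bQ.
    by rewrite mulrC -[b' * b]addr0 mprojMD// mproj0.
  apply: b'B; apply: contra bb'Q => bQ.
  by rewrite -[b * b']addr0 mprojMD// mproj0.
Qed.

Lemma mproj_open_bigU (I : Type) (f : I -> set mproj) :
  (forall i, mproj_open (f i)) -> mproj_open (\bigcup_i f i).
Proof.
move=> fo P [i _ /fo[e [b [eb bP bf]]]]; exists e, b; split=> // Q /bf fQ.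
by exists i.
Qed.

HB.instance Definition _ :=
  isOpenTopological.Build mproj mproj_openT mproj_openI mproj_open_bigU.

Lemma openmprojE (A : set mproj) : open A = mproj_open A.
Proof. by []. Qed.

End MultiProj.

Section Tofrac.
Variable R : idomainType.
Implicit Types a b c d : R.

Lemma tofrac_sub a b c d : b != 0 -> d != 0 ->
  tofrac a / tofrac b - tofrac c / tofrac d =
  tofrac (a * d - c * b) / tofrac (b * d).
Proof.
move=> b0 d0; rewrite tofracB !tofracM -mulNr addf_div ?tofrac_eq0//.
by rewrite mulNr.
Qed.

Lemma tofrac_mul a b c d :
  tofrac a / tofrac b * (tofrac c / tofrac d) = tofrac (a * c) / tofrac (b * d).
Proof. by rewrite !tofracM mulf_div. Qed.

Lemma tofrac_div_inj a b c d : b != 0 -> d != 0 ->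
  tofrac a / tofrac b = tofrac c / tofrac d -> a * d = c * b.
Proof.
move=> b0 d0 /eqP; rewrite eqr_div ?tofrac_eq0// -!tofracM tofrac_eq.
by move=> /eqP.
Qed.

End Tofrac.

Section Twist.
Variables (F : fieldType) (r : nat).

Local Notation T := (mproj F r).
Local Notation K := {fraction {mpoly F[r + r]}}.

(* [s] is locally a quotient [a / b] of multihomogeneous polynomials with
   [deg a - deg b = d].  Values are taken in the fraction field of the
   coordinate ring, which contains all its homogeneous localizations. *)
Definition is_local_fraction (d : 'I_r -> int) (U : opens T)
    (s : opens_set U -> K) : Prop :=
  forall x : opens_set U, exists V : opens T, opens_set V (val x) /\
    exists e e' a b,
    [/\ mhomog e a, mhomog e' b, forall i, (e i)%:Z = (e' i)%:Z + d i
      & forall y : opens_set U, opens_set V (val y) ->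
        b \notin mproj_ideal (val y) /\ s y = tofrac a / tofrac b].

Definition local_fraction (d : 'I_r -> int) (U : opens T) :
  {pred (opens_set U -> K)} := fun s => `[< is_local_fraction d s >].

Arguments local_fraction : clear implicits.

Lemma local_fractionP d U s :
  reflect (is_local_fraction d s) (s \in local_fraction d U).
Proof. exact: asboolP. Qed.

Lemma mhomogP e e' (p : {mpoly F[r + r]}) : e =1 e' -> mhomog e p -> mhomog e' p.
Proof. by move=> ee' ep m /ep mE i; rewrite mE. Qed.

Lemma mhomogX e (p : {mpoly F[r + r]}) k :
  mhomog e p -> mhomog (fun i => k * e i)%N (p ^+ k).
Proof.
move=> ep; elim: k => [|k IH]; first exact: mhomog1.
by rewrite exprS; apply: mhomogP (mhomogM ep IH) => i; rewrite mulSn.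
Qed.

Lemma mhomog_prod (I : Type) (s : seq I) (e : I -> 'I_r -> nat)
    (p : I -> {mpoly F[r + r]}) :
  (forall i, mhomog (e i) (p i)) ->
  mhomog (fun j => \sum_(i <- s) e i j)%N (\prod_(i <- s) p i).
Proof.
move=> ep; elim: s => [|i s IH].
  by rewrite big_nil; apply: mhomogP (@mhomog1 F r) => j; rewrite big_nil.
rewrite big_cons; apply: mhomogP (mhomogM (ep i) IH) => j.
by rewrite big_cons.
Qed.

Lemma mhomog_xvar (i : 'I_r) : mhomog (fun j => (i == j) : nat) (xvar F i).
Proof.
move=> m; rewrite msuppX inE => /eqP-> j; rewrite /mnm_mdeg !mnm1E.
by rewrite eq_lshift eq_lrshift addn0.
Qed.

Lemma mhomog_yvar (i : 'I_r) : mhomog (fun j => (i == j) : nat) (yvar F i).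
Proof.
move=> m; rewrite msuppX inE => /eqP-> j; rewrite /mnm_mdeg !mnm1E.
by rewrite eq_rlshift eq_rshift.
Qed.

Lemma mprojX_notin (P : T) p k :
  p \notin mproj_ideal P -> p ^+ k \notin mproj_ideal P.
Proof.
move=> pP; elim: k => [|k IH]; first exact: mproj1.
by rewrite exprS mprojM_notin.
Qed.

Lemma mproj_unit_exists (P : T) (e : 'I_r -> nat) :
  exists2 b, mhomog e b & b \notin mproj_ideal P.
Proof.
pose v i := if xvar F i \in mproj_ideal P then yvar F i else xvar F i.
have vP i : v i \notin mproj_ideal P.
  rewrite /v; case: ifPn => // xP.
  by have := mproj_relevant P i; rewrite xP.
have hv i : mhomog (fun j => (i == j) : nat) (v i).
  by rewrite /v; case: ifP => _; [exact: mhomog_yvar|exact: mhomog_xvar].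
exists (\prod_i v i ^+ e i).
  have hX i : mhomog (fun j => e i * (i == j))%N (v i ^+ e i) by exact: mhomogX.
  apply: mhomogP (mhomog_prod (s := index_enum _) hX) => j.
  rewrite (bigD1 j)//= eqxx muln1 big1 ?addn0// => i ij.
  by rewrite (negbTE ij) muln0.
apply: (big_ind (fun p => p \notin mproj_ideal P)).
- exact: mproj1.
- exact: mprojM_notin.
- by move=> i _; exact: mprojX_notin.
Qed.

Definition nonvanishing e (b : {mpoly F[r + r]}) (eb : mhomog e b) : opens T :=
  @Opens T [set P : T | b \notin mproj_ideal P]
    (fun P bP => ex_intro _ e (ex_intro _ b (And3 eb bP (fun Q => id)))).

Lemma local_fraction_zmod d U : zmod_closed (local_fraction d U).
Proof.
split=> [|s t /local_fractionP sP /local_fractionP tP].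
  apply/local_fractionP => x.
  pose e' (i : 'I_r) := absz (d i); pose e (i : 'I_r) := absz ((e' i)%:Z + d i).
  have [b eb bx] := mproj_unit_exists (val x) e'.
  exists (nonvanishing eb); split=> //.
  exists e, e', 0, b; split=> //; first exact: mhomog0.
    by move=> i; rewrite /e /e'; case: (d i) => k //=; lia.
  by move=> y by_; split=> //; rewrite tofrac0 mul0r.
apply/local_fractionP => x.
have [V [Vx [e [e' [a [b [ea eb dE sE]]]]]]] := sP x.
have [W [Wx [f [f' [a2 [b2 [fa fb dF tE]]]]]]] := tP x.
exists (Opens (openI (opens_open V) (opens_open W))); split=> //.
exists (fun i => e i + f' i)%N, (fun i => e' i + f' i)%N,
  (a * b2 - a2 * b), (b * b2); split.
- apply: mhomogD; first exact: mhomogM.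
  apply: mhomogN; apply: mhomogP (mhomogM fa eb) => i.
  by have := dE i; have := dF i; lia.
- exact: mhomogM.
- by move=> i; have := dE i; lia.
- move=> y [/sE[by_ sy] /tE[b2y ty]]; split; first exact: mprojM_notin.
  rewrite [LHS](_ : _ = s y - t y)// sy ty.
  by apply: tofrac_sub; [exact: mproj_notin0 by_|exact: mproj_notin0 b2y].
Qed.

HB.instance Definition _ d U :=
  GRing.isZmodClosed.Build (opens_set U -> K) (local_fraction d U)
    (local_fraction_zmod d U).

(* Sections of O(d) over [U]. *)
Record twist_sec (d : 'I_r -> int) (U : opens T) := TwistSec {
  twist_fun :> opens_set U -> K;
  twist_funP : twist_fun \in local_fraction d U }.

HB.instance Definition _ d U := [isSub for @twist_fun d U].
HB.instance Definition _ d U := [Choice of twist_sec d U by <:].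
HB.instance Definition _ d U := [SubChoice_isSubZmodule of twist_sec d U by <:].

Lemma local_fractionM d d' d2 U s t : (forall i, d2 i = d i + d' i) ->
  s \in local_fraction d U -> t \in local_fraction d' U ->
  (fun x => s x * t x) \in local_fraction d2 U.
Proof.
move=> d2E /local_fractionP sP /local_fractionP tP; apply/local_fractionP => x.
have [V [Vx [e [e' [a [b [ea eb dE sE]]]]]]] := sP x.
have [W [Wx [f [f' [a2 [b2 [fa fb dF tE]]]]]]] := tP x.
exists (Opens (openI (opens_open V) (opens_open W))); split=> //.
exists (fun i => e i + f i)%N, (fun i => e' i + f' i)%N, (a * a2), (b * b2).
split; [exact: mhomogM|exact: mhomogM| |].
- by move=> i; rewrite d2E; have := dE i; have := dF i; lia.
- move=> y [/sE[by_ sy] /tE[b2y ty]]; split; first exact: mprojM_notin.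
  by rewrite sy ty; exact: tofrac_mul.
Qed.

Lemma local_fraction_subring U : subring_closed (local_fraction (fun=> 0) U).
Proof.
split.
- apply/local_fractionP => x; exists (opensT T); split=> //.
  exists (fun=> 0%N), (fun=> 0%N), 1, 1; split=> //; try exact: mhomog1.
  by move=> y _; split; [exact: mproj1|rewrite tofrac1 divr1].
- by case: (local_fraction_zmod (fun=> 0) U).
- move=> s t; apply: local_fractionM => i.
  by rewrite addr0.
Qed.

Definition regular_sec (U : opens T) : Type := twist_sec (fun=> 0) U.

HB.instance Definition _ U := GRing.SubZmodule.on (regular_sec U).
HB.instance Definition _ U := GRing.SubZmodule_isSubPzRing.Build
  (opens_set U -> K) (local_fraction (fun=> 0) U) (regular_sec U)
  (local_fraction_subring U).
HB.instance Definition _ U := GRing.SubPzRing_isSubComPzRing.Build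
  (opens_set U -> K) (local_fraction (fun=> 0) U) (regular_sec U).

Section Scale.
Variables (d : 'I_r -> int) (U : opens T).

Definition twist_scale (a : regular_sec U) (s : twist_sec d U) : twist_sec d U :=
  TwistSec (local_fractionM (fun i => esym (add0r (d i))) (valP a) (valP s)).

Fact twist_scaleA a b s : twist_scale a (twist_scale b s) = twist_scale (a * b) s.
Proof. by apply/val_inj/funext => x /=; rewrite mulrA. Qed.
Fact twist_scale1 : left_id 1 twist_scale.
Proof. by move=> s; apply/val_inj/funext => x /=; rewrite mul1r. Qed.
Fact twist_scaleDr : right_distributive twist_scale +%R.
Proof. by move=> a s t; apply/val_inj/funext => x; apply: mulrDr. Qed.
Fact twist_scaleDl s : {morph twist_scale^~ s : a b / a + b}.
Proof. by move=> a b; apply/val_inj/funext => x; apply: mulrDl. Qed.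

HB.instance Definition _ := GRing.Zmodule_isLmodule.Build (regular_sec U)
  (twist_sec d U) twist_scaleA twist_scale1 twist_scaleDr twist_scaleDl.

End Scale.

Definition opens_incl (U V : opens T) (h : V `<=` U) (x : opens_set V) :
  opens_set U := SigSub (mem_set (h _ (set_mem (valP x)))).

Lemma local_fraction_res d (U V : opens T) (h : V `<=` U) s :
  s \in local_fraction d U -> s \o opens_incl h \in local_fraction d V.
Proof.
move=> /local_fractionP sP; apply/local_fractionP => x.
have [W [Wx [e [e' [a [b [ea eb dE sE]]]]]]] := sP (opens_incl h x).
by exists W; split=> //; exists e, e', a, b; split=> // y /(sE (opens_incl h y)).
Qed.

Definition twist_res d (U V : opens T) (h : V `<=` U) (s : twist_sec d U) :
  twist_sec d V := TwistSec (local_fraction_res h (valP s)).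

Lemma twist_fun_irr d (U : opens T) (s : twist_sec d U) x y :
  val x = val y -> s x = s y.
Proof. by move=> /val_inj ->. Qed.

Lemma twist_sheaf d : is_sheaf (@twist_res d).
Proof.
split.
- by move=> U h s; apply/val_inj/funext => x /=; apply: twist_fun_irr.
- by move=> U V W h k l s; apply/val_inj/funext => x /=; apply: twist_fun_irr.
- move=> U C CU UC s t st; apply/val_inj/funext => x /=.
  have [V CV Vx] := UC _ (set_mem (valP x)).
  have /(congr1 (fun u : twist_sec d V => u (SigSub (mem_set Vx)))) /= :=
    st V (CU V CV) CV.
  by rewrite !(@twist_fun_irr _ _ _ (opens_incl _ _) x).
- move=> U C CU UC s sP.
  have ex (x : opens_set U) : exists V, C V /\ opens_set V (val x).
    by have [V CV Vx] := UC _ (set_mem (valP x)); exists V.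
  pose V x := sval (cid (ex x)).
  have CV x : C (V x) by rewrite /V; case: cid => ? [].
  have Vx x : opens_set (V x) (val x) by rewrite /V; case: cid => ? [].
  pose f (x : opens_set U) : K := s (V x) (SigSub (mem_set (Vx x))).
  have fE (x : opens_set U) W (y : opens_set W) : C W -> val y = val x ->
      f x = s W y.
    move=> CW yx; pose O := Opens (openI (opens_open (V x)) (opens_open W)).
    have Ox : opens_set O (val x).
      by split=> //; rewrite -yx; exact: (set_mem (valP y)).
    have hV : O `<=` V x by move=> z [].
    have hW : O `<=` W by move=> z [].
    have /(congr1 (fun u : twist_sec d O => u (SigSub (mem_set Ox)))) /= :=
      sP _ _ _ hV hW (CV x) CW.
    rewrite (@twist_fun_irr _ _ _ (opens_incl hV _) (SigSub (mem_set (Vx x))))//.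
    by rewrite (@twist_fun_irr _ _ _ (opens_incl hW _) y).
  have fP : f \in local_fraction d U.
    apply/local_fractionP => x.
    have /local_fractionP/(_ (SigSub (mem_set (Vx x)))) := valP (s (V x)).
    move=> [W [Wx [e [e' [a [b [ea eb dE sE]]]]]]].
    exists (Opens (openI (opens_open (V x)) (opens_open W))); split=> //.
    exists e, e', a, b; split=> // y [Vy Wy].
    rewrite (fE y (V x) (SigSub (mem_set Vy)))//; exact: (sE (SigSub (mem_set Vy)) Wy).
  exists (TwistSec fP) => W h CW; apply/val_inj/funext => x /=.
  exact: fE.
Qed.

Section RegularRes.
Variables (U V : opens T) (h : V `<=` U).

Definition regular_res (s : regular_sec U) : regular_sec V := twist_res h s.

Fact regular_res_zmod : zmod_morphism regular_res.
Proof. by move=> s t; apply/val_inj. Qed.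
Fact regular_res_monoid : monoid_morphism regular_res.
Proof. by split=> [|s t]; apply/val_inj. Qed.

HB.instance Definition _ :=
  GRing.isZmodMorphism.Build _ _ regular_res regular_res_zmod.
HB.instance Definition _ :=
  GRing.isMonoidMorphism.Build _ _ regular_res regular_res_monoid.

End RegularRes.

End Twist.

Arguments local_fraction {F r} d U _.

Definition P1pow (F : fieldType) (r : nat) : ringedSpace :=
  @RingedSpace (mproj F r) (@regular_sec F r)
    (fun U V h => @regular_res F r U V h) (@twist_sheaf F r (fun=> 0)).

Section TwistModule.
Variables (F : fieldType) (r : nat) (d : 'I_r -> int).

Lemma twist_resP (U V : opens (P1pow F r)) (h : V `<=` U)
  (a : rs_sec U) (s t : twist_sec d U) :
  twist_res h (a *: s + t) = rs_res h a *: twist_res h s + twist_res h t.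
Proof. by apply/val_inj. Qed.

Definition twist : omodule (P1pow F r) :=
  @OModule (P1pow F r) (@twist_sec F r d) (@twist_res F r d)
    twist_resP (@twist_sheaf F r d).

End TwistModule.

Section HomogPart.
Variables (F : fieldType) (r : nat).

Local Notation S := {mpoly F[r + r]}.
Implicit Types (p q : S) (e : 'I_r -> nat) (Q : pred 'X_{1..r + r}).

Definition mfilter Q p : S := \sum_(m <- msupp p | Q m) p@_m *: 'X_[m].

Lemma mcoeff_mfilter Q p k : (mfilter Q p)@_k = if Q k then p@_k else 0.
Proof.
rewrite /mfilter raddf_sum /=.
under eq_bigr do rewrite mcoeffZ mcoeffX.
have [kp|kp] := boolP (k \in msupp p); last first.
  rewrite (memN_msupp_eq0 kp) if_same big_seq_cond big1// => m /andP[mp _].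
  by case: eqP kp => [<-|_ _]; rewrite ?mp ?mulr0.
rewrite (big_rem k)//= eqxx mulr1 big_seq_cond big1 ?addr0// => m.
rewrite (rem_filter _ (msupp_uniq p)) mem_filter /= => /andP[/andP[mk _] _].
by rewrite (negbTE mk) mulr0.
Qed.

Definition has_mdeg e : pred 'X_{1..r + r} :=
  fun m => [forall i, mnm_mdeg m i == e i].

Lemma has_mdegP e m : reflect (mnm_mdeg m =1 e) (has_mdeg e m).
Proof. exact: 'forall_eqP. Qed.

Lemma mhomog_partE e p : mhomog_part e p = mfilter (has_mdeg e) p.
Proof. by []. Qed.

Lemma mcoeff_part e p k :
  (mhomog_part e p)@_k = if has_mdeg e k then p@_k else 0.
Proof. by rewrite mhomog_partE mcoeff_mfilter. Qed.

Lemma mhomog_partD e p q :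
  mhomog_part e (p + q) = mhomog_part e p + mhomog_part e q.
Proof.
apply/mpolyP => k; rewrite mcoeffD !mcoeff_part mcoeffD.
by case: ifP; rewrite ?addr0.
Qed.

Lemma mhomog_partZ e c p : mhomog_part e (c *: p) = c *: mhomog_part e p.
Proof.
apply/mpolyP => k; rewrite mcoeffZ !mcoeff_part mcoeffZ.
by case: ifP; rewrite ?mulr0.
Qed.

Lemma mhomog_part0 e : mhomog_part e (0 : S) = 0.
Proof. by apply/mpolyP => k; rewrite mcoeff_part !mcoeff0 if_same. Qed.

Lemma mhomog_part_sum e (I : Type) (s : seq I) (p : I -> S) :
  mhomog_part e (\sum_(i <- s) p i) = \sum_(i <- s) mhomog_part e (p i).
Proof.
by apply: (big_morph (mhomog_part e)); [exact: mhomog_partD|exact: mhomog_part0].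
Qed.

Lemma mhomog_part_id e p : mhomog e p -> mhomog_part e p = p.
Proof.
move=> ep; apply/mpolyP => k; rewrite mcoeff_part; case: has_mdegP => // ke.
by apply/esym/memN_msupp_eq0; apply/negP => /ep.
Qed.

Lemma mhomog_part_neq e e' p : mhomog e p -> ~ e =1 e' -> mhomog_part e' p = 0.
Proof.
move=> ep ee'; apply/mpolyP => k; rewrite mcoeff_part mcoeff0.
case: has_mdegP => // ke'; apply: memN_msupp_eq0; apply/negP => /ep ke.
by apply: ee' => i; rewrite -ke ke'.
Qed.

Lemma mhomog_part_eq e e' p : e =1 e' -> mhomog_part e p = mhomog_part e' p.
Proof.
move=> ee'; apply/mpolyP => k; rewrite !mcoeff_part; congr (if _ then _ else _).
by apply: eq_forallb => i; rewrite ee'.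
Qed.

Lemma mhomog_partP e p : mhomog e (mhomog_part e p).
Proof.
move=> k; rewrite mcoeff_msupp mcoeff_part.
by case: has_mdegP => //; rewrite eqxx.
Qed.

Lemma mhomog_partMX e m p : mhomog_part e ('X_[m] * p) =
  if [forall i, mnm_mdeg m i <= e i]%N
  then 'X_[m] * mhomog_part (fun i => e i - mnm_mdeg m i)%N p else 0.
Proof.
rewrite {1}[p]mpolyE mulr_sumr mhomog_part_sum.
have mdegD k i : mnm_mdeg (m + k)%MM i = (mnm_mdeg m i + mnm_mdeg k i)%N.
  by rewrite /mnm_mdeg !mnmDE addnACA.
have homogX k : mhomog (mnm_mdeg k) ('X_[k] : S).
  by move=> k'; rewrite msuppX inE => /eqP ->.
case: ifPn => [/forallP me|me].
  rewrite [in RHS]/mhomog_part mulr_sumr [RHS]big_mkcond /=.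
  apply: eq_bigr => k _; rewrite -scalerAr -mpolyXD mhomog_partZ.
  case: ifPn => [/'forall_eqP ke|ke].
    rewrite mhomog_part_id -?scalerAr -?mpolyXD// => k'.
    rewrite msuppX inE => /eqP -> i.
    by rewrite mdegD ke subnKC.
  rewrite (mhomog_part_neq (homogX _)) ?scaler0// => mke.
  case/negP: ke; apply/'forall_eqP => i.
  by rewrite -mke mdegD addKn.
apply: big1 => k _; rewrite -scalerAr -mpolyXD mhomog_partZ.
rewrite (mhomog_part_neq (homogX _)) ?scaler0// => mke.
by case/negP: me; apply/forallP => i; rewrite -mke mdegD leq_addr.
Qed.

End HomogPart.

(* A map of factors f : 'I_r -> 'I_s induces (P^1)^s -> (P^1)^r, taking the
   point (P_j)_j to (P_(f i))_i; on homogeneous coordinates it is given by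
   x_i |-> x_(f i), y_i |-> y_(f i).  The projections and the diagonal of
   P^1 x P^1 are the three instances used below. *)
Section P1powMap.
Variables (F : fieldType) (r s : nat) (f : 'I_r -> 'I_s).

Local Notation R := {mpoly F[r + r]}.
Local Notation S := {mpoly F[s + s]}.

Definition coord_map (i : 'I_(r + r)) : 'I_(s + s) :=
  match fintype.split i with
  | inl j => lshift s (f j)
  | inr j => rshift s (f j)
  end.

Definition coord_subst : R -> S :=
  comp_mpoly [tuple 'X_(coord_map i) | i < r + r].

HB.instance Definition _ := GRing.RMorphism.on coord_subst.

Definition push_mdeg (e : 'I_r -> nat) (j : 'I_s) : nat :=
  (\sum_(i | f i == j) e i)%N.

Lemma coord_substX (m : 'X_{1..r + r}) :
  exists2 m', coord_subst 'X_[m] = 'X_[m'] &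
  mnm_mdeg m' =1 push_mdeg (mnm_mdeg m).
Proof.
exists (\sum_(i < r + r) U_(coord_map i) *+ m i)%MM.
  rewrite /coord_subst comp_mpolyX.
  rewrite -mprodXnE.
  by apply: eq_bigr => i _; rewrite tnth_mktuple.
move=> j; rewrite /mnm_mdeg /push_mdeg !mnm_sumE !big_split_ord /=.
have coordl i : coord_map (lshift r i) = lshift s (f i).
  by rewrite /coord_map -[lshift r i]/(unsplit (inl i)) unsplitK.
have coordr i : coord_map (rshift r i) = rshift s (f i).
  by rewrite /coord_map -[rshift r i]/(unsplit (inr i)) unsplitK.
rewrite -!big_split/= [RHS]big_mkcond/=.
apply: eq_bigr => i _.
rewrite !mulmnE coordl coordr !mnm1E eq_lshift eq_rlshift eq_lrshift eq_rshift.
by case: (f i == j); rewrite ?mul1n ?mul0n ?addn0 ?add0n.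
Qed.

Lemma mhomog_coord_subst e p :
  mhomog e p -> mhomog (push_mdeg e) (coord_subst p).
Proof.
move=> ep; rewrite [p]mpolyE raddf_sum /= big_seq.
apply: (big_ind (mhomog (push_mdeg e))).
- exact: mhomog0.
- by move=> u v; exact: mhomogD.
- move=> m /ep mE; rewrite -mul_mpolyC rmorphM /= {1}/coord_subst comp_mpolyC.
  rewrite mul_mpolyC; have [m' -> m'E] := coord_substX m.
  move=> k /msuppZ_le; rewrite msuppX inE => /eqP -> j.
  by rewrite m'E; apply: eq_bigr => i _; rewrite mE.
Qed.

Definition pull_ideal (P : mproj F s) : {pred R} :=
  fun p => `[< forall e, coord_subst (mhomog_part e p) \in mproj_ideal P >].

Section PullPoint.
Variable P : mproj F s.
Implicit Types p u v : R.

Lemma pull_idealP p :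
  reflect (forall e, coord_subst (mhomog_part e p) \in mproj_ideal P)
          (p \in pull_ideal P).
Proof. exact: asboolP. Qed.

Lemma pull_ideal_homog e p : mhomog e p ->
  (p \in pull_ideal P) = (coord_subst p \in mproj_ideal P).
Proof.
move=> ep; apply/pull_idealP/idP => [/(_ e)|pP e'].
  by rewrite mhomog_part_id.
have [/mhomog_part_eq <-|ee'] := pselect (e =1 e'); first by rewrite mhomog_part_id.
by rewrite (mhomog_part_neq ep ee') raddf0 mproj0.
Qed.

Lemma pull_idealD u v : u \in pull_ideal P -> v \in pull_ideal P ->
  u + v \in pull_ideal P.
Proof.
move=> /pull_idealP uP /pull_idealP vP; apply/pull_idealP => e.
rewrite mhomog_partD raddfD /= -[coord_subst (mhomog_part e u)]mul1r.
exact: mprojMD.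
Qed.

Lemma pull_ideal0 : 0 \in pull_ideal P.
Proof. by rewrite (pull_ideal_homog (@mhomog0 _ _ (fun=> 0%N))) raddf0 mproj0. Qed.

Lemma mprojM (Q : mproj F s) a q :
  q \in mproj_ideal Q -> a * q \in mproj_ideal Q.
Proof. by move=> qQ; rewrite -[a * q]addr0 mprojMD// mproj0. Qed.

Lemma pull_idealM u v : v \in pull_ideal P -> u * v \in pull_ideal P.
Proof.
move=> /pull_idealP vP; rewrite [u]mpolyE mulr_suml.
apply: (big_ind (fun p => p \in pull_ideal P)).
- exact: pull_ideal0.
- exact: pull_idealD.
- move=> m _; apply/pull_idealP => e.
  rewrite -scalerAl mhomog_partZ mhomog_partMX; case: ifP => _.
    by rewrite -mul_mpolyC !rmorphM /=; do 2!apply: mprojM.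
  by rewrite scaler0 raddf0 mproj0.
Qed.

Lemma pull_ideal_part e p : p \in pull_ideal P -> mhomog_part e p \in pull_ideal P.
Proof.
by move=> /pull_idealP pP; rewrite (pull_ideal_homog (@mhomog_partP _ _ e p)).
Qed.

Lemma pull_ideal_relevant i :
  ~~ ((xvar F i \in pull_ideal P) && (yvar F i \in pull_ideal P)).
Proof.
rewrite (pull_ideal_homog (@mhomog_xvar F r i)) (pull_ideal_homog (@mhomog_yvar F r i)).
have -> : coord_subst (xvar F i) = xvar F (f i).
  rewrite /coord_subst /xvar comp_mpolyXU -tnth_nth tnth_mktuple /coord_map.
  by rewrite -[lshift r i]/(unsplit (inl i)) unsplitK.
have -> : coord_subst (yvar F i) = yvar F (f i).
  rewrite /coord_subst /yvar comp_mpolyXU -tnth_nth tnth_mktuple /coord_map.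
  by rewrite -[rshift r i]/(unsplit (inr i)) unsplitK.
exact: mproj_relevant.
Qed.

Lemma pull_ideal_idealr : idealr_closed (pull_ideal P).
Proof.
split; first exact: pull_ideal0.
  by rewrite (pull_ideal_homog (@mhomog1 _ _)) rmorph1 mproj1.
by move=> a u v uP vP; exact: (pull_idealD (pull_idealM _ uP) vP).
Qed.

Let mm (m : 'X_{1..r + r}) : 'X_{1..r} := [multinom mnm_mdeg m i | i < r].

Let seq_max (D : seq 'X_{1..r}) (Q : pred 'X_{1..r}) : has Q D ->
  exists2 d, Q d & forall d', d' \in D -> Q d' -> (d' <= d)%O.
Proof.
elim: D => //= c D IH; have [/IH[d Qd dmax]|nQD] := boolP (has Q D).
  move=> _; have [cd|dc] := boolP (~~ Q c || (c <= d)%O).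
    exists d => // d'; rewrite inE => /orP[/eqP->{d'}|]; last exact: dmax.
    by move=> Qc; move: cd; rewrite Qc.
  move: dc; rewrite negb_or negbK -Order.TotalTheory.ltNge => /andP[Qc dc].
  exists c => // d'; rewrite inE => /orP[/eqP->//|d'D Qd'].
  exact: (Order.POrderTheory.le_trans (dmax _ d'D Qd') (Order.POrderTheory.ltW dc)).
rewrite orbF => Qc; exists c => // d'; rewrite inE => /orP[/eqP->//|d'D Qd'].
by move/hasPn: nQD => /(_ _ d'D); rewrite Qd'.
Qed.

Let mmE e m : has_mdeg e m = (mm m == [multinom e i | i < r]).
Proof.
apply/has_mdegP/eqP => [me|/mnmP me i]; first by apply/mnmP => i; rewrite !mnmE me.
by have := me i; rewrite !mnmE.
Qed.

Lemma pull_ideal_lead u : u \notin pull_ideal P -> exists u1 (d : 'X_{1..r}),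
  [/\ u - u1 \in pull_ideal P,
      coord_subst (mhomog_part d u1) \notin mproj_ideal P
    & forall m, m \in msupp u1 -> (mm m <= d)%O].
Proof.
move=> uP.
pose bad (d : 'X_{1..r}) := coord_subst (mhomog_part d u) \notin mproj_ideal P.
have part0 e : [multinom e i | i < r] \notin [seq mm m | m <- msupp u] ->
    mhomog_part e u = 0.
  move=> eD; apply/mpolyP => k; rewrite mcoeff_part mcoeff0 mmE.
  case: eqP => // ke; apply: memN_msupp_eq0; apply: contra eD => ku.
  by apply/mapP; exists k.
have multE e (d : 'X_{1..r}) : d = [multinom e i | i < r] -> e =1 d.
  by move=> -> i; rewrite mnmE.
have /seq_max[d dbad dmax] : has bad [seq mm m | m <- msupp u].
  apply: contraNT uP => /hasPn nbad; apply/pull_idealP => e.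
  have [/nbad|/part0->] := boolP ([multinom e i | i < r] \in
      [seq mm m | m <- msupp u]); last by rewrite raddf0 mproj0.
  by rewrite /bad negbK (mhomog_part_eq _ (multE e _ erefl)).
exists (mfilter (fun m => (mm m <= d)%O) u), d; split.
- apply/pull_idealP => e; set e' := [multinom e i | i < r].
  have [e'd|de'] := boolP (e' <= d)%O.
    rewrite (_ : mhomog_part _ _ = 0) ?raddf0 ?mproj0//.
    apply/mpolyP => k; rewrite mcoeff_part mcoeff0 mcoeffB mcoeff_mfilter mmE.
    by case: eqP => // ->; rewrite e'd subrr.
  rewrite (_ : mhomog_part _ _ = mhomog_part e u); last first.
    apply/mpolyP => k; rewrite !mcoeff_part mcoeffB mcoeff_mfilter mmE.
    by case: eqP => // ->; rewrite (negbTE de') subr0.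
  have [e'D|/part0->] := boolP (e' \in [seq mm m | m <- msupp u]);
    last by rewrite raddf0 mproj0.
  apply: contraR de' => ebad; apply: dmax => //.
  by rewrite /bad -(mhomog_part_eq _ (multE e _ erefl)).
- rewrite (_ : mhomog_part _ _ = mhomog_part d u)//.
  apply/mpolyP => k; rewrite !mcoeff_part mcoeff_mfilter mmE.
  case: eqP => // ->; rewrite (_ : [multinom _ | i < r] = d) ?Order.POrderTheory.lexx//.
  by apply/mnmP => i; rewrite mnmE.
- move=> m; rewrite mcoeff_msupp mcoeff_mfilter.
  by case: ifP => //; rewrite eqxx.
Qed.

Lemma pull_ideal_prime : prime_idealr_closed (pull_ideal P).
Proof.
move=> u v uv; apply: contraTT uv; rewrite negb_or => /andP[].
move=> /pull_ideal_lead[u1 [d [uu1 u1P u1d]]].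
move=> /pull_ideal_lead[v1 [d' [vv1 v1P v1d']]].
apply: contraNN (mprojM_notin u1P v1P) => uv; rewrite -rmorphM /=.
have : u1 * v1 \in pull_ideal P.
  have -> : u1 * v1 = u * v + (- v) * (u - u1) + (- u1) * (v - v1).
    by rewrite [- v * _]mulrC mulrN !mulNr mulrBl mulrBr !opprB !subrKC.
  exact: (pull_idealD (pull_idealD uv (pull_idealM _ uu1)) (pull_idealM _ vv1)).
move=> /pull_idealP/(_ (d + d')%MM).
suff -> : mhomog_part (d + d')%MM (u1 * v1) = mhomog_part d u1 * mhomog_part d' v1.
  by [].
rewrite {1}[u1]mpolyE mulr_suml mhomog_part_sum.
rewrite [X in _ = X * _]/mhomog_part mulr_suml [RHS]big_mkcond /=.
rewrite big_seq [RHS]big_seq; apply: eq_bigr => m mu1.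
rewrite -scalerAl mhomog_partZ mhomog_partMX.
have dE : [multinom d i | i < r] = d by apply/mnmP => i; rewrite mnmE.
have := mmE d m; rewrite /has_mdeg dE => ->.
have [md|md] := eqVneq (mm m) d.
  have mi i : mnm_mdeg m i = d i by rewrite -md mnmE.
  rewrite ifT; last by apply/forallP => i; rewrite mi mnmDE leq_addr.
  rewrite (@mhomog_part_eq _ _ _ d') -?scalerAl// => i.
  by rewrite mi mnmDE addKn.
case: ifPn => [/forallP le|_]; last by rewrite scaler0.
rewrite (_ : mhomog_part _ v1 = 0) ?mulr0 ?scaler0//.
apply/mpolyP => k; rewrite mcoeff_part mcoeff0; case: has_mdegP => // ke.
apply: memN_msupp_eq0; apply/negP => /v1d' kd'.
have mlt : (mm m < d)%O by rewrite Order.POrderTheory.lt_neqAle md u1d.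
have : ((mm m + mm k)%MM < (d + d')%MM)%O by exact: ltmc_le_add.
rewrite (_ : mm m + mm k = d + d')%MM ?Order.POrderTheory.ltxx//.
by apply/mnmP => i; rewrite !mnmDE !mnmE ke mnmDE subnKC// -mnmDE.
Qed.

Definition pull_point : mproj F r :=
  MProj pull_ideal_idealr pull_ideal_prime (@pull_ideal_part) pull_ideal_relevant.

End PullPoint.

Lemma pull_point_continuous : continuous pull_point.
Proof.
apply/continuousP => A; rewrite !openmprojE => Ao P /Ao[e [b [eb]]].
rewrite /= (pull_ideal_homog P eb) => bP bA.
exists (push_mdeg e), (coord_subst b); split=> //.
  exact: mhomog_coord_subst.
by move=> Q bQ; apply: bA; rewrite /= (pull_ideal_homog Q eb).
Qed.

(* The local homomorphism from the homogeneous localization at [pull_point P] to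
   the one at [P], [a / b |-> coord_subst a / coord_subst b]; outside of that
   local ring the value is irrelevant. *)
Definition pull_fraction (P : mproj F s) (z : {fraction R}) : {fraction S} :=
  xget 0 [set w | exists e a b,
    [/\ mhomog e a, mhomog e b, b \notin mproj_ideal (pull_point P),
        z = tofrac a / tofrac b
      & w = tofrac (coord_subst a) / tofrac (coord_subst b)]].

Lemma pull_fractionE P e a b : mhomog e a -> mhomog e b ->
  b \notin mproj_ideal (pull_point P) ->
  pull_fraction P (tofrac a / tofrac b) =
    tofrac (coord_subst a) / tofrac (coord_subst b).
Proof.
move=> ea eb bP; apply: xget_unique; first by exists e, a, b.
move=> w [e' [a' [b' [ea' eb' b'P ab ->]]]].
have b0 := mproj_notin0 bP; have b'0 := mproj_notin0 b'P.
have sb0 : coord_subst b != 0.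
  by move: bP; rewrite /= (pull_ideal_homog P eb) => /mproj_notin0.
have sb'0 : coord_subst b' != 0.
  by move: b'P; rewrite /= (pull_ideal_homog P eb') => /mproj_notin0.
apply/eqP; rewrite eqr_div ?tofrac_eq0// -!tofracM tofrac_eq -!rmorphM /=.
by rewrite (tofrac_div_inj b0 b'0 ab).
Qed.

Local Notation pre U := (opens_pre pull_point_continuous U).

Section PullSection.
Variable U : opens (mproj F r).

Definition pull_opens (x : opens_set (pre U)) : opens_set U :=
  @SigSub _ _ (mem (opens_set U)) (pull_point (val x))
    (mem_set (set_mem (valP x))).

Definition pull_fun (t : regular_sec U) (x : opens_set (pre U)) : {fraction S} :=
  pull_fraction (val x) (t (pull_opens x)).

Lemma regular_secP (t : regular_sec U) (x : opens_set U) : exists e a b,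
  [/\ mhomog e a, mhomog e b, b \notin mproj_ideal (val x)
    & t x = tofrac a / tofrac b].
Proof.
have /local_fractionP/(_ x)[V [Vx [e [e' [a [b [ea eb dE tE]]]]]]] := valP t.
have [bx tx] := tE x Vx; exists e, a, b; split=> //.
by apply: mhomogP eb => i; have := dE i; rewrite addr0 => -[].
Qed.

Lemma pull_funP (t : regular_sec U) :
  pull_fun t \in local_fraction (fun=> 0) (pre U).
Proof.
apply/local_fractionP => x.
have /local_fractionP/(_ (pull_opens x)) := valP t.
move=> [V [Vx [e [e' [a [b [ea eb dE tE]]]]]]].
have ee' : e' =1 e by move=> i; have := dE i; rewrite addr0 => -[].
have {}eb := mhomogP ee' eb.
exists (pre V); split=> //.
exists (push_mdeg e), (push_mdeg e), (coord_subst a), (coord_subst b).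
split; [exact: mhomog_coord_subst|exact: mhomog_coord_subst| |].
  by move=> i; rewrite addr0.
move=> y Vy; have [by_ ty] := tE (pull_opens y) Vy; split.
  by move: by_; rewrite /= (pull_ideal_homog _ eb).
rewrite /pull_fun ty; apply: (pull_fractionE ea eb); exact: by_.
Qed.

Definition pull_sec (t : regular_sec U) : regular_sec (pre U) :=
  TwistSec (pull_funP t).

Fact pull_sec_zmod : zmod_morphism pull_sec.
Proof.
move=> t u; apply/val_inj/funext => x; set y := pull_opens x.
have [e [a [b [ea eb by_ tE]]]] := regular_secP t y.
have [e' [a' [b' [ea' eb' b'y uE]]]] := regular_secP u y.
have sb0 : coord_subst b != 0.
  by move: by_; rewrite /= (pull_ideal_homog _ eb) => /mproj_notin0.
have sb'0 : coord_subst b' != 0.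
  by move: b'y; rewrite /= (pull_ideal_homog _ eb') => /mproj_notin0.
transitivity (pull_fraction (val x) (t y) - pull_fraction (val x) (u y)) => //.
transitivity (pull_fraction (val x) (t y - u y)) => //.
rewrite tE uE (tofrac_sub _ _ (mproj_notin0 by_) (mproj_notin0 b'y)).
rewrite (pull_fractionE ea eb by_) (pull_fractionE ea' eb' b'y).
rewrite (pull_fractionE (e := fun i => e i + e' i)%N) ?mprojM_notin//.
- have -> : coord_subst (a * b' - a' * b) =
      coord_subst a * coord_subst b' - coord_subst a' * coord_subst b.
    by rewrite rmorphB !rmorphM.
  have -> : coord_subst (b * b') = coord_subst b * coord_subst b'.
    by rewrite rmorphM.
  by apply/esym/tofrac_sub.
- apply: mhomogD; first exact: mhomogM.
  by apply: mhomogN; apply: mhomogP (mhomogM ea' eb) => i; rewrite addnC.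
- exact: mhomogM.
Qed.

Fact pull_sec_monoid : monoid_morphism pull_sec.
Proof.
split=> [|t u]; apply/val_inj/funext => x; set y := pull_opens x.
  transitivity (pull_fraction (val x) (tofrac 1 / tofrac 1)).
    by rewrite tofrac1 divr1.
  rewrite (pull_fractionE (@mhomog1 _ _) (@mhomog1 _ _) (mproj1 _)).
  by rewrite rmorph1 tofrac1 divr1.
have [e [a [b [ea eb by_ tE]]]] := regular_secP t y.
have [e' [a' [b' [ea' eb' b'y uE]]]] := regular_secP u y.
transitivity (pull_fraction (val x) (t y) * pull_fraction (val x) (u y)) => //.
transitivity (pull_fraction (val x) (t y * u y)) => //.
rewrite tE uE tofrac_mul.
rewrite (pull_fractionE ea eb by_) (pull_fractionE ea' eb' b'y).
rewrite (pull_fractionE (mhomogM ea ea') (mhomogM eb eb') (mprojM_notin by_ b'y)).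
have -> : coord_subst (a * a') = coord_subst a * coord_subst a'.
  by rewrite rmorphM.
have -> : coord_subst (b * b') = coord_subst b * coord_subst b'.
  by rewrite rmorphM.
exact/esym/tofrac_mul.
Qed.

HB.instance Definition _ :=
  GRing.isZmodMorphism.Build _ _ pull_sec pull_sec_zmod.
HB.instance Definition _ :=
  GRing.isMonoidMorphism.Build _ _ pull_sec pull_sec_monoid.

End PullSection.

Lemma pull_sec_nat (U V : opens (P1pow F r)) (h : V `<=` U)
    (h' : opens_pre pull_point_continuous V `<=` opens_pre pull_point_continuous U)
    (t : regular_sec U) :
  regular_res h' (pull_sec t) = pull_sec (regular_res h t).
Proof.
apply/val_inj/funext => x /=; rewrite /pull_fun /=; congr (pull_fraction _ _).
exact: twist_fun_irr.
Qed.

Definition P1pow_map : rsMorphism (P1pow F s) (P1pow F r) :=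
  @RSMorphism (P1pow F s) (P1pow F r) pull_point pull_point_continuous
    (fun U => @pull_sec U) pull_sec_nat.

End P1powMap.

Definition P1 (F : fieldType) : ringedSpace := P1pow F 1.
Definition P1xP1 (F : fieldType) : ringedSpace := P1pow F 2.

Definition pr1 (F : fieldType) : rsMorphism (P1xP1 F) (P1 F) :=
  P1pow_map F (fun _ : 'I_1 => ord0 : 'I_2).
Definition pr2 (F : fieldType) : rsMorphism (P1xP1 F) (P1 F) :=
  P1pow_map F (fun _ : 'I_1 => ord_max : 'I_2).
Definition diag (F : fieldType) : rsMorphism (P1 F) (P1xP1 F) :=
  P1pow_map F (fun _ : 'I_2 => ord0 : 'I_1).

(* Serre's twisting sheaf O(n). *)
Definition OP1 (F : fieldType) (n : int) : omodule (P1 F) := twist F (fun=> n).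

(* [G] is the module O_{Delta^k} (x) q^* E on P^1 x P^1 whose push-forward is
   P^k(E): along [pr1] for the left module structure, and along [pr2] for the
   right one. *)
Definition is_principal_parts (F : fieldType) (k : nat) (E : omodule (P1 F))
    (G : omodule (P1xP1 F)) : Prop :=
  is_infinitesimal_nbhd_module (diag F) (pr2 F) k E G.

Definition left_module (F : fieldType) (G : omodule (P1xP1 F)) :
  omodule (P1 F) := pushforward (pr1 F) G.

Definition right_module (F : fieldType) (G : omodule (P1xP1 F)) :
  omodule (P1 F) := pushforward (pr2 F) G.

Definition char_divides (F : fieldType) (n : nat) : Prop :=
  exists2 c : nat, c \in [pchar F] & (c %| n)%N.

(* Main.v *)
From Stdlib Require Import Ring Field.
Require Import Defs.
From HB Require Import structures.
From mathcomp Require Import all_boot all_order all_algebra.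
From mathcomp Require Import boolp classical_sets functions topology_structure.
From mathcomp Require Import mpoly zify.

Set Implicit Arguments.
Unset Strict Implicit.
Unset Printing Implicit Defensive.

Import GRing.Theory.

Local Open Scope classical_set_scope.
Local Open Scope ring_scope.

(** The space (P^1)^r is irreducible, so a section of a twisting sheaf is a single
    element of the fraction field of the coordinate ring that is regular of the
    prescribed degree at every point ([sec_const], [msec]). Everything below is
    computed with such elements.

    On P^1 x P^1 the inverse image of O(m) along the second projection is O(0, m)
    ([twist_is_pullback]). A local section t of it has degree zero in x_0, y_0, so
    x_0 t_{x_0} + y_0 t_{y_0} = 0 by Euler's identity, and on the diagonal
    t_{x_0} = y w and t_{y_0} = - x w for a unique w, of degree m - 2. If f is the
    restriction of t, the first order expansion t |-> (f, w) is a map from O(0, m)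
    to O(m) + O(m - 2) on the diagonal. It is an epimorphism, and its kernel is
    I^2 O(0, m): near a point of the diagonal I is generated by
    c = (x_0 y_1 - x_1 y_0) / (v_0 v_1), where v is x or y and does not vanish at
    the point, and the expansion of c is (0, 1 / v^2). So t is a multiple c t' as
    soon as f = 0 ([diag_factor]), then w is the restriction of t' divided by v^2,
    and t' is a multiple of c as soon as w = 0 ([taylor_ker]).

    The quotient of O(0, m) by I^2 is therefore the module [jets] of the pairs
    (f, w), on which a function a acts by its own expansion (a', delta a):
    a (f, w) = (a' f, a' w + delta(a) f). For m = 0 this is O / I^2 itself, and
    since tensoring with O / I^2 is the same as dividing by I^2
    ([quotient_tensor]), [jets] is a module of principal parts. Its universal
    properties make it the only one up to isomorphism ([principal_parts_jets]).

    It remains to read off the two structures on the pairs (f, w). A function of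
    x_1, y_1 has delta a = 0, so the right structure is that of O(m) + O(m - 2).
    For a function a of x_0, y_0 one has delta a = a_x / y. Then
    (f, w) |-> (f_x - y w, f_y + x w) is linear with values in O(m - 1)^2, and
    Euler's identity recovers m f as x (f_x - y w) + y (f_y + x w); hence it is an
    isomorphism when m is invertible in F ([left_jets_ndvd]). When m = 0 in F,
    Euler's identity says instead that f_x / y = - f_y / x is regular, of degree
    m - 2, and (f, w) |-> (f, w - f_x / y) is the required isomorphism
    ([left_jets_dvd]). *)

(** * Field identities *)

Section FieldOps.
Variable K : fieldType.

Definition kadd (x y : K) : K := x + y.
Definition kmul (x y : K) : K := x * y.
Definition ksub (x y : K) : K := x - y.
Definition kdiv (x y : K) : K := x / y.
Definition kopp (x : K) : K := - x.
Definition kinv (x : K) : K := x^-1.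
Definition kzero : K := 0.
Definition kone : K := 1.

Lemma field_theoryP :
  @field_theory (GRing.Field.sort K) kzero kone kadd kmul ksub kopp kdiv kinv eq.
Proof.
split=> //.
- by split=> //; [exact: add0r|exact: addrC|exact: addrA|exact: mul1r
    |exact: mulrC|exact: mulrA|exact: mulrDl|exact: subrr].
- by apply/eqP; rewrite oner_eq0.
- by move=> p /eqP p0; rewrite /kmul /kinv mulVf.
Qed.

End FieldOps.

(** The tactics [ring] and [field] compare operations syntactically, whereas the
    operations of a field occur under many convertible structures. Folding them
    into constants over the single carrier [K] makes them recognizable. *)
Ltac kfold K :=
  rewrite ?expr2;
  repeat match goal with
  | |- context [@GRing.add _ ?x (@GRing.opp _ ?y)] =>
      change (@GRing.add _ x (@GRing.opp _ y)) with (@ksub K x y)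
  | |- context [@GRing.mul _ ?x (@GRing.inv _ ?y)] =>
      change (@GRing.mul _ x (@GRing.inv _ y)) with (@kdiv K x y)
  | |- context [@GRing.add _ ?x ?y] =>
      change (@GRing.add _ x y) with (@kadd K x y)
  | |- context [@GRing.mul _ ?x ?y] =>
      change (@GRing.mul _ x y) with (@kmul K x y)
  | |- context [@GRing.opp _ ?x] => change (@GRing.opp _ x) with (@kopp K x)
  | |- context [@GRing.inv _ ?x] => change (@GRing.inv _ x) with (@kinv K x)
  | |- context [@GRing.zero _] => change (@GRing.zero _) with (@kzero K)
  | |- context [@GRing.one _] => change (@GRing.one _) with (@kone K)
  end;
  match goal with |- @eq _ ?x ?y => change (@eq (GRing.Field.sort K) x y) end.

Section FieldIdentities.
Variable K : fieldType.
Add Field K_field : (field_theoryP K).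

Lemma quotient_rule_wd (a b c e a' b' c' e' : K) : b != 0 -> e != 0 ->
  a * e = c * b -> a' * e + a * e' = c' * b + c * b' ->
  (a' * b - a * b') / (b * b) = (c' * e - c * e') / (e * e).
Proof.
move=> b0 e0 H1 H2; apply/eqP; rewrite eqr_div ?mulf_neq0// -subr_eq0; apply/eqP.
transitivity (b * e * (a' * e + a * e' - (c' * b + c * b')) -
   (a * e - c * b) * (b * e' + b' * e)); first by kfold K; ring.
by rewrite H1 H2 !subrr mulr0 mul0r subrr.
Qed.

Lemma quotient_ruleD (a b c e a' b' c' e' : K) : b != 0 -> e != 0 ->
  ((a' * e + a * e' + (c' * b + c * b')) * (b * e) - (a * e + c * b) * (b' * e + b * e'))
    / (b * e * (b * e)) =
  (a' * b - a * b') / (b * b) + (c' * e - c * e') / (e * e).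
Proof. by move=> /eqP b0 /eqP e0; kfold K; field; split. Qed.

Lemma quotient_ruleM (a b c e a' b' c' e' : K) : b != 0 -> e != 0 ->
  ((a' * c + a * c') * (b * e) - a * c * (b' * e + b * e')) / (b * e * (b * e)) =
  (a' * b - a * b') / (b * b) * (c / e) + a / b * ((c' * e - c * e') / (e * e)).
Proof. by move=> /eqP b0 /eqP e0; kfold K; field; split. Qed.

Lemma frac_cancel (y w : K) : y != 0 -> w != 0 -> y * w / (w * w) / y = w^-1.
Proof. by move=> /eqP y0 /eqP w0; kfold K; field; split. Qed.

Lemma frac_cancel2 (D q v w b : K) : v != 0 -> w != 0 -> b != 0 ->
  D * q / (v * b) = D / w * (q * w / (v * b)).
Proof. by move=> /eqP v0 /eqP w0 /eqP b0; kfold K; field; split. Qed.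

Lemma euler_recover (n x y f fx fy w : K) : n != 0 -> x * fx + y * fy = n * f ->
  (x * (fx - y * w) + y * (fy + x * w)) / n = f.
Proof.
move=> n0 E; have -> : x * (fx - y * w) + y * (fy + x * w) = x * fx + y * fy.
  by kfold K; ring.
by rewrite E mulrC mulKf.
Qed.

Lemma sub_div_cancel (y g u : K) : y != 0 -> g - y * ((g - u) / y) = u.
Proof. by move=> /eqP y0; kfold K; field. Qed.

Lemma add_sub_div_cancel (y g w : K) : y != 0 -> (g - (g - y * w)) / y = w.
Proof. by move=> /eqP y0; kfold K; field. Qed.

Lemma euler_second (n x y g gx gy u v : K) : y != 0 -> n != 0 ->
  x * gx + y * gy = n * g -> g = (x * u + y * v) / n -> gy + x * ((gx - u) / y) = v.
Proof.
move=> y0 n0 E gE; have {}E : x * gx + y * gy = x * u + y * v.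
  by rewrite E gE mulrC divfK.
apply: (mulfI y0); apply/eqP; rewrite -subr_eq0; apply/eqP.
transitivity (x * gx + y * gy - (x * u + y * v)); last by rewrite E subrr.
by move: y0 => /eqP y0; kfold K; field.
Qed.

Lemma euler_leibniz0 (x y r rx ry f fy w : K) : y != 0 -> x * rx + y * ry = 0 ->
  ry * f + r * fy + x * (r * w + rx / y * f) = r * (fy + x * w).
Proof.
move=> y0 E; apply: (mulfI y0); apply/eqP; rewrite -subr_eq0; apply/eqP.
transitivity ((x * rx + y * ry) * f); last by rewrite E mul0r.
by move: y0 => /eqP y0; kfold K; field.
Qed.

Lemma leibniz_left (y r rx f fx w : K) : y != 0 ->
  rx * f + r * fx - y * (r * w + rx / y * f) = r * (fx - y * w).
Proof. by move=> /eqP y0; kfold K; field. Qed.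

Lemma leibniz_shift (y r rx f fx w : K) : y != 0 ->
  r * w + rx / y * f - (rx * f + r * fx) / y = r * (w - fx / y).
Proof. by move=> /eqP y0; kfold K; field. Qed.

Lemma add_split (x y f g w w' : K) : f + g - y * (w + w') = f - y * w + (g - y * w') /\
  f + g + x * (w + w') = f + x * w + (g + x * w').
Proof. by split; kfold K; ring. Qed.

Lemma add_split_div (y f g w w' : K) : w + w' - (f + g) / y = w - f / y + (w' - g / y).
Proof. by rewrite mulrDl opprD addrACA. Qed.

End FieldIdentities.

(** * Fractions: specialization and derivation *)

Lemma fracP (R : idomainType) (z : {fraction R}) :
  exists a b : R, b != 0 /\ z = tofrac a / tofrac b.
Proof.
have [x ->] : exists x : {ratio R}, z = (\pi_({fraction R}) x)%qT.
  by exists (generic_quotient.repr z); rewrite generic_quotient.reprK.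
have d0 := denom_ratioP x.
exists (frac x).1, (frac x).2; split=> //.
have dF : tofrac (frac x).2 != 0 :> {fraction R} by rewrite tofrac_eq0.
apply: (mulIf dF); rewrite divfK //.
have tE (a : R) : tofrac a = (\pi_({fraction R}) (Ratio a 1))%qT.
  by rewrite generic_quotient.piE.
rewrite !tE.
rewrite [LHS](_ : _ = FracField.mul (\pi_({fraction R}) x)%qT
  (\pi_({fraction R}) (Ratio (frac x).2 1))%qT) //.
rewrite -FracField.pi_mul; apply/eqP.
rewrite FracField.equivf_def !numden_Ratio ?mulf_neq0 ?oner_eq0 ?mulr1//.
by rewrite mulrC.
Qed.

Lemma tofrac_cancel (R : idomainType) (v a b : R) : v != 0 ->
  tofrac (v * a) / tofrac (v * b) = tofrac a / tofrac b.
Proof. by move=> v0; rewrite -tofrac_mul divff ?mul1r// tofrac_eq0. Qed.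

Section FractionMap.
Variables (R S : idomainType) (phi : {rmorphism R -> S}).
Implicit Types (z w : {fraction R}).

(** The morphism [phi] is not assumed injective: it extends to the localization at
    its kernel only, and [frac_map] is that extension, with the value 0 outside. *)
Definition frac_map_dom z : Prop :=
  exists a b, phi b != 0 /\ z = tofrac a / tofrac b.

Definition frac_map z : {fraction S} :=
  xget 0 [set w | exists a b,
    [/\ phi b != 0, z = tofrac a / tofrac b & w = tofrac (phi a) / tofrac (phi b)]].

Lemma rmorph_neq0 b : phi b != 0 -> b != 0.
Proof. by apply: contraNneq => ->; rewrite raddf0. Qed.

Lemma frac_mapE a b : phi b != 0 ->
  frac_map (tofrac a / tofrac b) = tofrac (phi a) / tofrac (phi b).
Proof.
move=> b0; apply: xget_unique; first by exists a, b.
move=> w [a' [b' [b'0 ab ->]]]; apply/eqP.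
rewrite eqr_div ?tofrac_eq0// -!tofracM tofrac_eq -!rmorphM /=.
by rewrite (tofrac_div_inj (rmorph_neq0 b0) (rmorph_neq0 b'0) ab).
Qed.

Lemma frac_map_domD z w : frac_map_dom z -> frac_map_dom w ->
  frac_map_dom (z + w) /\ frac_map (z + w) = frac_map z + frac_map w.
Proof.
move=> [a [b [b0 ->]]] [c [d [d0 ->]]].
have E (T : idomainType) (x y u v : T) : y != 0 -> v != 0 ->
    tofrac x / tofrac y + tofrac u / tofrac v =
    tofrac (x * v + u * y) / tofrac (y * v) :> {fraction T}.
  by move=> y0 v0; rewrite tofracD !tofracM addf_div ?tofrac_eq0.
have bd0 : phi (b * d) != 0 by rewrite rmorphM mulf_neq0.
rewrite E ?rmorph_neq0 //; split; first by exists (a * d + c * b), (b * d).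
by rewrite !frac_mapE// E// rmorphD !rmorphM.
Qed.

Lemma frac_map_domM z w : frac_map_dom z -> frac_map_dom w ->
  frac_map_dom (z * w) /\ frac_map (z * w) = frac_map z * frac_map w.
Proof.
move=> [a [b [b0 ->]]] [c [d [d0 ->]]].
have bd0 : phi (b * d) != 0 by rewrite rmorphM mulf_neq0.
rewrite tofrac_mul; split; first by exists (a * c), (b * d).
by rewrite !frac_mapE// tofrac_mul !rmorphM.
Qed.

Lemma frac_map_tofrac a :
  frac_map_dom (tofrac a) /\ frac_map (tofrac a) = tofrac (phi a).
Proof.
have p1 : phi 1 != 0 by rewrite rmorph1 oner_eq0.
rewrite -[tofrac a]divr1 -tofrac1; split; first by exists a, 1.
by rewrite frac_mapE// rmorph1 tofrac1 divr1.
Qed.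

End FractionMap.

Section FractionDerivation.
Variables (F : fieldType) (n : nat).
Local Notation R := {mpoly F[n]}.
Local Notation K := {fraction R}.
Variable i : 'I_n.

(** The unique extension of a partial derivative to the field of fractions. *)
Definition frac_deriv (z : K) : K :=
  xget 0 [set w | exists a b : R, [/\ b != 0, z = tofrac a / tofrac b
    & w = tofrac (a^`M(i) * b - a * b^`M(i)) / tofrac (b * b)]].

Lemma frac_derivE (a b : R) : b != 0 ->
  frac_deriv (tofrac a / tofrac b) =
  tofrac (a^`M(i) * b - a * b^`M(i)) / tofrac (b * b).
Proof.
move=> b0; apply: xget_unique; first by exists a, b.
move=> w [c [e [e0 ab ->]]].
have H1 := tofrac_div_inj b0 e0 ab.
have H2 := congr1 (fun p => tofrac (p^`M(i)) : K) H1.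
rewrite /= !mderivM !tofracD !tofracM in H2.
rewrite !tofracB !tofracM; apply: quotient_rule_wd; rewrite ?tofrac_eq0//.
by rewrite -?tofracM ?H1.
Qed.

Lemma frac_derivD : {morph frac_deriv : z w / z + w}.
Proof.
move=> z w; have [a [b [b0 ->]]] := fracP z; have [c [e [e0 ->]]] := fracP w.
rewrite addf_div ?tofrac_eq0// -!tofracM -tofracD !frac_derivE ?mulf_neq0//.
rewrite mderivD !mderivM !(tofracB, tofracD, tofracM).
by apply: quotient_ruleD; rewrite tofrac_eq0.
Qed.

Lemma frac_derivM z w : frac_deriv (z * w) = frac_deriv z * w + z * frac_deriv w.
Proof.
have [a [b [b0 ->]]] := fracP z; have [c [e [e0 ->]]] := fracP w.
rewrite tofrac_mul !frac_derivE ?mulf_neq0//.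
rewrite !mderivM !(tofracB, tofracD, tofracM).
by apply: quotient_ruleM; rewrite tofrac_eq0.
Qed.

Lemma frac_deriv_tofrac (a : R) : frac_deriv (tofrac a) = tofrac (a^`M(i)).
Proof.
rewrite -[tofrac a]divr1 -tofrac1 frac_derivE ?oner_eq0//.
have -> : (1 : R)^`M(i) = 0 by rewrite -(mpolyC1 n F) mderivC.
by rewrite mulr0 subr0 !mulr1 tofrac1 divr1.
Qed.

Lemma frac_deriv0 : frac_deriv 0 = 0.
Proof. by rewrite -tofrac0 frac_deriv_tofrac mderiv0 tofrac0. Qed.

End FractionDerivation.

(** Chain rules such as [mderiv_coord_subst] reduce to this: both sides of a chain
    rule are derivations along the same morphism [phi], so that it is enough to
    compare them on generators. *)
Lemma mpoly_deriv_ext (F : fieldType) (n : nat) (S : comNzRingType)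
    (phi : {rmorphism {mpoly F[n]} -> S}) (D E : {mpoly F[n]} -> S) :
  {morph D : p q / p + q} -> {morph E : p q / p + q} ->
  (forall p q, D (p * q) = D p * phi q + phi p * D q) ->
  (forall p q, E (p * q) = E p * phi q + phi p * E q) ->
  (forall c, D c%:MP = E c%:MP) -> (forall i, D 'X_i = E 'X_i) -> D =1 E.
Proof.
move=> DD ED DM EM DC DX p.
have D0 : D 0 = E 0 by rewrite -(mpolyC0 n F) DC.
have Dm (m : 'X_{1..n}) : D 'X_[m] = E 'X_[m].
  rewrite mpolyXE_id.
  have P1 : D 1 = E 1 by rewrite -(mpolyC1 n F) DC.
  apply: (big_ind (fun p => D p = E p)) => // [u v Du Dv|i _].
    by rewrite DM EM Du Dv.
  by elim: (m i) => [|k IH]; rewrite ?expr0// exprS DM EM IH DX.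
elim/mpolyind: p => // c m p _ _ IH.
by rewrite DD ED IH -mul_mpolyC DM EM DC Dm.
Qed.

Lemma mpoly_rmorph_ext (F : fieldType) (n : nat) (S : pzRingType)
    (f g : {rmorphism {mpoly F[n]} -> S}) :
  (forall c, f c%:MP = g c%:MP) -> (forall i, f 'X_i = g 'X_i) -> f =1 g.
Proof.
move=> fC fX p; elim/mpolyind: p => [|c m p _ _ IH]; first by rewrite !rmorph0.
rewrite !rmorphD IH -mul_mpolyC !rmorphM fC mpolyXE_id !rmorph_prod.
congr (_ * _ + _); apply: eq_bigr => i _.
by rewrite !rmorphXn fX.
Qed.

(** * Sections of twisting sheaves as elements of the function field *)

Section Stalks.
Variables (F : fieldType) (r : nat).
Local Notation S := {mpoly F[r + r]}.
Local Notation K := {fraction S}.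
Local Notation T := (mproj F r).
Implicit Types (P Q : T) (d : 'I_r -> int) (z w : K).

(** The stalk of O(d) at P, as a subset of the field of fractions. *)
Definition Oloc d P z : Prop := exists e e' a b,
  [/\ mhomog e a, mhomog e' b, forall i, (e i)%:Z = (e' i)%:Z + d i,
      b \notin mproj_ideal P & z = tofrac a / tofrac b].

Lemma Oloc_eq d d' P z : d =1 d' -> Oloc d P z -> Oloc d' P z.
Proof.
move=> dd' [e [e' [a [b [ea eb de bP zE]]]]].
by exists e, e', a, b; split=> // i; rewrite de dd'.
Qed.

(** Numerator and denominator can be multiplied by a form that does not vanish at
    [P]; with positive degrees, truncated subtractions such as the degree of a
    derivative are exact. *)
Lemma Oloc_ge (k : nat) d P z : Oloc d P z -> exists e e' a b,
  [/\ mhomog e a, mhomog e' b, forall i, (e i)%:Z = (e' i)%:Z + d i,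
      forall i, (k <= e i)%N /\ (k <= e' i)%N
    & b \notin mproj_ideal P /\ z = tofrac a / tofrac b].
Proof.
move=> [e [e' [a [b [ea eb de bP zE]]]]].
have [u eu uP] := mproj_unit_exists P (fun=> k).
exists (fun i => e i + k)%N, (fun i => e' i + k)%N, (a * u), (b * u); split.
- exact: mhomogM.
- exact: mhomogM.
- by move=> i; have := de i; lia.
- by move=> i; rewrite !leq_addl.
- split; first exact: mprojM_notin.
  rewrite !tofracM -mulf_div divff ?mulr1//.
  by rewrite tofrac_eq0 (mproj_notin0 uP).
Qed.

Lemma Oloc0 d P : Oloc d P 0.
Proof.
pose e' (i : 'I_r) := absz (d i); pose e (i : 'I_r) := absz ((e' i)%:Z + d i).
have [b eb bP] := mproj_unit_exists P e'.
exists e, e', 0, b; split=> //; first exact: mhomog0.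
  by move=> i; rewrite /e /e'; case: (d i) => k //=; lia.
by rewrite tofrac0 mul0r.
Qed.

Lemma OlocB d P z w : Oloc d P z -> Oloc d P w -> Oloc d P (z - w).
Proof.
move=> [e [e' [a [b [ea eb dE bP ->]]]]] [f [f' [c [g [fc fg dF gP ->]]]]].
exists (fun i => e i + f' i)%N, (fun i => e' i + f' i)%N,
  (a * g - c * b), (b * g); split.
- apply: mhomogD; first exact: mhomogM.
  apply: mhomogN; apply: mhomogP (mhomogM fc eb) => i.
  by have := dE i; have := dF i; lia.
- exact: mhomogM.
- by move=> i; have := dE i; lia.
- exact: mprojM_notin.
- by apply: tofrac_sub; [exact: mproj_notin0 bP|exact: mproj_notin0 gP].
Qed.

Lemma OlocN d P z : Oloc d P z -> Oloc d P (- z).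
Proof. by rewrite -sub0r; apply: OlocB; exact: Oloc0. Qed.

Lemma OlocD d P z w : Oloc d P z -> Oloc d P w -> Oloc d P (z + w).
Proof. by move=> zP wP; rewrite -[w]opprK; apply: OlocB => //; exact: OlocN. Qed.

Lemma OlocM d d' d2 P z w : (forall i, d2 i = d i + d' i) ->
  Oloc d P z -> Oloc d' P w -> Oloc d2 P (z * w).
Proof.
move=> d2E [e [e' [a [b [ea eb dE bP ->]]]]] [f [f' [c [g [fc fg dF gP ->]]]]].
exists (fun i => e i + f i)%N, (fun i => e' i + f' i)%N, (a * c), (b * g); split.
- exact: mhomogM.
- exact: mhomogM.
- by move=> i; rewrite d2E; have := dE i; have := dF i; lia.
- exact: mprojM_notin.
- exact: tofrac_mul.
Qed.

Lemma Oloc_poly (e : 'I_r -> nat) P a : mhomog e a -> Oloc (fun i => (e i)%:Z) P (tofrac a).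
Proof.
move=> ea; exists e, (fun=> 0%N), a, 1; split=> //; first exact: mhomog1.
- exact: mproj1.
- by rewrite tofrac1 divr1.
Qed.

Lemma Oloc_const c P : Oloc (fun=> 0) P (tofrac c%:MP).
Proof.
apply: (@Oloc_poly (fun=> 0%N)) => m; rewrite msuppC.
by case: ifP => //; rewrite inE => _ /eqP -> i; rewrite /mnm_mdeg !mnm0E.
Qed.

Lemma Oloc_polyV (e : 'I_r -> nat) P a : mhomog e a -> a \notin mproj_ideal P ->
  Oloc (fun i => - (e i)%:Z) P (tofrac a)^-1.
Proof.
move=> ea aP; exists (fun=> 0%N), e, 1, a; split=> //; first exact: mhomog1.
- by move=> i; rewrite subrr.
- by rewrite tofrac1 div1r.
Qed.

Lemma Oloc_open d P z : Oloc d P z ->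
  exists U : opens T, opens_set U P /\ forall Q, opens_set U Q -> Oloc d Q z.
Proof.
move=> [e [e' [a [b [ea eb dE bP zE]]]]].
exists (nonvanishing eb); split=> // Q bQ.
by exists e, e', a, b.
Qed.

(** The homogeneous coordinates are indexed by a boolean so that the two standard
    charts of a projective line can be treated at once. *)
Definition cvar (c : bool) (i : 'I_r) : S := if c then xvar F i else yvar F i.

Arguments cvar : simpl never.

Lemma mhomog_cvar c i : mhomog (fun j => (i == j) : nat) (cvar c i).
Proof. by rewrite /cvar; case: c; [exact: mhomog_xvar|exact: mhomog_yvar]. Qed.

Lemma cvar_neq0 c i : cvar c i != 0.
Proof. by rewrite /cvar; case: c; rewrite -msupp_eq0 msuppX. Qed.

Lemma fcvar_neq0 c i : tofrac (cvar c i) != 0 :> K.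
Proof. by rewrite tofrac_eq0 cvar_neq0. Qed.

Lemma cvarXK c i (k : int) z :
  z * tofrac (cvar c i) ^ (- k) * tofrac (cvar c i) ^ k = z.
Proof. by rewrite -mulrA -expfzDr ?fcvar_neq0// addNr expr0z mulr1. Qed.

Lemma cvar_notin P i : exists c, cvar c i \notin mproj_ideal P.
Proof.
by have := mproj_relevant P i; rewrite negb_and => /orP[]; [exists true|exists false].
Qed.

Lemma Oloc_cvarX c i P (m : int) : cvar c i \notin mproj_ideal P ->
  Oloc (fun j => if i == j then m else 0) P (tofrac (cvar c i) ^ m).
Proof.
move=> cP; case: m => k.
  rewrite /exprz -tofracXn.
  apply: Oloc_eq (Oloc_poly P (mhomogX (k := k) (@mhomog_cvar c i))) => j.
  by case: (i == j); rewrite ?muln1 ?muln0.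
rewrite /exprz -tofracXn.
apply: Oloc_eq (Oloc_polyV (mhomogX (k := k.+1) (@mhomog_cvar c i))
  (mprojX_notin k.+1 cP)) => j.
by case: (i == j); rewrite ?muln1 ?muln0.
Qed.

Definition cvar_opens c i : opens T := nonvanishing (@mhomog_cvar c i).

Fact generic_idealr : idealr_closed [pred p : S | p == 0].
Proof.
split; rewrite ?inE ?oner_eq0// => a u v; rewrite !inE => /eqP-> /eqP->.
by rewrite mulr0 addr0.
Qed.
Fact generic_prime : prime_idealr_closed [pred p : S | p == 0].
Proof. by move=> u v; rewrite !inE mulf_eq0. Qed.
Fact generic_homog e (p : S) : p \in [pred p : S | p == 0] ->
  mhomog_part e p \in [pred p : S | p == 0].
Proof. by rewrite !inE => /eqP->; rewrite mhomog_part0. Qed.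
Fact generic_relevant i :
  ~~ ((xvar F i \in [pred p : S | p == 0]) && (yvar F i \in [pred p : S | p == 0])).
Proof. by rewrite !inE negb_and (@cvar_neq0 true i). Qed.

Definition generic : T :=
  MProj generic_idealr generic_prime generic_homog generic_relevant.

Lemma generic_in (U : opens T) P : opens_set U P -> opens_set U generic.
Proof.
move=> /(opens_open U) [e [b [eb bP bU]]]; apply: bU.
by rewrite /= inE (mproj_notin0 bP).
Qed.

Section Sections.
Variables (d : 'I_r -> int) (U : opens T).

Definition in_opens P (UP : opens_set U P) : opens_set U := SigSub (mem_set UP).

(** Every nonempty open subset contains the generic point, and a section is locally
    constant as a map to the field of fractions. *)
Lemma sec_const (s : twist_sec d U) x y : s x = s y.
Proof.
have gU : opens_set U generic by apply: (generic_in (set_mem (valP x))).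
suff E u : s u = s (in_opens gU) by rewrite !E.
have /local_fractionP/(_ u)[V [Vu [e [e' [a [b [ea eb dE tE]]]]]]] := valP s.
have Vg : opens_set V (val (in_opens gU)) by apply: generic_in Vu.
by have [_ ->] := tE u Vu; have [_ ->] := tE _ Vg.
Qed.

Lemma sec_Oloc (s : twist_sec d U) x : Oloc d (val x) (s x).
Proof.
have /local_fractionP/(_ x)[V [Vu [e [e' [a [b [ea eb dE tE]]]]]]] := valP s.
by have [bx sx] := tE x Vu; exists e, e', a, b.
Qed.

Lemma msecP (f : opens_set U -> K) : (forall x y, f x = f y) ->
  (forall x, Oloc d (val x) (f x)) -> f \in local_fraction d U.
Proof.
move=> fc fO; apply/local_fractionP => x.
have [e [e' [a [b [ea eb dE bP zE]]]]] := fO x.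
exists (nonvanishing eb); split=> //.
by exists e, e', a, b; split=> // y yP; split=> //; rewrite (fc y x).
Qed.

Definition msec (f : opens_set U -> K) (fc : forall x y, f x = f y)
    (fO : forall x, Oloc d (val x) (f x)) : twist_sec d U :=
  TwistSec (msecP fc fO).

Definition csec (z : K) (zO : forall P, opens_set U P -> Oloc d P z) :
    twist_sec d U :=
  @msec (fun=> z) (fun _ _ => erefl) (fun x => zO _ (set_mem (valP x))).

Lemma sec_eq (s t : twist_sec d U) : (forall x, s x = t x) -> s = t.
Proof. by move=> st; apply/val_inj/funext. Qed.

End Sections.

(** Division by a coordinate without choosing a chart: [z] is regular as soon as
    its products with both coordinates are, because one of them is invertible. *)
Lemma Oloc_div d d1 P (i : 'I_r) z :
  (forall j, d1 j = d j + ((i == j) : nat)%:Z) ->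
  (forall c, Oloc d1 P (tofrac (cvar c i) * z)) -> Oloc d P z.
Proof.
move=> d1E zO; have [c cP] := cvar_notin P i.
have c0 : tofrac (cvar c i) != 0 :> K by rewrite tofrac_eq0 cvar_neq0.
have -> : z = tofrac (cvar c i) * z * (tofrac (cvar c i))^-1 by rewrite mulrAC divff ?mul1r.
apply: OlocM (zO c) (Oloc_polyV (@mhomog_cvar c i) cP) => j.
by rewrite d1E addrK.
Qed.

End Stalks.

Arguments cvar : simpl never.

(** * Modules over a ringed space *)

Definition opensI (T : topologicalType) (U V : opens T) : opens T :=
  Opens (openI (opens_open U) (opens_open V)).

Section Modules.
Variable X : ringedSpace.

Lemma om_res_id (M : omodule X) (U : opens X) (h : U `<=` U) (s : M U) : om_res M h s = s.
Proof. by case: (om_sheaf M) => ->. Qed.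

Lemma om_res_res (M : omodule X) (U V W : opens X) (h : V `<=` U) (k : W `<=` V)
  (l : W `<=` U) (s : M U) : om_res M k (om_res M h s) = om_res M l s.
Proof. by case: (om_sheaf M) => _ ->. Qed.

Lemma om_res_irr (M : omodule X) (U V : opens X) (h h' : V `<=` U) (s : M U) :
  om_res M h s = om_res M h' s.
Proof. by rewrite (Prop_irrelevance h h'). Qed.

Lemma om_res0 (M : omodule X) (U V : opens X) (h : V `<=` U) : om_res M h 0 = 0.
Proof.
have := om_resP h 1 (0 : M U) 0.
rewrite rmorph1 !scale1r addr0 => /eqP.
by rewrite -[X in X == _]addr0 (inj_eq (addrI _)) eq_sym => /eqP.
Qed.

Lemma om_resZ (M : omodule X) (U V : opens X) (h : V `<=` U) (a : rs_sec U) (s : M U) :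
  om_res M h (a *: s) = rs_res h a *: om_res M h s.
Proof. by have := om_resP h a s 0; rewrite om_res0 !addr0. Qed.

Lemma om_eq_local (M : omodule X) (U : opens X) (s t : M U) :
  (forall x : X, opens_set U x -> exists (V : opens X) (h : V `<=` U),
     opens_set V x /\ om_res M h s = om_res M h t) -> s = t.
Proof.
move=> st; case: (om_sheaf M) => _ _ sep _.
apply: (sep U [set V : opens X | exists h : V `<=` U, om_res M h s = om_res M h t]).
- by move=> V [].
- by move=> x /st [V [h [Vx E]]]; exists V => //; exists h.
- by move=> V h [h' E]; rewrite (Prop_irrelevance h h').
Qed.

(** The gluing axiom in the form used below: a section is specified by a relation
    [R] that has at most one solution over each open subset and is solvable
    locally, so that no family of sections has to be chosen beforehand. *)
Lemma om_glue (L : omodule X) (U : opens X) (R : forall V : opens X, L V -> Prop) :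
  (forall V l l', R V l -> R V l' -> l = l') ->
  (forall (V W : opens X) (h : W `<=` V) l, R V l -> R W (om_res L h l)) ->
  (forall x, opens_set U x ->
     exists (V : opens X) (h : V `<=` U) (l : L V), opens_set V x /\ R V l) ->
  exists l : L U, forall (V : opens X) (h : V `<=` U) l', R V l' -> om_res L h l = l'.
Proof.
move=> Runiq Rres Rex; case: (om_sheaf L) => _ _ _ glue.
pose s V : L V := xget 0 [set l | R V l].
have sE V l : R V l -> s V = l.
  by move=> Rl; apply: (Runiq V) => //; apply: xgetPex; exists l.
have [|||l lP] := glue U [set V : opens X | V `<=` U /\ exists l, R V l] _ _ s.
- by move=> V [].
- by move=> x /Rex [V [h [l [Vx Rl]]]]; exists V => //; split=> //; exists l.
- move=> V V' W h h' [_ [l Rl]] [_ [l' Rl']].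
  by rewrite (sE _ _ Rl) (sE _ _ Rl'); apply: (Runiq W); exact: Rres.
- by exists l => V h l' Rl'; rewrite lP ?(sE _ _ Rl')//; split=> //; exists l'.
Qed.

Definition mk_linear (R : pzRingType) (A B : lmodType R) (f : A -> B)
  (fL : linear f) : {linear A -> B} := HB.pack f (GRing.isLinear.Build R A B *:%R f fL).

Definition om_id (M : omodule X) : omHom M M :=
  @OmHom X M M (fun U => mk_linear (f := @id (M U)) (fun _ _ _ => erefl))
    (fun _ _ _ _ => erefl).

Fact om_comp_nat (M N L : omodule X) (g : omHom N L) (f : omHom M N)
  (U V : opens X) (h : V `<=` U) (s : M U) :
  om_res L h (g U (f U s)) = g V (f V (om_res M h s)).
Proof. by rewrite !hom_nat. Qed.

Definition om_comp (M N L : omodule X) (g : omHom N L) (f : omHom M N) : omHom M L :=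
  @OmHom X M L (fun U => (g U \o f U : {linear M U -> L U})) (om_comp_nat g f).

Lemma om_iso_trans (M N L : omodule X) : om_iso M N -> om_iso N L -> om_iso M L.
Proof.
move=> [f [fb fn]] [g [gb gn]].
exists (fun V h => (g V h \o f V h : {linear M V -> L V})); split=> [V h|V W h k l s].
  exact: (bij_comp (gb V h) (fb V h)).
apply: etrans (gn V W h k l _) _; congr (g W k _); exact: fn.
Qed.

Lemma locally_free_iso (M N : omodule X) : om_iso M N -> locally_free N ->
  locally_free M.
Proof.
move=> [f [fb fn]] Nf x; have [U Ux [r [g [gb gn]]]] := Nf x.
have T (V : opens X) : V `<=` opensT X by [].
exists U => //; exists r.
exists (fun V h => (g V h \o f V (T V) : {linear M V -> om_free X r V})).
split=> [V h|V W h k l s]; first exact: (bij_comp (gb V h) (fb V (T V))).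
apply: etrans (gn V W h k l _) _; congr (g W k _); exact: fn.
Qed.

Definition om_epi (M N : omodule X) (sigma : omHom M N) : Prop :=
  forall (U : opens X) (s : N U) (x : X), opens_set U x ->
    exists (V : opens X) (h : V `<=` U), opens_set V x /\
    exists a : M V, sigma V a = om_res N h s.

Lemma epi_cancel (M N L : omodule X) (sigma : omHom M N) (g g' : omHom N L) :
  om_epi sigma -> (forall U m, g U (sigma U m) = g' U (sigma U m)) ->
  forall U z, g U z = g' U z.
Proof.
move=> sE gg' U z; apply: om_eq_local => x /(sE U z)[V [h [Vx [m mE]]]].
by exists V, h; split=> //; rewrite !hom_nat -mE gg'.
Qed.

(** An epimorphism is only locally surjective on sections: the images under [h] of
    the local preimages of [z] agree on overlaps and glue. The map [h] lives over
    the open subsets of [U] only, since in [quotient_tensor] it depends on a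
    section over [U]. *)
Lemma epi_lift (M N L : omodule X) (sigma : omHom M N) (U : opens X)
    (h : forall V : opens X, V `<=` U -> M V -> L V) :
  om_epi sigma ->
  (forall (V W : opens X) (hV : V `<=` U) (hW : W `<=` U) (k : W `<=` V) m,
     om_res L k (h V hV m) = h W hW (om_res M k m)) ->
  (forall (V : opens X) (hV : V `<=` U) m m',
     sigma V m = sigma V m' -> h V hV m = h V hV m') ->
  forall z : N U, exists l : L U, forall (V : opens X) (hV : V `<=` U) (m : M V),
    sigma V m = om_res N hV z -> om_res L hV l = h V hV m.
Proof.
move=> sE hn hk z.
pose R (V : opens X) (l : L V) :=
  exists (hV : V `<=` U) m, sigma V m = om_res N hV z /\ l = h V hV m.
have [|||l lP] := @om_glue L U R.
- move=> V l l' [hV [m [mE ->]]] [hV' [m' [m'E ->]]].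
  rewrite (Prop_irrelevance hV' hV) in m'E *.
  by apply: hk; rewrite mE m'E.
- move=> V W k l [hV [m [mE ->]]].
  have hW : W `<=` U by move=> y /k /hV.
  exists hW, (om_res M k m); split; last exact: hn.
  by rewrite -hom_nat mE (om_res_res _ _ hW).
- move=> x Ux; have [V [hV [Vx [m mE]]]] := sE U z x Ux.
  by exists V, hV, (h V hV m); split=> //; exists hV, m.
- by exists l => V hV m mE; apply: lP; exists hV, m.
Qed.

Lemma epi_factor (M N L : omodule X) (sigma : omHom M N) (h : omHom M L) :
  om_epi sigma -> (forall U m, sigma U m = 0 -> h U m = 0) ->
  exists g : omHom N L, forall U m, g U (sigma U m) = h U m.
Proof.
move=> sE hk.
have hk' U m m' : sigma U m = sigma U m' -> h U m = h U m'.
  move=> /eqP; rewrite -subr_eq0 -linearB => /eqP/hk/eqP.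
  by rewrite linearB subr_eq0 => /eqP.
have ex U (z : N U) := @epi_lift M N L sigma U (fun V _ => h V) sE
  (fun V W _ _ k m => hom_nat h k m) (fun V _ => @hk' V) z.
pose g U z := sval (cid (ex U z)).
have gP (U : opens X) (z : N U) (V : opens X) (hV : V `<=` U) m : sigma V m = om_res N hV z ->
    om_res L hV (g U z) = h V m.
  by rewrite /g; case: cid => l /= lP; exact: lP.
have gs U m : g U (sigma U m) = h U m.
  have UU : U `<=` U by [].
  by rewrite -[LHS](om_res_id UU) (gP _ _ _ _ m)// om_res_id.
have gL U : linear (g U).
  move=> a s t; apply: om_eq_local => x Ux.
  have [V [hV [Vx [m mE]]]] := sE U s x Ux.
  have [W [hW [Wx [m' m'E]]]] := sE V (om_res N hV t) x Vx.
  have hWU : W `<=` U by move=> y /hW /hV.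
  exists W, hWU; split=> //; rewrite om_resP.
  have sm : sigma W (om_res M hW m) = om_res N hWU s.
    by rewrite -hom_nat mE (om_res_res _ _ hWU).
  have tm : sigma W m' = om_res N hWU t by rewrite m'E (om_res_res _ _ hWU).
  rewrite (gP _ _ _ _ _ sm) (gP _ _ _ _ _ tm) -linearP; apply: gP.
  by rewrite linearP om_resP sm tm.
have gn (U V : opens X) (k : V `<=` U) (s : N U) : om_res L k (g U s) = g V (om_res N k s).
  apply: om_eq_local => x Vx.
  have [W [hW [Wx [m mE]]]] := sE V (om_res N k s) x Vx.
  have hWU : W `<=` U by move=> y /hW /k.
  exists W, hW; split=> //; rewrite (om_res_res _ _ hWU) (gP _ _ _ _ m mE).
  by rewrite (gP _ _ _ _ m) // mE (om_res_res _ _ hWU).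
by exists (@OmHom X N L (fun U => mk_linear (gL U)) gn).
Qed.

(** With [J] the kernel of [pi], the hypotheses say that [Q] is [O / J] and that
    [N] is [M / J M]. The bilinear map sends the class of [a] and [t] to the class
    of [a *: t], and a bilinear map [b] out of [Q] and [M] factors through [N]
    because [b (pi 1) t] is killed by [J]. *)
Lemma quotient_tensor (Q M N : omodule X) (pi : omHom (om_structure X) Q)
    (sigma : omHom M N) :
  om_epi pi -> om_epi sigma ->
  (forall (U : opens X) (a : rs_sec U) (t : M U), pi U a = 0 -> a *: sigma U t = 0) ->
  (forall (U : opens X) (t : M U) (x : X), opens_set U x -> sigma U t = 0 ->
     exists (V : opens X) (h : V `<=` U), opens_set V x /\
     exists (a : rs_sec V) (t' : M V), pi V a = 0 /\ om_res M h t = a *: t') ->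
  exists tau : omBilinear Q M N, is_tensor tau.
Proof.
move=> pE sE K1 K2.
pose O := om_structure X.
have ex (U : opens X) (s : Q U) (t : M U) : exists l : N U,
    forall (V : opens X) (hV : V `<=` U) (a : O V),
    pi V a = om_res Q hV s -> om_res N hV l = (a : rs_sec V) *: sigma V (om_res M hV t).
  apply: (@epi_lift O Q N pi U (fun V hV (a : O V) =>
    (a : rs_sec V) *: sigma V (om_res M hV t)) pE).
    move=> V W hV hW k a; rewrite om_resZ; congr (_ *: _).
    by rewrite hom_nat (om_res_res _ _ hW).
  move=> V hV a a' /eqP; rewrite -subr_eq0 -linearB => /eqP /K1 K.
  by apply/eqP; rewrite -subr_eq0 -scalerBl; apply/eqP; exact: K.
pose tau (U : opens X) (s : Q U) (t : M U) : N U := sval (cid (ex U s t)).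
have tauP (U V : opens X) (hV : V `<=` U) s t (a : O V) : pi V a = om_res Q hV s ->
    om_res N hV (tau U s t) = (a : rs_sec V) *: sigma V (om_res M hV t).
  by rewrite /tau; case: cid => l /= lP; exact: lP.
have tauE (U : opens X) (a : O U) t : tau U (pi U a) t = (a : rs_sec U) *: sigma U t.
  have UU : U `<=` U by [].
  by rewrite -[LHS](om_res_id UU) (tauP _ _ _ _ _ a) ?om_res_id.
have taul (U : opens X) (t : M U) : linear (fun s => tau U s t).
  move=> u s s'; apply: om_eq_local => x Ux.
  have [V [hV [Vx [a aE]]]] := pE U s x Ux.
  have [W [hW [Wx [a' a'E]]]] := pE V (om_res Q hV s') x Vx.
  have hWU : W `<=` U by move=> y /hW /hV.
  exists W, hWU; split=> //; rewrite om_resP.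
  have sa : pi W (om_res O hW a) = om_res Q hWU s.
    by rewrite -hom_nat aE (om_res_res _ _ hWU).
  have ta : pi W a' = om_res Q hWU s' by rewrite a'E (om_res_res _ _ hWU).
  rewrite (tauP _ _ _ _ _ _ sa) (tauP _ _ _ _ _ _ ta) scalerA -scalerDl.
  apply: tauP; have := linearP (pi W) (rs_res hWU u) (om_res O hW a) a'.
  by rewrite sa ta -om_resP => <-.
have taur (U : opens X) (s : Q U) : linear (tau U s).
  move=> u t t'; apply: om_eq_local => x Ux.
  have [V [hV [Vx [a aE]]]] := pE U s x Ux.
  exists V, hV; split=> //; rewrite om_resP !(tauP _ _ _ _ _ a)//.
  by rewrite om_resP linearP scalerDr !scalerA mulrC.
have taun (U V : opens X) (h : V `<=` U) (s : Q U) (t : M U) :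
    om_res N h (tau U s t) = tau V (om_res Q h s) (om_res M h t).
  apply: om_eq_local => x Vx.
  have [W [hW [Wx [a aE]]]] := pE V (om_res Q h s) x Vx.
  have hWU : W `<=` U by move=> y /hW /h.
  exists W, hW; split=> //; rewrite (om_res_res _ _ hWU) (tauP _ _ hW _ _ a)//.
  by rewrite (om_res_res _ _ hWU) (tauP _ _ hWU _ _ a) // aE (om_res_res _ _ hWU).
exists (OmBilinear taul taur taun) => L b /=; split.
  have hL (U : opens X) : linear (fun t => b U (pi U (1 : rs_sec U)) t).
    exact: bil_linr.
  have hn (U V : opens X) (h : V `<=` U) (s : M U) :
    om_res L h (mk_linear (hL U) s) = mk_linear (hL V) (om_res M h s).
    apply: etrans (bil_nat b h _ _) _; congr (b V _ _).
    apply: etrans (hom_nat pi h _) _; congr (pi V _).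
    exact: rmorph1.
  have b1 (U : opens X) (a : O U) t :
      b U (pi U a) t = (a : rs_sec U) *: b U (pi U (1 : rs_sec U)) t.
    have := bil_linl b t (a : rs_sec U) (pi U (1 : rs_sec U)) 0.
    have -> : b U 0 t = 0.
      have := bil_linl b t (-1) 0 (0 : Q U).
      by rewrite scaler0 add0r scaleN1r addNr.
    rewrite !addr0 => <-; rewrite -linearZ /=; congr (b U (pi U _) _).
    by rewrite [RHS]mulr1.
  have [|g gP] := @epi_factor M N L sigma (OmHom hn) sE.
    move=> U t t0; apply: om_eq_local => x Ux.
    have [V [h [Vx [a [t' [a0 tE]]]]]] := K2 U t x Ux t0.
    exists V, h; split=> //; rewrite hom_nat om_res0 tE linearZ /=.
    rewrite -b1 a0.
    have := bil_linl b t' (-1) 0 (0 : Q V).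
    by rewrite scaler0 add0r scaleN1r addNr.
  exists g => U s t; apply: om_eq_local => x Ux.
  have [V [h [Vx [a aE]]]] := pE U s x Ux.
  exists V, h; split=> //; rewrite hom_nat (tauP _ _ _ _ _ a)// linearZ /= gP /=.
  by rewrite -b1 aE bil_nat.
move=> g g' gg' U z; apply: (epi_cancel sE) => V m.
by have := gg' V (pi V (1 : rs_sec V)) m; rewrite /= tauE scale1r.
Qed.

Lemma tensor_unique (M N T T' : omodule X) (tau : omBilinear M N T)
    (tau' : omBilinear M N T') : is_tensor tau -> is_tensor tau' ->
  exists (f : omHom T T') (g : omHom T' T),
    (forall U s, g U (f U s) = s) /\ (forall U s, f U (g U s) = s).
Proof.
move=> tT tT'; have [[f fE] _] := tT _ tau'; have [[g gE] _] := tT' _ tau.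
exists f, g; split=> U s.
  have [_ u] := tT _ tau; apply: (u (om_comp g f) (om_id T)) => V a b /=.
  by rewrite fE gE.
have [_ u] := tT' _ tau'; apply: (u (om_comp f g) (om_id T')) => V a b /=.
by rewrite gE fE.
Qed.

End Modules.

Lemma pushforward_iso (X Y : ringedSpace) (q : rsMorphism X Y) (M N : omodule X)
    (f : omHom M N) (g : omHom N M) :
  (forall U s, g U (f U s) = s) -> (forall U s, f U (g U s) = s) ->
  om_iso (pushforward q M) (pushforward q N).
Proof.
move=> gf fg.
have fL (U : opens Y) :
    linear (f (mor_pre q U) : pushforward q M U -> pushforward q N U).
  by move=> a s t; apply: linearP.
exists (fun V _ => mk_linear (fL V)); split=> [V _|V W h k l s].
  by exists (g (mor_pre q V)) => s; [exact: gf|exact: fg].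
exact: (@hom_nat _ _ _ f (mor_pre q V) (mor_pre q W)).
Qed.

Lemma pullback_unique (X Y : ringedSpace) (q : rsMorphism X Y) (E : omodule Y)
    (G G' : omodule X) (eta : omHom E (pushforward q G))
    (eta' : omHom E (pushforward q G')) : is_pullback eta -> is_pullback eta' ->
  exists (f : omHom G G') (g : omHom G' G),
    (forall U s, g U (f U s) = s) /\ (forall U s, f U (g U s) = s).
Proof.
move=> pG pG'; have [[f fE] _] := pG _ eta'; have [[g gE] _] := pG' _ eta.
exists f, g; split=> U s.
  have [_ u] := pG _ eta; apply: (u (om_comp g f) (om_id G)) => V a /=.
  by rewrite fE gE.
have [_ u] := pG' _ eta'; apply: (u (om_comp f g) (om_id G')) => V a /=.
by rewrite gE fE.
Qed.

(** * Specialization along coordinate maps *)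

Section Derivatives.
Variables (F : fieldType) (r : nat).
Local Notation S := {mpoly F[r + r]}.
Implicit Types (p q : S) (d : 'I_r -> int) (P : mproj F r).

Definition cidx (c : bool) (i : 'I_r) : 'I_(r + r) :=
  if c then lshift r i else rshift r i.

Lemma cvarE c i : cvar F c i = 'X_(cidx c i).
Proof. by case: c. Qed.

Lemma cidx_cases (k : 'I_(r + r)) : exists c i, k = cidx c i.
Proof.
by rewrite -(splitK k); case: (fintype.split k) => i; [exists true, i|exists false, i].
Qed.

Lemma cidx_eq c c' i i' : (cidx c i == cidx c' i') = (c == c') && (i == i').
Proof.
by case: c; case: c'; rewrite /= ?eq_lshift ?eq_rshift ?eq_lrshift ?eq_rlshift.
Qed.

Lemma mderiv_cvar c c' i j :
  (cvar F c i)^`M(cidx c' j) = ((c' == c) && (j == i))%:R.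
Proof.
rewrite cvarE mderivX mnm1E eq_sym cidx_eq.
case: eqP => [->|]; case: eqP => [->|] /=; rewrite ?scale0r//.
by rewrite -{1}[U_(_)%MM]add0m addmK scale1r mpolyX0.
Qed.

Lemma mnm_mdegE m i c : mnm_mdeg m i = (m (cidx c i) + m (cidx (~~ c) i))%N.
Proof. by case: c => //=; rewrite addnC. Qed.

Lemma mhomog_mderiv e c i p : mhomog e p ->
  mhomog (fun j => e j - (i == j))%N (p^`M(cidx c i)).
Proof.
move=> ep m; rewrite mcoeff_msupp mcoeff_deriv => pm.
have /ep mE : (m + U_(cidx c i))%MM \in msupp p.
  by rewrite mcoeff_msupp; apply: contraNneq pm => ->; rewrite mul0rn.
move=> j; rewrite -mE !(mnm_mdegE _ _ c) !mnmDE !mnm1E !cidx_eq eqxx /=.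
by case: c {pm mE} => /=; case: (i == j); lia.
Qed.

Lemma euler_mnm (m : 'X_{1..r + r}) (k : 'I_(r + r)) :
  'X_k * ('X_[m] : S)^`M(k) = (m k)%:R *: 'X_[m].
Proof.
rewrite mderivX -scalerAr -mpolyXD; have [->|mk] := posnP (m k); first by rewrite !scale0r.
by congr (_ *: 'X_[_]); rewrite addmC submK// lep1mP -lt0n.
Qed.

Lemma euler_mpoly e i p : mhomog e p ->
  xvar F i * p^`M(cidx true i) + yvar F i * p^`M(cidx false i) = (e i)%:R * p.
Proof.
move=> ep; rewrite [p]mpolyE !raddf_sum !mulr_sumr -big_split /=.
rewrite [LHS]big_seq [RHS]big_seq; apply: eq_bigr => m /ep mE.
rewrite !mderivZ -!scalerAr -scalerDr !euler_mnm -scalerDl -natrD -mE.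
by rewrite mulr_natl scaler_nat.
Qed.

Lemma euler_frac d P i z : Oloc d P z ->
  tofrac (xvar F i) * frac_deriv (cidx true i) z +
  tofrac (yvar F i) * frac_deriv (cidx false i) z = (d i)%:~R * z.
Proof.
move=> [e [e' [a [b [ea eb dE bP ->]]]]]; have b0 := mproj_notin0 bP.
rewrite !frac_derivE// !mulrA -!tofracM -mulrDl -tofracD !mulrBr.
have -> : xvar F i * (a^`M(cidx true i) * b) - xvar F i * (a * b^`M(cidx true i)) +
    (yvar F i * (a^`M(cidx false i) * b) - yvar F i * (a * b^`M(cidx false i))) =
    (e i)%:R * a * b - a * ((e' i)%:R * b).
  rewrite -(euler_mpoly i ea) -(euler_mpoly i eb) mulrDl mulrDr opprD !mulrA.
  by rewrite ![_ * a]mulrC addrACA.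
have -> : (e i)%:R * a * b - a * ((e' i)%:R * b) = (d i)%:~R * (a * b).
  have -> : (e i)%:R = (e' i)%:R + (d i)%:~R :> S.
    by rewrite -[(e i)%:R]/((e i)%:Z%:~R) dE rmorphD.
  by rewrite mulrDl mulrDl [a * _]mulrCA !mulrA addrAC subrr add0r.
rewrite -[RHS]mulrA; have -> : tofrac a / tofrac b = tofrac (a * b) / tofrac (b * b).
  by rewrite -tofrac_mul divff ?mulr1 // tofrac_eq0.
by rewrite tofracM rmorph_int mulrA.
Qed.

Lemma Oloc_deriv d d' P c i z : (forall j, d j = d' j + ((i == j) : nat)%:Z) ->
  Oloc d P z -> Oloc d' P (frac_deriv (cidx c i) z).
Proof.
move=> dd' /(Oloc_ge 1)[e [e' [a [b [ea eb dE e1 [bP ->]]]]]].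
rewrite frac_derivE ?(mproj_notin0 bP)//.
exists (fun j => e j - (i == j) + e' j)%N, (fun j => e' j + e' j)%N.
exists (a^`M(cidx c i) * b - a * b^`M(cidx c i)), (b * b); split=> //.
- apply: mhomogD; first exact: mhomogM (mhomog_mderiv ea) eb.
  apply: mhomogN; apply: mhomogP (mhomogM ea (mhomog_mderiv eb)) => j.
  by have := e1 j; case: (i == j); lia.
- exact: mhomogM.
- move=> j; have := dE j; have := dd' j; have := e1 j; case: (i == j) => /=; lia.
- exact: mprojM_notin.
Qed.

End Derivatives.

Section CoordMap.
Variables (F : fieldType) (r s : nat) (f : 'I_r -> 'I_s).
Local Notation R := {mpoly F[r + r]}.
Local Notation S := {mpoly F[s + s]}.

Lemma coord_substC c : coord_subst f (c%:MP : R) = c%:MP.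
Proof. exact: comp_mpolyC. Qed.

Lemma coord_subst_cvar c i : coord_subst f (cvar F c i) = cvar F c (f i).
Proof.
rewrite cvarE /coord_subst comp_mpolyXU -tnth_nth tnth_mktuple /coord_map.
by case: c; rewrite /= ?(unsplitK (inl i)) ?(unsplitK (inr i)).
Qed.

Definition frac_pull : {fraction R} -> {fraction S} := frac_map (coord_subst f).
Definition frac_pull_dom : {fraction R} -> Prop := frac_map_dom (coord_subst f).

Lemma pull_sharpE (U : opens (P1pow F r)) (t : rs_sec U) x :
  (mor_sharp (P1pow_map F f) U t : regular_sec _) x =
  frac_pull ((t : regular_sec U) (pull_opens x)).
Proof.
have [e [a [b [ea eb bP tE]]]] := regular_secP (t : regular_sec U) (pull_opens x).
rewrite /= /pull_fun tE (pull_fractionE ea eb bP) /frac_pull frac_mapE//.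
by move: bP; rewrite /= (@pull_ideal_homog _ _ _ f _ _ _ eb) => /mproj_notin0.
Qed.

(** The degree of the inverse image: the coordinates of the factors that [f]
    identifies have their degrees added. *)
Definition push_deg (d : 'I_r -> int) (j : 'I_s) : int := \sum_(i | f i == j) d i.

Lemma Oloc_pull d P z : Oloc d (pull_point f P) z ->
  frac_pull_dom z /\ Oloc (push_deg d) P (frac_pull z).
Proof.
move=> [e [e' [a [b [ea eb dE bP ->]]]]].
have bP' : coord_subst f b \notin mproj_ideal P.
  by move: bP; rewrite /= (@pull_ideal_homog _ _ _ f _ _ _ eb).
have b0 := mproj_notin0 bP'; split; first by exists a, b.
rewrite /frac_pull frac_mapE//.
exists (push_mdeg f e), (push_mdeg f e'), (coord_subst f a), (coord_subst f b).
split=> //; [exact: mhomog_coord_subst|exact: mhomog_coord_subst|].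
move=> j; rewrite /push_mdeg /push_deg !(big_morph Posz PoszD (erefl 0%:Z)) -big_split.
by apply: eq_bigr => i _; rewrite dE.
Qed.

Lemma mderiv_coord_subst (p : R) c j :
  (coord_subst f p)^`M(cidx c j) = \sum_(i | f i == j) coord_subst f (p^`M(cidx c i)).
Proof.
apply: (mpoly_deriv_ext (phi := coord_subst f)
  (D := fun p => (coord_subst f p)^`M(cidx c j))
  (E := fun p => \sum_(i | f i == j) coord_subst f (p^`M(cidx c i)))).
- by move=> u v; rewrite rmorphD mderivD.
- move=> u v; rewrite -big_split; apply: eq_bigr => i _.
  by rewrite mderivD rmorphD.
- by move=> u v; rewrite rmorphM mderivM.
- move=> u v; rewrite mulr_suml mulr_sumr -big_split; apply: eq_bigr => i _.
  by rewrite mderivM rmorphD !rmorphM.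
- move=> k; rewrite coord_substC mderivC big1// => i _.
  by rewrite mderivC rmorph0.
- move=> k; have [c' [i ->]] := cidx_cases k.
  rewrite -cvarE coord_subst_cvar mderiv_cvar.
  under eq_bigr do rewrite mderiv_cvar rmorph_nat.
  rewrite big_mkcond (bigD1 i)//= big1 => [|l li].
    rewrite eqxx andbT addr0 [_ == f i]eq_sym.
    by case: (f i == j); rewrite ?andbF ?andbT.
  by rewrite (negbTE li) andbF if_same.
Qed.

End CoordMap.

Lemma coord_subst_comp (F : fieldType) (r s t : nat) (f : 'I_r -> 'I_s)
    (g : 'I_s -> 'I_t) (p : {mpoly F[r + r]}) :
  coord_subst g (coord_subst f p) = coord_subst (g \o f) p.
Proof.
apply: (mpoly_rmorph_ext (f := coord_subst g \o coord_subst f) (g := coord_subst (g \o f))).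
  by move=> c; rewrite /= !coord_substC.
by move=> k; have [c [i ->]] := cidx_cases k; rewrite -cvarE /= !coord_subst_cvar.
Qed.

Lemma coord_subst_id (F : fieldType) (r : nat) (f : 'I_r -> 'I_r) (p : {mpoly F[r + r]}) :
  f =1 id -> coord_subst f p = p.
Proof.
move=> fid; apply: (mpoly_rmorph_ext (f := coord_subst f) (g := idfun)).
  by move=> c; rewrite /= !coord_substC.
by move=> k; have [c [i ->]] := cidx_cases k; rewrite -cvarE /= !coord_subst_cvar fid.
Qed.

Section SmallMaps.
Variables (F : fieldType) (s : nat) (f : 'I_1 -> 'I_s).
Local Notation R := {mpoly F[1 + 1]}.

(** This map of factors induces the diagonal of (P^1)^s. It is a left inverse of
    every map from one factor, which makes inverse images along projections
    injective. *)
Definition collapse (_ : 'I_s) : 'I_1 := ord0.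

Lemma collapseK (p : R) : coord_subst collapse (coord_subst f p) = p.
Proof. by rewrite coord_subst_comp coord_subst_id// => i; rewrite [i]ord1. Qed.

Lemma coord_subst1_neq0 (p : R) : p != 0 -> coord_subst f p != 0.
Proof. by apply: contraNneq => p0; rewrite -[p]collapseK p0 rmorph0. Qed.

Lemma frac_pull1_dom (z : {fraction R}) : frac_pull_dom f z.
Proof.
by have [a [b [b0 ->]]] := fracP z; exists a, b; rewrite coord_subst1_neq0.
Qed.

Lemma frac_pull1D : {morph @frac_pull F 1 s f : z w / z + w}.
Proof. by move=> z w; have [] := frac_map_domD (frac_pull1_dom z) (frac_pull1_dom w). Qed.

Lemma frac_pull1M : {morph @frac_pull F 1 s f : z w / z * w}.
Proof. by move=> z w; have [] := frac_map_domM (frac_pull1_dom z) (frac_pull1_dom w). Qed.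

Lemma frac_pull_tofrac (p : R) : frac_pull f (tofrac p) = tofrac (coord_subst f p).
Proof. by have [] := frac_map_tofrac (coord_subst f) p. Qed.

Lemma frac_pull1K (z : {fraction R}) :
  frac_pull_dom collapse (frac_pull f z) /\
  frac_pull collapse (frac_pull f z) = z.
Proof.
have [a [b [b0 ->]]] := fracP z; have sb0 := coord_subst1_neq0 b0.
rewrite /frac_pull frac_mapE//; split.
  by exists (coord_subst f a), (coord_subst f b); split=> //=; rewrite collapseK.
by rewrite frac_mapE /= !collapseK.
Qed.

Lemma frac_deriv_pull c j (z : {fraction R}) :
  frac_deriv (cidx c j) (frac_pull f z) =
  if f ord0 == j then frac_pull f (frac_deriv (cidx c ord0) z) else 0.
Proof.
have [a [b [b0 ->]]] := fracP z; have sb0 := coord_subst1_neq0 b0.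
have mE (p : R) : (coord_subst f p)^`M(cidx c j) =
    if f ord0 == j then coord_subst f (p^`M(cidx c ord0)) else 0.
  by rewrite mderiv_coord_subst big_mkcond big_ord1.
rewrite /frac_pull frac_mapE// frac_derivE// !mE frac_derivE//.
case: ifP => _; last by rewrite mul0r mulr0 subr0 tofrac0 mul0r.
rewrite frac_mapE; last by rewrite rmorphM mulf_neq0.
by congr (tofrac _ / tofrac _); rewrite /= ?rmorphB !rmorphM.
Qed.

End SmallMaps.

(** * First order expansions along the diagonal *)

Section Diagonal.
Variable F : fieldType.
Local Notation S1 := {mpoly F[1 + 1]}.
Local Notation S2 := {mpoly F[2 + 2]}.
Local Notation i0 := (ord0 : 'I_2).
Local Notation i1 := (ord_max : 'I_2).
Local Notation j0 := (ord0 : 'I_1).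
Implicit Types (d : 'I_2 -> int) (t u : {fraction S2}) (P : mproj F 1) (Q : mproj F 2).

(** The localization at the kernel of the restriction to the diagonal. *)
Definition at_diag t : Prop := frac_pull_dom (@collapse 2) t.
Definition restr t : {fraction S1} := frac_pull (@collapse 2) t.

Lemma restrD t u : at_diag t -> at_diag u -> restr (t + u) = restr t + restr u.
Proof. by move=> dt du; have [] := frac_map_domD dt du. Qed.
Lemma at_diagM t u : at_diag t -> at_diag u -> at_diag (t * u).
Proof. by move=> dt du; have [] := frac_map_domM dt du. Qed.
Lemma restrM t u : at_diag t -> at_diag u -> restr (t * u) = restr t * restr u.
Proof. by move=> dt du; have [] := frac_map_domM dt du. Qed.
Lemma at_diag_tofrac (p : S2) : at_diag (tofrac p).
Proof. by have [] := frac_map_tofrac (coord_subst (@collapse 2)) p. Qed.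
Lemma restr_tofrac (p : S2) : restr (tofrac p) = tofrac (coord_subst (@collapse 2) p).
Proof. by have [] := frac_map_tofrac (coord_subst (@collapse 2)) p. Qed.
Lemma restr0 : restr 0 = 0.
Proof. by rewrite -(tofrac0 S2) restr_tofrac raddf0 tofrac0. Qed.
Lemma at_diag_deriv i t : at_diag t -> at_diag (frac_deriv i t).
Proof.
move=> [a [b [b0 ->]]]; rewrite frac_derivE ?(rmorph_neq0 b0)//.
by exists (a^`M(i) * b - a * b^`M(i)), (b * b); rewrite rmorphM mulf_neq0.
Qed.

Lemma at_diag_Oloc d P t : Oloc d (pull_point (@collapse 2) P) t -> at_diag t.
Proof. by move=> /Oloc_pull[]. Qed.

Lemma push_deg_collapse (d : 'I_2 -> int) : push_deg (@collapse 2) d =1 fun=> d i0 + d i1.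
Proof.
move=> j; rewrite /push_deg (eq_bigl predT) => [|i]; last by rewrite [j]ord1 eqxx.
by rewrite big_ord_recl big_ord1; congr (_ + d _); apply: val_inj.
Qed.

Lemma restr_Oloc d P t : Oloc d (pull_point (@collapse 2) P) t ->
  Oloc (fun=> d i0 + d i1) P (restr t).
Proof. by move=> /Oloc_pull[_]; apply: Oloc_eq; exact: push_deg_collapse. Qed.

(** The second component of the first order expansion. By Euler's identity the
    restriction of [d t / d y_0] is then [- x * delta t] when [t] has degree zero
    in the first variables, whence the regularity where [y] vanishes
    ([delta_Oloc]). *)
Definition delta t : {fraction S1} :=
  restr (frac_deriv (cidx true i0) t) / tofrac (yvar F j0).

Lemma deltaD t u : at_diag t -> at_diag u -> delta (t + u) = delta t + delta u.
Proof.
by move=> dt du; rewrite /delta frac_derivD restrD ?mulrDl//; exact: at_diag_deriv.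
Qed.

Lemma deltaM t u : at_diag t -> at_diag u ->
  delta (t * u) = restr t * delta u + delta t * restr u.
Proof.
move=> dt du; have dt' := at_diag_deriv (cidx true i0) dt.
have du' := at_diag_deriv (cidx true i0) du.
rewrite /delta frac_derivM restrD; try exact: at_diagM.
by rewrite !restrM// mulrDl addrC -mulrA [in X in _ + X]mulrAC.
Qed.

Lemma restr_pull (f : 'I_1 -> 'I_2) z : at_diag (frac_pull f z) /\ restr (frac_pull f z) = z.
Proof. exact: frac_pull1K. Qed.

Lemma delta_pull (f : 'I_1 -> 'I_2) z : delta (frac_pull f z) =
  if f ord0 == i0 then frac_deriv (cidx true j0) z / tofrac (yvar F j0) else 0.
Proof.
rewrite /delta frac_deriv_pull; case: ifP => _; first by rewrite (restr_pull f _).2.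
by rewrite restr0 mul0r.
Qed.

Lemma delta_Oloc d P t : d i0 = 0 -> Oloc d (pull_point (@collapse 2) P) t ->
  Oloc (fun=> d i1 - 2) P (delta t).
Proof.
move=> d0 tO; pose d' j := d j - ((i0 == j) : nat)%:Z.
have dO c : Oloc (fun=> d i1 - 1) P (restr (frac_deriv (cidx c i0) t)).
  have /restr_Oloc : Oloc d' (pull_point (@collapse 2) P) (frac_deriv (cidx c i0) t).
    by apply: Oloc_deriv tO => j; rewrite /d'; lia.
  by apply: Oloc_eq => j; rewrite /d' /= d0; lia.
have y0 : tofrac (yvar F j0) != 0 :> {fraction S1}.
  by rewrite tofrac_eq0 (@cvar_neq0 _ _ false).
apply: (@Oloc_div _ _ _ (fun=> d i1 - 1) P j0) => [j|[]].
- by rewrite [j]ord1 eqxx /=; lia.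
- have := euler_frac i0 tO; rewrite d0 mulr0z mul0r => /(congr1 restr).
  rewrite restr0 restrD; try (apply: at_diagM;
    [exact: at_diag_tofrac|exact: at_diag_deriv (at_diag_Oloc tO)]).
  rewrite !restrM; try exact: at_diag_tofrac; try exact: at_diag_deriv (at_diag_Oloc tO).
  rewrite !restr_tofrac (@coord_subst_cvar _ _ _ _ true) (@coord_subst_cvar _ _ _ _ false).
  move=> /eqP; rewrite addr_eq0 => /eqP E.
  rewrite /delta mulrA E mulNr; apply: OlocN.
  suff -> : tofrac (cvar F false j0) * restr (frac_deriv (cidx false i0) t) /
     tofrac (yvar F j0) = restr (frac_deriv (cidx false i0) t) by exact: dO.
  by rewrite mulrAC divff ?mul1r.
- by rewrite /delta mulrCA divff// mulr1; exact: dO.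
Qed.

End Diagonal.

Section DiagonalIdeal.
Variable F : fieldType.
Local Notation S1 := {mpoly F[1 + 1]}.
Local Notation S2 := {mpoly F[2 + 2]}.
Local Notation i0 := (ord0 : 'I_2).
Local Notation i1 := (ord_max : 'I_2).
Local Notation j0 := (ord0 : 'I_1).
Local Notation K2 := {fraction S2}.
Local Notation dg := (@collapse 2).
Local Notation p2 := (fun _ : 'I_1 => i1).
Implicit Types (d : 'I_2 -> int) (t : K2) (P : mproj F 1) (Q : mproj F 2).

Definition diag_eq : S2 := xvar F i0 * yvar F i1 - xvar F i1 * yvar F i0.

Definition eqmod_diag (p q : S2) : Prop := exists u, p - q = diag_eq * u.

Lemma eqmod_diag_refl p : eqmod_diag p p.
Proof. by exists 0; rewrite subrr mulr0. Qed.

Lemma eqmod_diagM p q p' q' : eqmod_diag p q -> eqmod_diag p' q' -> eqmod_diag (p * p') (q * q').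
Proof.
move=> [u uE] [v vE]; exists (u * p' + q * v).
by rewrite mulrDr mulrA -uE mulrCA -vE mulrBl mulrBr addrA subrK.
Qed.

Lemma eqmod_diagX p q k : eqmod_diag p q -> eqmod_diag (p ^+ k) (q ^+ k).
Proof.
move=> pq; elim: k => [|k IH]; first exact: eqmod_diag_refl.
by rewrite !exprS; exact: eqmod_diagM.
Qed.

Lemma cvar_cross c c' :
  eqmod_diag (cvar F c i1 * cvar F c' i0) (cvar F c i0 * cvar F c' i1).
Proof.
case: c; case: c'; rewrite /cvar.
- by rewrite mulrC; exact: eqmod_diag_refl.
- by exists (- 1); rewrite mulrN1 opprB.
- by exists 1; rewrite mulr1 /diag_eq mulrC [yvar F i0 * _]mulrC.
- by rewrite mulrC; exact: eqmod_diag_refl.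
Qed.

Lemma monomial2 (m : 'X_{1..2 + 2}) : 'X_[m] =
  (cvar F true i0 ^+ m (cidx true i0) * cvar F false i0 ^+ m (cidx false i0)) *
  (cvar F true i1 ^+ m (cidx true i1) * cvar F false i1 ^+ m (cidx false i1)).
Proof.
rewrite mpolyXE_id big_split_ord /= !big_ord_recl !big_ord0 !mulr1 mulrACA.
have -> : lift ord0 ord0 = i1 by apply: val_inj.
by [].
Qed.

(** Up to a power of a coordinate, a form is congruent to its restriction to the
    diagonal written in the variables of the second factor, since
    [v_1 x_0 = v_0 x_1] and [v_1 y_0 = v_0 y_1] modulo the equation. A form that
    vanishes on the diagonal is thus a multiple of the equation, locally. *)
Lemma eqmod_diag_restr c e p : mhomog e p ->
  eqmod_diag (cvar F c i1 ^+ e i0 * p)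
         (cvar F c i0 ^+ e i0 * coord_subst p2 (coord_subst dg p)).
Proof.
move=> ep; rewrite {1}[p]mpolyE {1}[p in coord_subst dg p]mpolyE.
rewrite (raddf_sum (coord_subst dg)) (raddf_sum (coord_subst p2)) !mulr_sumr /=.
rewrite [X in eqmod_diag X]big_seq [X in eqmod_diag _ X]big_seq.
apply: (big_ind2 eqmod_diag); first exact: eqmod_diag_refl.
  move=> a b a' b' [u uE] [v vE]; exists (u + v).
  by rewrite mulrDr -uE -vE opprD addrACA.
move=> m /ep mE; rewrite -mul_mpolyC !rmorphM /=.
rewrite !coord_substC mulrCA [X in eqmod_diag _ X]mulrCA.
apply: eqmod_diagM; first exact: eqmod_diag_refl.
rewrite monomial2 !rmorphM !rmorphXn /= !coord_subst_cvar.
rewrite -(mE i0) (mnm_mdegE _ _ true) [X in eqmod_diag X]mulrA [X in eqmod_diag _ X]mulrA.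
apply: eqmod_diagM; last exact: eqmod_diag_refl.
rewrite !exprD [X in eqmod_diag X]mulrACA [X in eqmod_diag _ X]mulrACA -!exprMn.
by apply: eqmod_diagM; apply: eqmod_diagX; exact: cvar_cross.
Qed.

Lemma coord_subst_diag_eq : coord_subst dg diag_eq = 0.
Proof.
rewrite /diag_eq rmorphB !rmorphM /=.
rewrite !(@coord_subst_cvar _ _ _ _ true) !(@coord_subst_cvar _ _ _ _ false).
by rewrite subrr.
Qed.

Lemma mhomog_diag_eq : mhomog (fun=> 1%N) diag_eq.
Proof.
apply: mhomogD; last apply: mhomogN.
  apply: mhomogP (mhomogM (@mhomog_xvar F 2 i0) (@mhomog_yvar F 2 i1)) => i.
  by case: i => [[|[|k]] ?].
apply: mhomogP (mhomogM (@mhomog_xvar F 2 i1) (@mhomog_yvar F 2 i0)) => i.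
by case: i => [[|[|k]] ?].
Qed.

Section Point.
Variable Q : mproj F 2.
Hypothesis QD : diag_eq \in mproj_ideal Q.

Lemma eqmod_diag_in p q : eqmod_diag p q -> (p \in mproj_ideal Q) = (q \in mproj_ideal Q).
Proof.
move=> [u uE]; have DuQ : diag_eq * u \in mproj_ideal Q by rewrite mulrC; exact: mprojM.
apply/idP/idP => [pQ|qQ].
  rewrite -[q](subKr p) uE -mulN1r addrC; exact: mprojMD.
by rewrite -[p](subrK q) uE -[_ * u]mul1r; exact: mprojMD.
Qed.

(** If [v_1] does not vanish at a point of the diagonal, then neither does [v_0]:
    [v_1 u_0 = v_0 u_1] modulo the equation, where [u_0] is a coordinate of the
    first factor that does not vanish. *)
Lemma diag_cvar_notin : exists c,
  cvar F c i0 \notin mproj_ideal Q /\ cvar F c i1 \notin mproj_ideal Q.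
Proof.
have [c cQ] := cvar_notin Q i1; exists c; split=> //; apply/negP => c0.
have [c' c'Q] := cvar_notin Q i0.
have : cvar F c i1 * cvar F c' i0 \notin mproj_ideal Q by exact: mprojM_notin.
by rewrite (eqmod_diag_in (cvar_cross c c')) mulrC mprojM.
Qed.

(** By [eqmod_diag_restr] a form and its restriction to the diagonal, written in the
    second variables, vanish together at [Q]; so [Q] and the diagonal image of its
    second projection lie in the same open subsets. *)
Lemma diag_pr2 e b : mhomog e b -> (b \in mproj_ideal Q) =
  (b \in mproj_ideal (pull_point dg (pull_point p2 Q))).
Proof.
move=> eb; rewrite [RHS](@pull_ideal_homog _ _ _ dg _ _ _ eb).
rewrite [RHS](@pull_ideal_homog _ _ _ p2 _ _ _ (mhomog_coord_subst eb)).
have [c [c0 c1]] := diag_cvar_notin; have := eqmod_diag_in (eqmod_diag_restr c eb).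
have mE v p : v \notin mproj_ideal Q ->
    (v ^+ e i0 * p \in mproj_ideal Q) = (p \in mproj_ideal Q).
  move=> vQ; apply/idP/idP => [|pQ]; last exact: mprojM.
  by move=> /mproj_prime; rewrite (negbTE (mprojX_notin _ vQ)).
by rewrite !mE.
Qed.

Lemma diag_pr2_opens (V : opens (mproj F 2)) : opens_set V Q ->
  opens_set V (pull_point dg (pull_point p2 Q)).
Proof.
move=> /(opens_open V)[e [b [eb bQ bV]]]; apply: bV.
by rewrite -(diag_pr2 eb).
Qed.

Lemma restr_denominator e b : mhomog e b -> b \notin mproj_ideal Q ->
  coord_subst dg b != 0.
Proof.
move=> eb; rewrite (diag_pr2 eb).
by rewrite (@pull_ideal_homog _ _ _ dg _ _ _ eb) => /mproj_notin0.
Qed.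

Lemma at_diag_point d t : Oloc d Q t -> at_diag t.
Proof.
by move=> [e [e' [a [b [ea eb dE bQ ->]]]]]; exists a, b; rewrite (restr_denominator eb).
Qed.

End Point.

(** The equation is a difference of monomials of degree (1, 1), so multiplying by it
    commutes, up to this shift, with taking homogeneous parts. *)
Lemma diag_eq_split e q : mhomog e (diag_eq * q) -> (forall i, 0 < e i)%N ->
  exists2 q', mhomog (fun i => e i - 1)%N q' & diag_eq * q = diag_eq * q'.
Proof.
move=> eD e0; exists (mhomog_part (fun i => e i - 1)%N q); first exact: mhomog_partP.
have mE (i k : 'I_2) : (i == k) = false ->
    mnm_mdeg (U_(lshift 2 i) + U_(rshift 2 k))%MM =1 fun=> 1%N.
  move=> ik j; rewrite /mnm_mdeg !mnmDE !mnm1E.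
  rewrite eq_lshift eq_rlshift eq_lrshift eq_rshift.
  by case: i ik => [[|[|?]] ?]; case: k => [[|[|?]] ?]; case: j => [[|[|?]] ?].
have part (i k : 'I_2) : (i == k) = false ->
    mhomog_part e ('X_(lshift 2 i) * 'X_(rshift 2 k) * q) =
    'X_(lshift 2 i) * 'X_(rshift 2 k) * mhomog_part (fun i => e i - 1)%N q.
  move=> ik; rewrite -mpolyXD mhomog_partMX ifT.
    by congr (_ * _); apply: mhomog_part_eq => j; rewrite mE.
  by apply/forallP => j; rewrite mE.
rewrite -[LHS](mhomog_part_id eD) /diag_eq !mulrBl /xvar /yvar.
rewrite mhomog_partD -mulN1r -[- 1]/(- 1%:MP) -mpolyCN mul_mpolyC mhomog_partZ.
by rewrite !part// scaleN1r.
Qed.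

End DiagonalIdeal.

Section LocalEquation.
Variable F : fieldType.
Local Notation S1 := {mpoly F[1 + 1]}.
Local Notation S2 := {mpoly F[2 + 2]}.
Local Notation i0 := (ord0 : 'I_2).
Local Notation i1 := (ord_max : 'I_2).
Local Notation j0 := (ord0 : 'I_1).
Local Notation K2 := {fraction S2}.
Local Notation dg := (@collapse 2).
Local Notation p2 := (fun _ : 'I_1 => i1).
Implicit Types (d : 'I_2 -> int) (t : K2) (P : mproj F 1) (Q : mproj F 2).

(** A generator of the ideal of the diagonal in the chart [c] of both factors. *)
Definition diag_coord c : K2 :=
  tofrac (diag_eq F) / tofrac (cvar F c i0 * cvar F c i1).

Lemma mhomog_cvar2 c : mhomog (fun=> 1%N) (cvar F c i0 * cvar F c i1).
Proof.
apply: mhomogP (mhomogM (@mhomog_cvar F 2 c i0) (@mhomog_cvar F 2 c i1)) => i.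
by case: i => [[|[|?]] ?].
Qed.

Lemma coord_subst_cvar2 c : coord_subst dg (cvar F c i0 * cvar F c i1) = cvar F c j0 ^+ 2.
Proof. by rewrite rmorphM /= !coord_subst_cvar expr2. Qed.

Lemma cvar2_neq0 c : coord_subst dg (cvar F c i0 * cvar F c i1) != 0.
Proof. by rewrite coord_subst_cvar2 expf_neq0// cvar_neq0. Qed.

Lemma diag_coord_Oloc c Q : cvar F c i0 \notin mproj_ideal Q ->
  cvar F c i1 \notin mproj_ideal Q -> Oloc (fun=> 0) Q (diag_coord c).
Proof.
move=> c0 c1; exists (fun=> 1%N), (fun=> 1%N), (diag_eq F), (cvar F c i0 * cvar F c i1).
split=> //; [exact: mhomog_diag_eq|exact: mhomog_cvar2|exact: mprojM_notin].
Qed.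

Lemma at_diag_coord c : at_diag (diag_coord c).
Proof. by exists (diag_eq F), (cvar F c i0 * cvar F c i1); rewrite cvar2_neq0. Qed.

Lemma restr_diag_coord c : restr (diag_coord c) = 0.
Proof.
rewrite /restr /frac_pull frac_mapE ?cvar2_neq0//.
by rewrite [X in tofrac X / _](coord_subst_diag_eq F) tofrac0 mul0r.
Qed.

Lemma delta_diag_coord c : delta (diag_coord c) = (tofrac (cvar F c j0) ^+ 2)^-1.
Proof.
have v0 := rmorph_neq0 (cvar2_neq0 c).
rewrite /delta /diag_coord frac_derivE// /restr /frac_pull frac_mapE; last first.
  by rewrite rmorphM mulf_neq0// cvar2_neq0.
have -> : (diag_eq F)^`M(cidx true i0) = cvar F false i1.
  rewrite /diag_eq mderivB !mderivM.
  rewrite !(@mderiv_cvar F _ true) !(@mderiv_cvar F _ false) /=.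
  by rewrite mul1r !(mul0r, mulr0) !(addr0, add0r) subr0.
have y0 : tofrac (yvar F j0) != 0 :> {fraction S1}.
  by rewrite tofrac_eq0 (@cvar_neq0 _ _ false).
have w0 : tofrac (coord_subst dg (cvar F c i0 * cvar F c i1)) != 0 :> {fraction S1}.
  by rewrite tofrac_eq0 cvar2_neq0.
rewrite rmorphB [X in _ - X]rmorphM [X in _ - X * _](coord_subst_diag_eq F) mul0r subr0.
rewrite !rmorphM /= coord_subst_cvar.
rewrite -tofracXn -coord_subst_cvar2; move: w0; rewrite !rmorphM /= !coord_subst_cvar.
exact: frac_cancel.
Qed.

(** Write [t = a / b]. The restriction of [b] to the diagonal does not vanish, so
    that of [a] does, and [eqmod_diag_restr] turns this into divisibility. *)
Lemma diag_factor Q c d t : diag_eq F \in mproj_ideal Q ->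
  cvar F c i0 \notin mproj_ideal Q -> cvar F c i1 \notin mproj_ideal Q ->
  Oloc d Q t -> restr t = 0 -> exists2 t', Oloc d Q t' & t = diag_coord c * t'.
Proof.
move=> QD c0 c1 /(Oloc_ge 1)[e [e' [a [b [ea eb dE e1 [bQ ->]]]]]].
have b0 := restr_denominator QD eb bQ.
rewrite /restr /frac_pull frac_mapE// => /eqP.
rewrite mulf_eq0 invr_eq0 !tofrac_eq0 (negbTE b0) orbF => /eqP a0.
have [u uE] := eqmod_diag_restr c ea; rewrite a0 rmorph0 mulr0 subr0 in uE.
have hv : mhomog (fun i => e i0 * (i1 == i))%N (cvar F c i1 ^+ e i0).
  exact: (mhomogX (@mhomog_cvar F 2 c i1)).
have := mhomogM hv ea; rewrite uE => /diag_eq_split[i|q qE DqE].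
  by have := e1 i; lia.
rewrite DqE in uE.
exists (tofrac (q * (cvar F c i0 * cvar F c i1)) / tofrac (cvar F c i1 ^+ e i0 * b)).
  exists (fun i : 'I_2 => e i0 * (i1 == i) + e i - 1 + 1)%N.
  exists (fun i : 'I_2 => e i0 * (i1 == i) + e' i)%N.
  exists (q * (cvar F c i0 * cvar F c i1)), (cvar F c i1 ^+ e i0 * b).
  split; [exact: mhomogM qE (@mhomog_cvar2 c)|exact: mhomogM hv eb| | |by []].
    by move=> i; have := dE i; have := e1 i; lia.
  by rewrite mprojM_notin// mprojX_notin.
have v0 : tofrac (cvar F c i1 ^+ e i0) != 0 :> K2 by rewrite tofrac_eq0 expf_neq0// cvar_neq0.
have w0 : tofrac (cvar F c i0 * cvar F c i1) != 0 :> K2.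
  by rewrite tofrac_eq0 mulf_neq0// cvar_neq0.
have bF : tofrac b != 0 :> K2 by rewrite tofrac_eq0 (mproj_notin0 bQ).
have -> : tofrac a / tofrac b = tofrac (diag_eq F * q) / tofrac (cvar F c i1 ^+ e i0 * b).
  by rewrite -uE tofrac_cancel// expf_neq0// cvar_neq0.
rewrite /diag_coord; move: w0; rewrite !tofracM => w0.
have := frac_cancel2 (tofrac (diag_eq F)) (tofrac q) v0 w0 bF.
by rewrite -!tofracM.
Qed.

End LocalEquation.

(** * The model of the module of principal parts *)

Section SectionValues.
Variables (F : fieldType) (r : nat) (d : 'I_r -> int) (U : opens (mproj F r)).
Implicit Types (s t : twist_sec d U) (a b : regular_sec U) (x : opens_set U).

Lemma secD s t x : (s + t) x = s x + t x. Proof. by []. Qed.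
Lemma sec0 x : (0 : twist_sec d U) x = 0. Proof. by []. Qed.
Lemma secZ a s x : (a *: s) x = a x * s x. Proof. by []. Qed.
Lemma rsecD a b x : (a + b) x = a x + b x. Proof. by []. Qed.
Lemma rsecM a b x : (a * b) x = a x * b x. Proof. by []. Qed.
Lemma rsec1 x : (1 : regular_sec U) x = 1. Proof. by []. Qed.

End SectionValues.

Section Jets.
Variables (F : fieldType) (m : int).
Local Notation S1 := {mpoly F[1 + 1]}.
Local Notation S2 := {mpoly F[2 + 2]}.
Local Notation i0 := (ord0 : 'I_2).
Local Notation i1 := (ord_max : 'I_2).
Local Notation dg := (@collapse 2).
Local Notation diagpre V := (mor_pre (diag F) V).

Section TaylorMap.
Variables (d : 'I_2 -> int) (k : int) (V : opens (P1xP1 F)) (t : twist_sec d V).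
Hypotheses (d0 : d i0 = 0) (dk : d i1 = k).

Let tO (x : opens_set (diagpre V)) :
  Oloc d (pull_point dg (val x)) (t (@pull_opens F 2 1 dg V x)).
Proof. exact: (sec_Oloc t (@pull_opens F 2 1 dg V x)). Qed.

Fact restr_sec_loc (x : opens_set (diagpre V)) :
  Oloc (fun=> k) (val x) (restr (t (@pull_opens F 2 1 dg V x))).
Proof. by apply: Oloc_eq (restr_Oloc (tO x)) => i; rewrite d0 dk add0r. Qed.

Fact delta_sec_loc (x : opens_set (diagpre V)) :
  Oloc (fun=> k - 2) (val x) (delta (t (@pull_opens F 2 1 dg V x))).
Proof. by apply: Oloc_eq (delta_Oloc d0 (tO x)) => i; rewrite dk. Qed.

Fact restr_sec_const (x y : opens_set (diagpre V)) :
  restr (t (@pull_opens F 2 1 dg V x)) = restr (t (@pull_opens F 2 1 dg V y)).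
Proof. by congr restr; exact: sec_const. Qed.

Fact delta_sec_const (x y : opens_set (diagpre V)) :
  delta (t (@pull_opens F 2 1 dg V x)) = delta (t (@pull_opens F 2 1 dg V y)).
Proof. by congr delta; exact: sec_const. Qed.

Definition restr_sec : twist_sec (fun=> k) (diagpre V) :=
  msec restr_sec_const restr_sec_loc.
Definition delta_sec : twist_sec (fun=> k - 2) (diagpre V) :=
  msec delta_sec_const delta_sec_loc.

Lemma sec_at_diag (x : opens_set (diagpre V)) : at_diag (t (@pull_opens F 2 1 dg V x)).
Proof. exact: at_diag_Oloc (tO x). Qed.

End TaylorMap.

Definition jet_sec (V : opens (P1xP1 F)) : Type :=
  (twist_sec (fun _ : 'I_1 => m) (diagpre V) *
   twist_sec (fun _ : 'I_1 => m - 2) (diagpre V))%type.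

HB.instance Definition _ V := GRing.Zmodule.on (jet_sec V).

Section Scale.
Variable V : opens (P1xP1 F).
Local Notation po x := (@pull_opens F 2 1 dg V x).

Fact jet_scale1_const (a : regular_sec V) (s : jet_sec V) (x y : opens_set (diagpre V)) :
  restr (a (po x)) * s.1 x = restr (a (po y)) * s.1 y.
Proof. by rewrite (restr_sec_const a x y) (sec_const s.1 x y). Qed.
Fact jet_scale1_loc (a : regular_sec V) (s : jet_sec V) (x : opens_set (diagpre V)) :
  Oloc (fun=> m) (val x) (restr (a (po x)) * s.1 x).
Proof.
apply: OlocM (restr_sec_loc a erefl erefl x) (sec_Oloc s.1 x) => i.
by rewrite add0r.
Qed.
Fact jet_scale2_const (a : regular_sec V) (s : jet_sec V) (x y : opens_set (diagpre V)) :
  restr (a (po x)) * s.2 x + delta (a (po x)) * s.1 x =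
  restr (a (po y)) * s.2 y + delta (a (po y)) * s.1 y.
Proof.
by rewrite (restr_sec_const a x y) (delta_sec_const a x y) (sec_const s.1 x y)
  (sec_const s.2 x y).
Qed.
Fact jet_scale2_loc (a : regular_sec V) (s : jet_sec V) (x : opens_set (diagpre V)) :
  Oloc (fun=> m - 2) (val x) (restr (a (po x)) * s.2 x + delta (a (po x)) * s.1 x).
Proof.
apply: OlocD.
  apply: OlocM (restr_sec_loc a erefl erefl x) (sec_Oloc s.2 x) => i.
  by rewrite add0r.
apply: OlocM (delta_sec_loc a erefl erefl x) (sec_Oloc s.1 x) => i.
by rewrite add0r addrC.
Qed.

(** The product of the expansions [restr a + e * delta a] and [f + e * w], with
    [e] of square zero. *)
Definition jet_scale (a : regular_sec V) (s : jet_sec V) : jet_sec V :=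
  (msec (jet_scale1_const a s) (jet_scale1_loc a s),
   msec (jet_scale2_const a s) (jet_scale2_loc a s)).

Lemma jet_eq (s t : jet_sec V) : (forall x, s.1 x = t.1 x) ->
  (forall x, s.2 x = t.2 x) -> s = t.
Proof.
by case: s t => [s1 s2] [t1 t2] /= E1 E2; congr pair; apply: sec_eq.
Qed.

Lemma jet_scaleE1 a s x : (jet_scale a s).1 x = restr (a (po x)) * s.1 x.
Proof. by []. Qed.
Lemma jet_scaleE2 a s x :
  (jet_scale a s).2 x = restr (a (po x)) * s.2 x + delta (a (po x)) * s.1 x.
Proof. by []. Qed.
Lemma jetD1 (s t : jet_sec V) x : (s + t).1 x = s.1 x + t.1 x. Proof. by []. Qed.
Lemma jetD2 (s t : jet_sec V) x : (s + t).2 x = s.2 x + t.2 x. Proof. by []. Qed.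

Fact jet_scaleA a b s : jet_scale a (jet_scale b s) = jet_scale (a * b) s.
Proof.
apply: jet_eq => x; rewrite ?jet_scaleE1 ?jet_scaleE2 ?jet_scaleE1 rsecM.
  by rewrite restrM ?mulrA//; exact: sec_at_diag.
rewrite restrM ?deltaM; try exact: sec_at_diag.
by rewrite mulrDr mulrDl !mulrA -addrA.
Qed.

Fact jet_scale1 : left_id 1 jet_scale.
Proof.
move=> s; apply: jet_eq => x; rewrite ?jet_scaleE1 ?jet_scaleE2 rsec1.
  by rewrite -tofrac1 restr_tofrac rmorph1 tofrac1 mul1r.
rewrite -tofrac1 restr_tofrac rmorph1 /delta.
rewrite frac_deriv_tofrac -(mpolyC1 _ F) mderivC tofrac0 restr0 !mul0r addr0.
by rewrite mpolyC1 tofrac1 mul1r.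
Qed.

Fact jet_scaleDr : right_distributive jet_scale +%R.
Proof.
move=> a s t; apply: jet_eq => x.
  by rewrite jetD1 !jet_scaleE1 jetD1 mulrDr.
by rewrite jetD2 !jet_scaleE2 jetD1 jetD2 !mulrDr addrACA.
Qed.

Fact jet_scaleDl s : {morph jet_scale^~ s : a b / a + b}.
Proof.
move=> a b; apply: jet_eq => x.
  by rewrite jetD1 !jet_scaleE1 rsecD restrD ?mulrDl//; exact: sec_at_diag.
rewrite jetD2 !jet_scaleE2 rsecD restrD ?deltaD; try exact: sec_at_diag.
by rewrite !mulrDl addrACA.
Qed.

HB.instance Definition _ := GRing.Zmodule_isLmodule.Build (regular_sec V)
  (jet_sec V) jet_scaleA jet_scale1 jet_scaleDr jet_scaleDl.

End Scale.

Definition diagpre_sub (U V : opens (P1xP1 F)) (h : V `<=` U) :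
  diagpre V `<=` diagpre U := fun x => h (diag F x).

Definition jet_res (U V : opens (P1xP1 F)) (h : V `<=` U) (s : jet_sec U) : jet_sec V :=
  (twist_res (diagpre_sub h) s.1, twist_res (diagpre_sub h) s.2).

Lemma jet_resP (U V : opens (P1xP1 F)) (h : V `<=` U) (a : rs_sec U) (s t : jet_sec U) :
  jet_res h ((a : regular_sec U) *: s + t) =
  (rs_res h a : regular_sec V) *: jet_res h s + jet_res h t.
Proof.
have aE x : (rs_res h a : regular_sec V) (@pull_opens F 2 1 dg V x) =
    (a : regular_sec U) (@pull_opens F 2 1 dg U (opens_incl (diagpre_sub h) x)).
  exact: (@sec_const F 2 _ U (a : regular_sec U)).
apply: jet_eq => x.
  by rewrite jetD1 jet_scaleE1 aE.
by rewrite jetD2 jet_scaleE2 aE.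
Qed.

Definition jets : omodule (P1xP1 F) :=
  @OModule (P1xP1 F) jet_sec jet_res jet_resP
   (om_sheaf (pushforward (diag F) (om_dsum (twist F (fun=> m)) (twist F (fun=> m - 2))))).

End Jets.

Section Taylor.
Variable F : fieldType.
Local Notation S1 := {mpoly F[1 + 1]}.
Local Notation S2 := {mpoly F[2 + 2]}.
Local Notation i0 := (ord0 : 'I_2).
Local Notation i1 := (ord_max : 'I_2).
Local Notation j0 := (ord0 : 'I_1).
Local Notation dg := (@collapse 2).
Local Notation p2 := (fun _ : 'I_1 => i1).
Local Notation diagpre V := (mor_pre (diag F) V).
Local Notation po x := (@pull_opens F 2 1 dg _ x).
Local Notation J := (@ideal_power (P1xP1 F) (@kernel_ideal _ _ (diag F)) 2).
Implicit Types (V : opens (P1xP1 F)) (Q : mproj F 2).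

Lemma kernel_diagP V (a : rs_sec V) : kernel_ideal (diag F) a <->
  forall x : opens_set (diagpre V), restr ((a : regular_sec V) (po x)) = 0.
Proof.
split=> [a0 x|a0].
  rewrite -[LHS](@pull_sharpE F 2 1 dg V a x).
  by have -> : mor_sharp (diag F) V a = 0 by [].
apply: (@sec_eq F 1) => x; apply: etrans (@pull_sharpE F 2 1 dg V a x) _.
exact: a0.
Qed.

Lemma diag_complement_empty V : (forall Q, opens_set V Q -> diag_eq F \notin mproj_ideal Q) ->
  forall P, ~ opens_set (diagpre V) P.
Proof.
move=> VD P /VD /=.
by rewrite (pull_ideal_homog dg P (@mhomog_diag_eq F)) coord_subst_diag_eq mproj0.
Qed.

Section Degree.
Variables (d : 'I_2 -> int) (m : int).
Hypotheses (d0 : d i0 = 0) (dm : d i1 = m).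

Definition taylor_fun V (t : twist_sec d V) : jet_sec m V :=
  (restr_sec t d0 dm, delta_sec t d0 dm).

Lemma taylor_funE1 V (t : twist_sec d V) x : (taylor_fun t).1 x = restr (t (po x)).
Proof. by []. Qed.
Lemma taylor_funE2 V (t : twist_sec d V) x : (taylor_fun t).2 x = delta (t (po x)).
Proof. by []. Qed.

Lemma taylor_linear V : linear (@taylor_fun V).
Proof.
move=> a s t; apply: jet_eq => x.
  rewrite jetD1 taylor_funE1 secD secZ jet_scaleE1.
  by rewrite restrD ?restrM //; try apply: at_diagM; exact: sec_at_diag.
rewrite jetD2 taylor_funE2 secD secZ jet_scaleE2.
rewrite deltaD ?deltaM //; try apply: at_diagM; exact: sec_at_diag.
Qed.

Lemma taylor_nat (U V : opens (P1xP1 F)) (h : V `<=` U) (s : twist_sec d U) :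
  jet_res h (taylor_fun s) = taylor_fun (twist_res h s).
Proof.
have E x : s (@pull_opens F 2 1 dg U (opens_incl (diagpre_sub h) x)) =
    s (opens_incl h (@pull_opens F 2 1 dg V x)) by exact: (@sec_const F 2 _ U s).
by apply: jet_eq => x; rewrite /= E.
Qed.

Definition taylor : omHom (twist F d) (jets F m) :=
  @OmHom (P1xP1 F) (twist F d) (jets F m) (fun V => mk_linear (@taylor_linear V))
    taylor_nat.

(** The expansion [(f, w)] is attained by [f] read in the second variables, which
    has no derivative in the first ones, corrected by a multiple of the equation
    [c], whose expansion is [(0, 1 / v ^ 2)]. *)
Lemma taylor_fun_surj V (s : jet_sec m V) Q : opens_set V Q ->
  exists (V' : opens (P1xP1 F)) (h : V' `<=` V), opens_set V' Q /\
  exists t : twist_sec d V', taylor_fun t = jet_res h s.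
Proof.
move=> VQ; have [QD|QD] := boolP (diag_eq F \in mproj_ideal Q); last first.
  (* Away from the diagonal, pairs are sections over the empty set. *)
  exists (opensI V (nonvanishing (@mhomog_diag_eq F))).
  have h : opensI V (nonvanishing (@mhomog_diag_eq F)) `<=` V by move=> ? [].
  exists h; split=> //; exists 0.
  have emp := @diag_complement_empty (opensI V (nonvanishing (@mhomog_diag_eq F))).
  by apply: jet_eq => x; case: (emp _ _ (set_mem (valP x))) => ? [].
have [c [c0 c1]] := diag_cvar_notin QD.
have VP := diag_pr2_opens QD VQ.
pose x0 : opens_set (diagpre V) := @in_opens F 1 (diagpre V) _ VP.
pose f := s.1 x0; pose w := s.2 x0.
pose v : {fraction S1} := tofrac (cvar F c j0).
have v0 : v != 0 by rewrite tofrac_eq0 cvar_neq0.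
have pushE : push_deg p2 (fun=> m) =1 d.
  move=> j; rewrite /push_deg big_mkcond big_ord1.
  by case: j => [[|[|?]] ?] //=; [rewrite -d0|rewrite -dm]; congr d; apply: val_inj.
have fO : Oloc (fun=> m) (pull_point p2 Q) f by exact: (sec_Oloc s.1 x0).
have vO : Oloc (fun=> 2) (pull_point p2 Q) (v ^+ 2).
  rewrite /v -tofracXn.
  apply: Oloc_eq (Oloc_poly _ (mhomogX (k := 2) (@mhomog_cvar F 1 c j0))) => j.
  by rewrite [j]ord1.
have wO : Oloc (fun=> m) (pull_point p2 Q) (w * v ^+ 2).
  by apply: OlocM (sec_Oloc s.2 x0) vO => j; rewrite subrK.
have zO : Oloc d Q (frac_pull p2 f + diag_coord F c * frac_pull p2 (w * v ^+ 2)).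
  apply: OlocD; first by apply: Oloc_eq pushE _; have [] := Oloc_pull fO.
  apply: OlocM (diag_coord_Oloc c0 c1) (Oloc_eq pushE (Oloc_pull wO).2) => j.
  by rewrite add0r.
have [U [UQ UO]] := Oloc_open zO.
have h : opensI V U `<=` V by move=> ? [].
exists (opensI V U), h; split=> //.
exists (@csec _ _ d (opensI V U) _ (fun P VUP => UO P VUP.2)).
have [aF rF] := restr_pull p2 f; have [aw rw] := restr_pull p2 (w * v ^+ 2).
have aC := at_diag_coord F c.
apply: jet_eq => x.
  rewrite taylor_funE1 /= restrD//; last exact: at_diagM.
  rewrite restrM// restr_diag_coord mul0r addr0 rF.
  exact: sec_const.
rewrite taylor_funE2 /= deltaD//; last exact: at_diagM.
rewrite deltaM// restr_diag_coord mul0r add0r delta_pull /= add0r rw.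
rewrite delta_diag_coord mulrC mulfK ?expf_neq0//.
exact: sec_const.
Qed.

Lemma taylor_epi : om_epi taylor.
Proof. by move=> V s Q; exact: taylor_fun_surj. Qed.

(** Two divisions by the equation [c] of the diagonal: the vanishing of the first
    component allows one, after which the second component is the restriction of
    the quotient divided by [v ^ 2]. *)
Lemma taylor_ker V (t : twist_sec d V) Q : opens_set V Q -> taylor_fun t = 0 ->
  exists (V' : opens (P1xP1 F)) (h : V' `<=` V), opens_set V' Q /\
  exists (a : rs_sec V') (t' : twist_sec d V'),
    J a /\ twist_res h t = (a : regular_sec V') *: t'.
Proof.
move=> VQ t0; have [QD|QD] := boolP (diag_eq F \in mproj_ideal Q); last first.
  (* Away from the diagonal its ideal contains 1. *)
  pose V' := opensI V (nonvanishing (@mhomog_diag_eq F)).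
  have h : V' `<=` V by move=> ? [].
  exists V', h; split=> //; exists 1, (twist_res h t); split; last by rewrite scale1r.
  have h1 : V' `<=` V' by [].
  move=> y V'y; exists V', h1; split=> //; exists 1%N, (fun=> 1), (fun _ _ => 1); split.
    move=> _ _; apply/kernel_diagP => x.
    have emp := @diag_complement_empty V'.
    by case: (emp _ _ (set_mem (valP x))) => ? [].
  by rewrite rmorph1 big_ord1 big1 ?mulr1.
have [c [c0 c1]] := diag_cvar_notin QD.
have VP := diag_pr2_opens QD VQ.
pose x0 : opens_set (diagpre V) := @in_opens F 1 (diagpre V) _ VP.
pose z0 := t (in_opens VQ).
have tE y : t y = z0 by exact: sec_const.
have r0 : restr z0 = 0 by rewrite -(tE (po x0)) -taylor_funE1 t0.
have dl0 : delta z0 = 0 by rewrite -(tE (po x0)) -taylor_funE2 t0.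
have z0O : Oloc d Q z0 by exact: (sec_Oloc t (in_opens VQ)).
have [z1 z1O z0E] := diag_factor QD c0 c1 z0O r0.
have aC := at_diag_coord F c; have az1 := at_diag_point QD z1O.
have r1 : restr z1 = 0.
  move: dl0; rewrite z0E deltaM// restr_diag_coord mul0r add0r delta_diag_coord.
  move=> /eqP; rewrite mulf_eq0 invr_eq0 expf_eq0 /= tofrac_eq0.
  by rewrite (negbTE (cvar_neq0 _ _ _)) => /eqP.
have [z2 z2O z1E] := diag_factor QD c0 c1 z1O r1.
have [U [UQ UO]] := Oloc_open z2O.
pose V' := opensI V (opensI U (nonvanishing (@mhomog_cvar2 F c))).
have h : V' `<=` V by move=> ? [].
have CO P : opens_set V' P -> Oloc (fun=> 0) P (diag_coord F c).
  move=> [_ [_ cP]]; apply: diag_coord_Oloc; apply: contra cP => cP.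
    by rewrite mulrC; exact: mprojM.
  exact: mprojM.
pose C : regular_sec V' := @csec _ _ (fun=> 0) V' _ CO.
exists V', h; split; first by split=> //; split=> //; exact: mprojM_notin.
exists (C * C : regular_sec V'), (@csec _ _ d V' _ (fun P VUP => UO P VUP.2.1)); split.
  have h1 : V' `<=` V' by [].
  move=> y V'y; exists V', h1; split=> //.
  exists 1%N, (fun=> 1), (fun _ _ => (C : rs_sec V')); split.
    by move=> _ _; apply/kernel_diagP => x; exact: restr_diag_coord.
  rewrite big_ord1 mul1r big_ord_recl big_ord1.
  by apply: (@sec_eq F 2) => x.
apply: sec_eq => x; rewrite secZ rsecM /= -mulrA -z1E -z0E.
exact: sec_const.
Qed.

End Degree.

(** By [deltaM] a product of two functions that vanish on the diagonal has zero
    expansion. *)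
Lemma ideal_power_diag V (a : rs_sec V) : J a -> forall x : opens_set (diagpre V),
  restr ((a : regular_sec V) (po x)) = 0 /\ delta ((a : regular_sec V) (po x)) = 0.
Proof.
move=> Ja x; have [V1 [h [V1x [N [b [c [cJ aE]]]]]]] := Ja _ (set_mem (valP (po x))).
pose y : opens_set V1 := @in_opens F 2 V1 _ V1x.
have x1P : opens_set (diagpre V1) (val x) by exact: V1x.
pose x1 : opens_set (diagpre V1) := @in_opens F 1 (diagpre V1) _ x1P.
pose Z (s : regular_sec V1) := restr (s (po x1)) = 0 /\ delta (s (po x1)) = 0.
have -> : (a : regular_sec V) (po x) = (rs_res h a : regular_sec V1) (po x1).
  exact: (@sec_const F 2 _ V (a : regular_sec V)).
rewrite aE; apply: (big_ind Z).
- by rewrite /Z sec0 restr0 /delta frac_deriv0 restr0 mul0r.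
- move=> s t [s1 s2] [t1 t2]; rewrite /Z rsecD.
  rewrite restrD ?deltaD; try exact: sec_at_diag.
  by rewrite s1 s2 t1 t2 addr0.
move=> i _; rewrite big_ord_recl big_ord1.
have c0 j : restr ((c i j : regular_sec V1) (po x1)) = 0.
  by have /kernel_diagP := cJ i j; apply.
rewrite /Z !rsecM.
have ad (s : regular_sec V1) : at_diag (s (po x1)) by exact: sec_at_diag.
have adM := at_diagM (ad (c i ord0)) (ad (c i (lift ord0 ord0))).
rewrite restrM// deltaM// restrM// deltaM// !c0.
by rewrite !(mul0r, mulr0) !(addr0, mulr0).
Qed.

Lemma ideal_power_jet m V (a : rs_sec V) (s : jet_sec m V) : J a ->
  (a : regular_sec V) *: s = 0.
Proof.
move=> /ideal_power_diag Ja; apply: jet_eq => x; have [r0 dl0] := Ja x.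
  by rewrite jet_scaleE1 r0 mul0r.
by rewrite jet_scaleE2 r0 dl0 !mul0r addr0.
Qed.

Lemma structure_taylor_linear V :
  linear (fun a : (rs_sec V)^o => @taylor_fun (fun=> 0) 0 erefl erefl V a).
Proof.
move=> a s t; apply: jet_eq => x.
  rewrite jetD1 jet_scaleE1 !taylor_funE1 rsecD rsecM.
  by rewrite restrD ?restrM //; try apply: at_diagM; exact: sec_at_diag.
rewrite jetD2 jet_scaleE2 !taylor_funE2 rsecD rsecM taylor_funE1.
rewrite deltaD ?deltaM //; try apply: at_diagM; exact: sec_at_diag.
Qed.

(** In degree zero the expansion is the projection of the structure sheaf on the
    first infinitesimal neighbourhood. Functions and sections of O(0) are the same
    but carry separately declared module structures, hence a construction apart
    from [taylor]. *)
Definition structure_taylor : omHom (om_structure (P1xP1 F)) (jets F 0) :=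
  @OmHom (P1xP1 F) (om_structure (P1xP1 F)) (jets F 0)
    (fun V => mk_linear (@structure_taylor_linear V))
    (@taylor_nat (fun=> 0) 0 erefl erefl).

Lemma structure_taylor_quotient :
  is_quotient J structure_taylor.
Proof.
split=> [V a|V s Q VQ]; last exact: taylor_fun_surj.
split=> [a0|/ideal_power_diag Ja]; last first.
  by apply: (@jet_eq F 0) => x; have [] := Ja x.
move=> Q VQ; have [V' [h [V'Q [b [t' [Jb bE]]]]]] := taylor_ker VQ a0.
have [V1 [h1 [V1Q [N [b1 [c1 [cJ aE]]]]]]] := Jb Q V'Q.
have hV1 : V1 `<=` V by move=> y /h1 /h.
exists V1, hV1; split=> //; exists N, (fun i => rs_res h1 (t' : rs_sec V') * b1 i), c1.
split=> //.
have -> : rs_res hV1 a = rs_res h1 (rs_res h a).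
  by apply: (@sec_eq F 2) => x; exact: (@sec_const F 2 _ V (a : regular_sec V)).
have -> : rs_res h a = (b : rs_sec V') * (t' : rs_sec V').
  apply: (@sec_eq F 2) => x; apply: etrans (congr1 (fun u : twist_sec _ _ => u x) bE) _.
  by rewrite secZ [RHS]rsecM.
rewrite rmorphM aE mulrC mulr_sumr.
by apply: eq_bigr => i _; rewrite mulrA.
Qed.

End Taylor.

(** * Inverse images of twisting sheaves *)

Lemma pushforward_resE (X Y : ringedSpace) (q : rsMorphism X Y) (M : omodule X)
    (U V : opens Y) (h : V `<=` U) (h' : mor_pre q V `<=` mor_pre q U)
    (s : pushforward q M U) :
  om_res (pushforward q M) h s = om_res M h' (s : M (mor_pre q U)).
Proof. exact: (@om_res_irr X M (mor_pre q U) (mor_pre q V) _ h' s). Qed.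

Section InverseImage.
Variables (F : fieldType) (r : nat) (f : 'I_1 -> 'I_r) (m : int) (d : 'I_r -> int).
Hypothesis dE : push_deg f (fun=> m) =1 d.
Local Notation S1 := {mpoly F[1 + 1]}.
Local Notation S2 := {mpoly F[r + r]}.
Local Notation K1 := {fraction S1}.
Local Notation K2 := {fraction S2}.
Local Notation j0 := (ord0 : 'I_1).
Local Notation q := (P1pow_map F f).
Local Notation v c := (tofrac (cvar F c j0) : K1).
Local Notation w c := (tofrac (cvar F c (f j0)) : K2).
Local Notation chart c := (@cvar_opens F 1 c j0).
Local Notation po x := (@pull_opens F 1 r f _ x).

Lemma frac_pull_cvarX c k : frac_pull f (v c ^ k) = w c ^ k.
Proof.
have E n : frac_pull f (tofrac (cvar F c j0 ^+ n)) = w c ^+ n.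
  by rewrite frac_pull_tofrac rmorphXn /= coord_subst_cvar tofracXn.
case: k => n; rewrite /exprz -tofracXn ?E//.
have z0 : frac_pull f (tofrac (cvar F c j0 ^+ n.+1)) != 0.
  by rewrite E expf_neq0// fcvar_neq0.
apply: (mulfI z0); rewrite -frac_pull1M [in RHS]E !divff ?expf_neq0 ?fcvar_neq0//.
  by rewrite -tofrac1 frac_pull_tofrac rmorph1 tofrac1.
by rewrite tofracXn expf_neq0 ?fcvar_neq0.
Qed.

Fact inverse_image_const (U : opens (P1 F)) (s : twist_sec (fun=> m) U)
    (x y : opens_set (mor_pre q U)) :
  frac_pull f (s (po x)) = frac_pull f (s (po y)).
Proof. by congr frac_pull; exact: sec_const. Qed.

Fact inverse_image_loc (U : opens (P1 F)) (s : twist_sec (fun=> m) U)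
    (x : opens_set (mor_pre q U)) :
  Oloc d (val x) (frac_pull f (s (po x))).
Proof.
apply: Oloc_eq dE _; apply: (fun H => (Oloc_pull (f := f) H).2).
exact: (sec_Oloc s (po x)).
Qed.

Definition inverse_image_sec (U : opens (P1 F)) (s : twist_sec (fun=> m) U) :
    twist_sec d (mor_pre q U) :=
  msec (inverse_image_const s) (inverse_image_loc s).

Lemma inverse_image_linear (U : opens (P1 F)) :
  linear (@inverse_image_sec U : OP1 F m U -> pushforward q (twist F d) U).
Proof.
move=> a s t; apply: (@sec_eq F r) => x.
rewrite [RHS](_ : _ = (mor_sharp q U a : regular_sec _) x * inverse_image_sec s x
  + inverse_image_sec t x)//.
rewrite (@pull_sharpE F 1 r f _ a) /= -frac_pull1M -frac_pull1D.
by [].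
Qed.

Lemma inverse_image_nat (U V : opens (P1 F)) (h : V `<=` U) (s : OP1 F m U) :
  om_res (pushforward q (twist F d)) h (inverse_image_sec s) =
  inverse_image_sec (om_res (OP1 F m) h s).
Proof.
by apply: (@sec_eq F r) => x /=; congr frac_pull; exact: (@sec_const F 1 _ U s).
Qed.

Definition inverse_image_unit : omHom (OP1 F m) (pushforward q (twist F d)) :=
  @OmHom (P1 F) (OP1 F m) (pushforward q (twist F d))
    (fun U => mk_linear (@inverse_image_linear U)) inverse_image_nat.

Fact chart_gen_loc c P : opens_set (chart c) P -> Oloc (fun=> m) P (v c ^ m).
Proof. by move=> cP; apply: Oloc_eq (Oloc_cvarX m cP) => j; rewrite [j]ord1. Qed.

Definition chart_gen c : twist_sec (fun=> m) (chart c) := csec (@chart_gen_loc c).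

Lemma in_chart c (Q : mproj F r) :
  opens_set (mor_pre q (chart c)) Q <-> cvar F c (f j0) \notin mproj_ideal Q.
Proof.
rewrite /= (@pull_ideal_homog _ _ _ f _ _ _ (@mhomog_cvar F 1 c j0)).
by rewrite coord_subst_cvar.
Qed.

Lemma degE j : d j = if f j0 == j then m else 0.
Proof. by rewrite -dE /push_deg big_mkcond big_ord1. Qed.

Lemma chart_quotient (V : opens (P1pow F r)) c (t : twist_sec d V) :
  V `<=` mor_pre q (chart c) ->
  exists a : regular_sec V, forall x, a x * w c ^ m = t x.
Proof.
move=> hc.
have aO x : Oloc (fun=> 0) (val x) (t x * w c ^ (- m)).
  have /in_chart cx := hc _ (set_mem (valP x)).
  apply: OlocM (sec_Oloc t x) (Oloc_cvarX (- m) cx) => j.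
  by rewrite degE; case: ifP => _; rewrite ?subrr ?addr0.
have aC x y : t x * w c ^ (- m) = t y * w c ^ (- m) by rewrite (sec_const t x y).
by exists (msec aC aO) => x; exact: cvarXK.
Qed.

Section Universal.
Variables (L : omodule (P1pow F r)) (h : omHom (OP1 F m) (pushforward q L)).

Definition gen_image c : L (mor_pre q (chart c)) := h (chart c) (chart_gen c).

(** The generators [v ^ m] of the two charts differ by a unit that comes from the
    projective line, and [h] is linear over such functions. *)
Lemma gen_image_compat (V : opens (P1pow F r)) c c' (hc : V `<=` mor_pre q (chart c))
    (hc' : V `<=` mor_pre q (chart c')) (a a' : regular_sec V) :
  (forall x, a x * w c ^ m = a' x * w c' ^ m) ->
  (a : rs_sec V) *: om_res L hc (gen_image c) =
  (a' : rs_sec V) *: om_res L hc' (gen_image c').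
Proof.
move=> aa'; pose U : opens (P1 F) := opensI (chart c) (chart c').
have UO P : opens_set U P -> Oloc (fun=> 0) P (v c ^ m * v c' ^ (- m)).
  move=> [cP c'P]; apply: OlocM (Oloc_cvarX m cP) (Oloc_cvarX (- m) c'P) => j.
  by rewrite [j]ord1 eqxx subrr.
pose u : rs_sec U := @csec F 1 (fun=> 0) U _ UO.
have hU : U `<=` chart c by move=> ? [].
have hU' : U `<=` chart c' by move=> ? [].
have VU : V `<=` mor_pre q U by move=> x Vx; split; [exact: hc|exact: hc'].
have gE : om_res (OP1 F m) hU (chart_gen c) = u *: om_res (OP1 F m) hU' (chart_gen c').
  by apply: (@sec_eq F 1) => x; rewrite secZ /= cvarXK.
have qU : mor_pre q U `<=` mor_pre q (chart c) by move=> x; exact: hU.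
have qU' : mor_pre q U `<=` mor_pre q (chart c') by move=> x; exact: hU'.
rewrite -(om_res_res qU VU hc) -(om_res_res qU' VU hc').
have E : om_res L qU (gen_image c) = mor_sharp q U u *: om_res L qU' (gen_image c').
  rewrite /gen_image -(pushforward_resE hU qU) -(pushforward_resE hU' qU').
  by rewrite !hom_nat gE linearZ.
rewrite E om_resZ scalerA; congr (_ *: _).
apply: (@sec_eq F r) => x; rewrite rsecM.
have -> : (rs_res VU (mor_sharp q U u) : regular_sec V) x = w c ^ m * w c' ^ (- m).
  transitivity (frac_pull f (v c ^ m * v c' ^ (- m))); last first.
    by rewrite frac_pull1M !frac_pull_cvarX.
  exact: (@pull_sharpE F 1 r f _ u (opens_incl VU x)).
by rewrite mulrA aa' -mulrA -expfzDr ?fcvar_neq0// subrr expr0z mulr1.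
Qed.

Lemma inverse_image_lift (V : opens (P1pow F r)) (t : twist_sec d V) :
  exists l : L V, forall (V' : opens (P1pow F r)) (hV : V' `<=` V) c
    (hc : V' `<=` mor_pre q (chart c)) (a : regular_sec V'),
    (forall x, a x * w c ^ m = t (opens_incl hV x)) ->
    om_res L hV l = (a : rs_sec V') *: om_res L hc (gen_image c).
Proof.
pose R (V' : opens (P1pow F r)) (l : L V') :=
  exists (hV : V' `<=` V) c (hc : V' `<=` mor_pre q (chart c)) (a : regular_sec V'),
    (forall x, a x * w c ^ m = t (opens_incl hV x)) /\
    l = (a : rs_sec V') *: om_res L hc (gen_image c).
have [|||l lP] := @om_glue (P1pow F r) L V R.
- move=> V' l l' [hV [c [hc [a [aE ->]]]]] [hV' [c' [hc' [a' [a'E ->]]]]].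
  by apply: gen_image_compat => x; rewrite aE a'E; exact: sec_const.
- move=> V' W k l [hV [c [hc [a [aE ->]]]]].
  have hW : W `<=` V by move=> x /k /hV.
  have hcW : W `<=` mor_pre q (chart c) by move=> x /k /hc.
  exists hW, c, hcW, (rs_res k (a : rs_sec V')); split; last first.
    by rewrite om_resZ (om_res_res _ _ hcW).
  move=> x; transitivity (a (opens_incl k x) * w c ^ m) => //.
  by rewrite aE; exact: sec_const.
- move=> Q VQ; have [c cQ] := cvar_notin Q (f j0).
  pose V' : opens (P1pow F r) := opensI V (@cvar_opens F r c (f j0)).
  have hV : V' `<=` V by move=> ? [].
  have hc : V' `<=` mor_pre q (chart c) by move=> x [_ cx]; apply/in_chart.
  have [a aE] := chart_quotient (twist_res hV t) hc.
  exists V', hV, ((a : rs_sec V') *: om_res L hc (gen_image c)); split=> //.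
  by exists hV, c, hc, a.
by exists l => V' hV c hc a aE; apply: lP; exists hV, c, hc, a.
Qed.

End Universal.

(** Over the chart where a coordinate [v] does not vanish, both sheaves are free and
    generated by [v ^ m]; so a morphism out of the inverse image is determined by
    the images of these two generators. *)
Lemma twist_is_pullback : is_pullback inverse_image_unit.
Proof.
move=> L h.
have local (V : opens (P1pow F r)) (Q : mproj F r) : opens_set V Q ->
    exists (V' : opens (P1pow F r)) (hV : V' `<=` V) c (hc : V' `<=` mor_pre q (chart c)), opens_set V' Q /\
    forall t : twist_sec d V, exists a : regular_sec V',
      forall x, a x * w c ^ m = t (opens_incl hV x).
  move=> VQ; have [c cQ] := cvar_notin Q (f j0).
  pose V' : opens (P1pow F r) := opensI V (@cvar_opens F r c (f j0)).
  have hV : V' `<=` V by move=> ? [].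
  have hc : V' `<=` mor_pre q (chart c) by move=> x [_ cx]; apply/in_chart.
  exists V', hV, c, hc; split=> // t.
  by have [a aE] := chart_quotient (twist_res hV t) hc; exists a.
split.
  pose g V (t : twist F d V) : L V := sval (cid (inverse_image_lift h t)).
  have gP (V : opens (P1pow F r)) (t : twist_sec d V) (V' : opens (P1pow F r))
      (hV : V' `<=` V) c (hc : V' `<=` mor_pre q (chart c)) (a : regular_sec V') :
      (forall x, a x * w c ^ m = t (opens_incl hV x)) ->
      om_res L hV (g V t) = (a : rs_sec V') *: om_res L hc (gen_image h c).
    by rewrite /g; case: cid => l /= lP; exact: lP.
  have gL (V : opens (P1pow F r)) : linear (g V).
    move=> u s t; apply: om_eq_local => Q VQ.
    have [V' [hV [c [hc [V'Q div]]]]] := local V Q VQ; exists V', hV; split=> //.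
    have [a aE] := div s; have [b bE] := div t.
    rewrite om_resP (gP _ _ _ _ _ hc _ aE) (gP _ _ _ _ _ hc _ bE) scalerA -scalerDl.
    apply: gP => x; rewrite rsecD rsecM mulrDl -mulrA aE bE secD secZ.
    by [].
  have gn (U V : opens (P1pow F r)) (k : V `<=` U) (s : twist F d U) :
      om_res L k (mk_linear (gL U) s) = mk_linear (gL V) (om_res (twist F d) k s).
    apply: om_eq_local => Q VQ.
    have [V' [hV [c [hc [V'Q div]]]]] := local V Q VQ; exists V', hV; split=> //.
    have hVU : V' `<=` U by move=> x /hV /k.
    have [a aE] := div (om_res (twist F d) k s).
    rewrite (om_res_res _ _ hVU) (gP _ _ _ hV _ hc _ aE).
    by apply: gP => x; rewrite aE; exact: (@sec_const F r _ U s).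
  exists (OmHom gn) => U s; apply: om_eq_local => Q UQ.
  have [c cQ] := cvar_notin Q (f j0).
  pose U' : opens (P1 F) := opensI U (chart c).
  have hU : U' `<=` U by move=> ? [].
  have hUc : U' `<=` chart c by move=> ? [].
  have qU : mor_pre q U' `<=` mor_pre q U by move=> x; exact: hU.
  have qUc : mor_pre q U' `<=` mor_pre q (chart c) by move=> x; exact: hUc.
  exists (mor_pre q U'), qU; split; first by split=> //; apply/in_chart.
  have bO x : Oloc (fun=> 0) (val x) (s (opens_incl hU x) * v c ^ (- m)).
    have cx : cvar F c j0 \notin mproj_ideal (val x) by exact: hUc (set_mem (valP x)).
    apply: OlocM (sec_Oloc s (opens_incl hU x)) (Oloc_cvarX (- m) cx) => j.
    by rewrite [j]ord1 eqxx subrr.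
  have bC x y : s (opens_incl hU x) * v c ^ (- m) = s (opens_incl hU y) * v c ^ (- m).
    by congr (_ * _); exact: sec_const.
  pose b : rs_sec U' := @msec F 1 (fun=> 0) U' _ bC bO.
  have sE : om_res (OP1 F m) hU s = b *: om_res (OP1 F m) hUc (chart_gen c).
    by apply: (@sec_eq F 1) => x; rewrite secZ /= cvarXK.
  transitivity (mor_sharp q U' b *: om_res L qUc (gen_image h c)).
    apply: gP => x; rewrite (@pull_sharpE F 1 r f _ b) -frac_pull_cvarX -frac_pull1M /=.
    rewrite cvarXK; congr frac_pull; exact: sec_const.
  rewrite /gen_image -(pushforward_resE hU qU) -(pushforward_resE hUc qUc).
  by rewrite !hom_nat sE linearZ.
move=> g g' gg' V t; apply: om_eq_local => Q VQ.
have [V' [hV [c [hc [V'Q div]]]]] := local V Q VQ; exists V', hV; split=> //.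
have [a aE] := div t.
have tE : om_res (twist F d) hV t =
    (a : rs_sec V') *: om_res (twist F d) hc (inverse_image_unit (chart c) (chart_gen c)).
  apply: (@sec_eq F r) => x; rewrite secZ /= frac_pull_cvarX.
  by rewrite aE.
by rewrite !hom_nat tE !linearZ -!hom_nat gg'.
Qed.

End InverseImage.

(** * Principal parts *)

Section PrincipalParts.
Variables (F : fieldType) (m : int).
Local Notation i0 := (ord0 : 'I_2).
Local Notation i1 := (ord_max : 'I_2).
Local Notation p2 := (fun _ : 'I_1 => i1).
Local Notation J := (@ideal_power (P1xP1 F) (@kernel_ideal _ _ (diag F)) 2).

Definition deg2 (i : 'I_2) : int := if i == i1 then m else 0.

Lemma push_deg2 : push_deg p2 (fun=> m) =1 deg2.
Proof. by move=> j; rewrite /push_deg /deg2 big_mkcond big_ord1 eq_sym. Qed.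

Definition deg2_taylor : omHom (twist F deg2) (jets F m) :=
  @taylor F deg2 m erefl erefl.

(** The inverse image [qE] is replaced by the isomorphic twisting sheaf, on which
    the expansion is an epimorphism with kernel [J] times the sheaf. *)
Lemma jets_tensor (Q qE : omodule (P1xP1 F)) (pi : omHom (om_structure (P1xP1 F)) Q)
    (eta : omHom (OP1 F m) (pushforward (pr2 F) qE)) :
  is_quotient J pi -> is_pullback eta ->
  exists tau : omBilinear Q qE (jets F m), is_tensor tau.
Proof.
move=> [piJ piE] etaP.
have [f [g [gf fg]]] := pullback_unique etaP (twist_is_pullback push_deg2).
apply: (@quotient_tensor _ Q qE (jets F m) pi (om_comp deg2_taylor f)) => //.
- move=> U s x Ux.
  have [V [h [Vx [a aE]]]] := @taylor_epi F deg2 m erefl erefl U s x Ux.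
  by exists V, h; split=> //; exists (g V a); rewrite /= fg.
- by move=> U a t /piJ aJ; apply: ideal_power_jet.
- move=> U t x Ux t0.
  have [V [h [Vx [a [t' [aJ tE]]]]]] := taylor_ker Ux t0.
  exists V, h; split=> //; exists a, (g V t'); split; first exact/piJ.
  by rewrite -[t]gf hom_nat -linearZ; congr (g V _).
Qed.

Lemma jets_principal_parts : is_principal_parts 1 (OP1 F m) (jets F m).
Proof.
exists (jets F 0), (structure_taylor F); split; first exact: structure_taylor_quotient.
exists (twist F deg2), (inverse_image_unit F push_deg2).
split; first exact: twist_is_pullback.
exact: jets_tensor (structure_taylor_quotient F) (twist_is_pullback push_deg2).
Qed.

Lemma principal_parts_jets G : is_principal_parts 1 (OP1 F m) G ->
  exists (f : omHom G (jets F m)) (g : omHom (jets F m) G),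
    (forall U s, g U (f U s) = s) /\ (forall U s, f U (g U s) = s).
Proof.
move=> [Q [pi [piJ [qE [eta [etaP [tau tauP]]]]]]].
have [tau' tau'P] := jets_tensor piJ etaP.
exact: tensor_unique tauP tau'P.
Qed.

End PrincipalParts.

(** * The two module structures on principal parts *)

(** A common form of the three isomorphisms below. The composite of the diagonal
    with a projection is the identity, so sections of the push-forward over [V]
    are pairs of sections over [V], and an isomorphism is given by a formula in
    the field of fractions. *)
Section PushforwardJets.
Variables (F : fieldType) (m a b : int) (p : 'I_1 -> 'I_2).
Local Notation K1 := {fraction {mpoly F[1 + 1]}}.
Local Notation dg := (@collapse 2).
Local Notation diagpre V := (mor_pre (diag F) V).
Local Notation q := (P1pow_map F p).
Variables (phi1 phi2 psi1 psi2 : K1 -> K1 -> K1).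
Hypothesis phiO : forall P f w, Oloc (fun=> m) P f -> Oloc (fun=> m - 2) P w ->
  Oloc (fun=> a) P (phi1 f w) /\ Oloc (fun=> b) P (phi2 f w).
Hypothesis psiO : forall P u v, Oloc (fun=> a) P u -> Oloc (fun=> b) P v ->
  Oloc (fun=> m) P (psi1 u v) /\ Oloc (fun=> m - 2) P (psi2 u v).
Hypothesis phiK : forall P f w, Oloc (fun=> m) P f -> Oloc (fun=> m - 2) P w ->
  psi1 (phi1 f w) (phi2 f w) = f /\ psi2 (phi1 f w) (phi2 f w) = w.
Hypothesis psiK : forall P u v, Oloc (fun=> a) P u -> Oloc (fun=> b) P v ->
  phi1 (psi1 u v) (psi2 u v) = u /\ phi2 (psi1 u v) (psi2 u v) = v.
Hypothesis phiD : forall f w f' w',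
  phi1 (f + f') (w + w') = phi1 f w + phi1 f' w' /\
  phi2 (f + f') (w + w') = phi2 f w + phi2 f' w'.
Hypothesis phiZ : forall P c f w, Oloc (fun=> 0) P c ->
  phi1 (c * f) (c * w + delta (frac_pull p c) * f) = c * phi1 f w /\
  phi2 (c * f) (c * w + delta (frac_pull p c) * f) = c * phi2 f w.

Lemma opens_pull_diag (V : opens (P1 F)) P :
  opens_set (diagpre (mor_pre q V)) P <-> opens_set V P.
Proof.
have homE e c : mhomog e c ->
    (c \in mproj_ideal (pull_point p (pull_point dg P))) = (c \in mproj_ideal P).
  move=> ec; rewrite (@pull_ideal_homog _ _ _ p _ _ _ ec).
  rewrite (@pull_ideal_homog _ _ _ dg _ _ _ (mhomog_coord_subst ec)).
  by rewrite collapseK.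
split=> /(opens_open V)[e [c [ec cP cV]]]; apply: cV.
  by rewrite -(homE _ _ ec).
by rewrite (homE _ _ ec).
Qed.

Lemma sub_pull_diag (V : opens (P1 F)) : V `<=` diagpre (mor_pre q V).
Proof. by move=> P VP; apply/opens_pull_diag. Qed.
Lemma pull_diag_sub (V : opens (P1 F)) : diagpre (mor_pre q V) `<=` V.
Proof. by move=> P; apply: (opens_pull_diag V P).1. Qed.

Section Sections.
Variable V : opens (P1 F).
Local Notation up x := (@opens_incl F 1 _ V (@sub_pull_diag V) x).
Local Notation down x := (@opens_incl F 1 V _ (@pull_diag_sub V) x).

Section Forward.
Variable s : jet_sec m (mor_pre q V).

Let sO (x : opens_set V) : Oloc (fun=> a) (val x) (phi1 (s.1 (up x)) (s.2 (up x))) /\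
  Oloc (fun=> b) (val x) (phi2 (s.1 (up x)) (s.2 (up x))).
Proof. by apply: phiO; [exact: (sec_Oloc s.1 (up x))|exact: (sec_Oloc s.2 (up x))]. Qed.

Fact jet_fwd_const (phi : K1 -> K1 -> K1) (x y : opens_set V) :
  phi (s.1 (up x)) (s.2 (up x)) = phi (s.1 (up y)) (s.2 (up y)).
Proof. by congr phi; apply: sec_const. Qed.

Definition jet_fwd : (twist_sec (fun=> a) V * twist_sec (fun=> b) V)%type :=
  (msec (jet_fwd_const phi1) (fun x => (sO x).1),
   msec (jet_fwd_const phi2) (fun x => (sO x).2)).
End Forward.

Section Backward.
Variable t : (twist_sec (fun _ : 'I_1 => a) V * twist_sec (fun _ : 'I_1 => b) V)%type.

Let tO (x : opens_set (diagpre (mor_pre q V))) :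
  Oloc (fun=> m) (val x) (psi1 (t.1 (down x)) (t.2 (down x))) /\
  Oloc (fun=> m - 2) (val x) (psi2 (t.1 (down x)) (t.2 (down x))).
Proof. by apply: psiO; [exact: (sec_Oloc t.1 (down x))|exact: (sec_Oloc t.2 (down x))]. Qed.

Fact jet_bwd_const (psi : K1 -> K1 -> K1) (x y : opens_set (diagpre (mor_pre q V))) :
  psi (t.1 (down x)) (t.2 (down x)) = psi (t.1 (down y)) (t.2 (down y)).
Proof. by congr psi; apply: sec_const. Qed.

Definition jet_bwd : jet_sec m (mor_pre q V) :=
  (msec (jet_bwd_const psi1) (fun x => (tO x).1),
   msec (jet_bwd_const psi2) (fun x => (tO x).2)).
End Backward.

Lemma jet_fwdK : cancel jet_fwd jet_bwd.
Proof.
move=> s; have E (x : opens_set (diagpre (mor_pre q V))) :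
    s.1 (up (down x)) = s.1 x /\ s.2 (up (down x)) = s.2 x.
  by split; apply: sec_const.
apply: jet_eq => x /=; have [-> ->] := E x.
  by have [] := phiK (sec_Oloc s.1 x) (sec_Oloc s.2 x).
by have [] := phiK (sec_Oloc s.1 x) (sec_Oloc s.2 x).
Qed.

Lemma jet_bwdK : cancel jet_bwd jet_fwd.
Proof.
move=> t; have E (x : opens_set V) : t.1 (down (up x)) = t.1 x /\ t.2 (down (up x)) = t.2 x.
  by split; apply: sec_const.
rewrite [RHS]surjective_pairing; congr pair; apply: sec_eq => x /=; have [-> ->] := E x.
  by have [] := psiK (sec_Oloc t.1 x) (sec_Oloc t.2 x).
by have [] := psiK (sec_Oloc t.1 x) (sec_Oloc t.2 x).
Qed.

Lemma jet_fwd_linear :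
  linear (jet_fwd : pushforward q (jets F m) V -> om_dsum (OP1 F a) (OP1 F b) V).
Proof.
move=> c s t.
have E (x : opens_set V) : restr ((mor_sharp q V c : regular_sec _)
      (@pull_opens F 2 1 dg _ (up x))) = (c : regular_sec V) x /\
    delta ((mor_sharp q V c : regular_sec _) (@pull_opens F 2 1 dg _ (up x))) =
    delta (frac_pull p ((c : regular_sec V) x)).
  rewrite (@pull_sharpE F 1 2 p V c).
  have -> : (c : regular_sec V) (pull_opens (@pull_opens F 2 1 dg _ (up x))) =
    (c : regular_sec V) x by exact: (@sec_const F 1 _ V (c : regular_sec V)).
  by split=> //; exact: (restr_pull p _).2.
have cO x : Oloc (fun=> 0) (val x) ((c : regular_sec V) x) by exact: sec_Oloc.
rewrite /jet_fwd; congr pair; apply: sec_eq => x.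
  rewrite [RHS](_ : _ = (c : regular_sec V) x * phi1 (s.1 (up x)) (s.2 (up x)) +
    phi1 (t.1 (up x)) (t.2 (up x)))//.
  rewrite -(phiZ (s.1 (up x)) (s.2 (up x)) (cO x)).1 -(phiD _ _ _ _).1.
  have [E1 E2] := E x; rewrite -E2 -{1}E1 -{1}E1.
  by [].
rewrite [RHS](_ : _ = (c : regular_sec V) x * phi2 (s.1 (up x)) (s.2 (up x)) +
    phi2 (t.1 (up x)) (t.2 (up x)))//.
rewrite -(phiZ (s.1 (up x)) (s.2 (up x)) (cO x)).2 -(phiD _ _ _ _).2.
have [E1 E2] := E x; rewrite -E2 -{1}E1 -{1}E1.
by [].
Qed.

End Sections.

Lemma pushforward_jets_iso :
  om_iso (pushforward q (jets F m)) (om_dsum (OP1 F a) (OP1 F b)).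
Proof.
exists (fun V _ => mk_linear (@jet_fwd_linear V)); split=> [V _|V W _ _ k s].
  by exists (@jet_bwd V); [exact: jet_fwdK|exact: jet_bwdK].
congr pair; apply: (@sec_eq F 1) => x /=.
  congr (phi1 _ _); first exact: (sec_const s.1).
  exact: (sec_const s.2).
congr (phi2 _ _); first exact: (sec_const s.1).
exact: (sec_const s.2).
Qed.

End PushforwardJets.

Section Structures.
Variables (F : fieldType) (m : int).
Local Notation i0 := (ord0 : 'I_2).
Local Notation i1 := (ord_max : 'I_2).
Local Notation j0 := (ord0 : 'I_1).
Local Notation K1 := {fraction {mpoly F[1 + 1]}}.
Local Notation KF := (K1 : fieldType).
Local Notation p1 := (fun _ : 'I_1 => i0).
Local Notation p2 := (fun _ : 'I_1 => i1).
Local Notation X := (tofrac (cvar F true j0) : K1).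
Local Notation Y := (tofrac (cvar F false j0) : K1).
Local Notation dX := (@frac_deriv F (1 + 1) (cidx true j0)).
Local Notation dY := (@frac_deriv F (1 + 1) (cidx false j0)).

Lemma X_Oloc P : Oloc (fun=> 1) P X.
Proof. by apply: Oloc_eq (Oloc_poly P (@mhomog_cvar F 1 true j0)) => j; rewrite [j]ord1. Qed.
Lemma Y_Oloc P : Oloc (fun=> 1) P Y.
Proof. by apply: Oloc_eq (Oloc_poly P (@mhomog_cvar F 1 false j0)) => j; rewrite [j]ord1. Qed.

Lemma Oloc1_deriv (k : int) P c z : Oloc (fun=> k) P z ->
  Oloc (fun=> k - 1) P (@frac_deriv F (1 + 1) (cidx c j0) z).
Proof. by apply: Oloc_deriv => j; rewrite [j]ord1 eqxx subrK. Qed.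

Lemma euler1 (k : int) P (z : K1) : Oloc (fun=> k) P z -> X * dX z + Y * dY z = k%:~R * z.
Proof. exact: euler_frac. Qed.

Lemma Oloc1M (k l n : int) P (z w : K1) : n = k + l ->
  Oloc (fun=> k) P z -> Oloc (fun=> l) P w -> Oloc (fun=> n) P (z * w).
Proof. by move=> nE; apply: OlocM => _. Qed.

(** The relation gives [g / y = - h / x], which is regular in both charts. *)
Lemma Oloc1_divY (k : int) P (g h : K1) : X * g + Y * h = 0 -> Oloc (fun=> k - 1) P g ->
  Oloc (fun=> k - 1) P h -> Oloc (fun=> k - 2) P (g / Y).
Proof.
move=> E gO hO; apply: (@Oloc_div _ _ _ (fun=> k - 1) P j0) => [j|[]].
- by rewrite [j]ord1 eqxx /=; lia.
- move: E => /eqP; rewrite addr_eq0 => /eqP E.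
  by rewrite mulrA E mulNr mulrAC divff ?fcvar_neq0// mul1r; exact: OlocN.
- by rewrite mulrCA divff ?fcvar_neq0// mulr1.
Qed.

Lemma delta_pull1 (z : K1) : delta (frac_pull p1 z) = dX z / Y.
Proof. by rewrite delta_pull. Qed.

Lemma int_tofrac (k : int) : k%:~R = tofrac (k%:~R : F)%:MP :> K1.
Proof. by rewrite !rmorph_int. Qed.

(** The second projection is constant in the first variables, so the derivative
    in the action vanishes and the formula is the identity. *)
Lemma right_jets :
  om_iso (right_module (jets F m)) (om_dsum (OP1 F m) (OP1 F (m - 2))).
Proof.
apply: (@pushforward_jets_iso F m m (m - 2) p2 (fun f w => f) (fun f w => w)
  (fun u v => u) (fun u v => v)) => //.
by move=> P c f w cO; rewrite delta_pull /= mul0r addr0.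
Qed.

(** Since [dX f / Y] is a regular derivation when [m] is zero in the field, it
    absorbs the derivative in the action. *)
Lemma left_jets_dvd : m%:~R = 0 :> K1 ->
  om_iso (left_module (jets F m)) (om_dsum (OP1 F m) (OP1 F (m - 2))).
Proof.
move=> m0; have O P f : Oloc (fun=> m) P f -> Oloc (fun=> m - 2) P (dX f / Y).
  move=> fO; apply: (Oloc1_divY (h := dY f)); try exact: Oloc1_deriv.
  by rewrite (euler1 fO) m0 mul0r.
apply: (@pushforward_jets_iso F m m (m - 2) p1 (fun f w => f) (fun f w => w - dX f / Y)
  (fun u v => u) (fun u v => v + dX u / Y)).
- by move=> P f w fO wO; split=> //; apply: OlocB => //; exact: O.
- by move=> P u v uO vO; split=> //; apply: OlocD => //; exact: O.
- by move=> P f w _ _; split=> //; rewrite subrK.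
- by move=> P u v _ _; split=> //; rewrite addrK.
- by move=> f w f' w'; split=> //; rewrite frac_derivD add_split_div.
- move=> P c f w _; split=> //; rewrite delta_pull1 frac_derivM.
  exact: (@leibniz_shift KF _ c (dX c) f (dX f) w (fcvar_neq0 _ _ _)).
Qed.

(** The two components are the derivatives of a local section in the variables of
    the second factor; by Euler's identity they determine its restriction [f],
    and then [w]. *)
Lemma left_jets_ndvd : m%:~R != 0 :> F ->
  om_iso (left_module (jets F m)) (om_dsum (OP1 F (m - 1)) (OP1 F (m - 1))).
Proof.
move=> mF; have nE : (m%:~R)^-1 = tofrac (m%:~R^-1 : F)%:MP :> K1.
  have m1 : m%:~R * tofrac (m%:~R^-1 : F)%:MP = 1 :> K1.
    by rewrite int_tofrac -tofracM -mpolyCM divff// mpolyC1 tofrac1.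
  exact: mulr1_eq m1.
have m0 : m%:~R != 0 :> K1.
  by rewrite -invr_eq0 nE tofrac_eq0 mpolyC_eq0 invr_eq0.
have Y0 : Y != 0 by exact: fcvar_neq0.
(* Generalizing the scalar keeps unification from unfolding it. *)
have [N NE] : exists N : K1, N = m%:~R by exists m%:~R.
rewrite -NE in nE m0.
have euler P z : Oloc (fun=> m) P z -> X * dX z + Y * dY z = N * z.
  by move=> /euler1 ->; rewrite NE.
pose psi (u v : K1) := (X * u + Y * v) / N.
have psiO P u v : Oloc (fun=> m - 1) P u -> Oloc (fun=> m - 1) P v ->
    Oloc (fun=> m) P (psi u v).
  move=> uO vO; rewrite /psi nE; apply: (@Oloc1M m 0); first by rewrite addr0.
    apply: OlocD; [apply: Oloc1M (X_Oloc P) uO|apply: Oloc1M (Y_Oloc P) vO]; lia.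
  exact: Oloc_const.
have psiE P u v : Oloc (fun=> m - 1) P u -> Oloc (fun=> m - 1) P v ->
    X * dX (psi u v) + Y * dY (psi u v) = X * u + Y * v.
  by move=> uO vO; rewrite (euler P _ (psiO P u v uO vO)) /psi mulrC divfK.
apply: (@pushforward_jets_iso F m (m - 1) (m - 1) p1
  (fun f w => dX f - Y * w) (fun f w => dY f + X * w)
  psi (fun u v => (dX (psi u v) - u) / Y)).
- move=> P f w fO wO; split.
    by apply: OlocB; [exact: Oloc1_deriv|apply: Oloc1M (Y_Oloc P) wO; lia].
  by apply: OlocD; [exact: Oloc1_deriv|apply: Oloc1M (X_Oloc P) wO; lia].
- move=> P u v uO vO; split; first exact: psiO.
  apply: (Oloc1_divY (h := dY (psi u v) - v)).
  + by rewrite !mulrBr addrACA -opprD (psiE P)// subrr.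
  + by apply: OlocB => //; apply/Oloc1_deriv/psiO.
  + by apply: OlocB => //; apply/Oloc1_deriv/psiO.
- move=> P f w fO wO; have E : psi (dX f - Y * w) (dY f + X * w) = f.
    exact: (@euler_recover KF _ _ _ _ _ _ w m0 (euler P f fO)).
  by rewrite E; split=> //; exact: (@add_sub_div_cancel KF _ (dX f) w Y0).
- move=> P u v uO vO; split; first exact: (@sub_div_cancel KF _ (dX (psi u v)) u Y0).
  exact: (@euler_second KF _ _ _ _ _ _ _ _ Y0 m0 (euler P _ (psiO P u v uO vO)) erefl).
- move=> f w f' w'; rewrite !frac_derivD.
  split; first exact: (@add_split KF X Y (dX f) (dX f') w w').1.
  exact: (@add_split KF X Y (dY f) (dY f') w w').2.
- move=> P c f w cO; rewrite delta_pull1 !frac_derivM; split.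
    exact: (@leibniz_left KF _ c (dX c) f (dX f) w Y0).
  apply: (@euler_leibniz0 KF X Y c (dX c) (dY c) f (dY f) w Y0).
  by rewrite (euler1 cO) mul0r.
Qed.

End Structures.

(** * Local freeness and the theorem *)

Section LocallyFree.
Variables (F : fieldType) (a b : int).
Local Notation j0 := (ord0 : 'I_1).
Local Notation v c := (tofrac (cvar F c j0) : {fraction {mpoly F[1 + 1]}}).

Lemma twist_shift_loc (V : opens (P1 F)) c (k l : int) (s : twist_sec (fun=> k) V) (n : int) :
  V `<=` @cvar_opens F 1 c j0 -> n = k + l ->
  forall x, Oloc (fun=> n) (val x) (s x * v c ^ l).
Proof.
move=> hc nE x; have cx : cvar F c j0 \notin mproj_ideal (val x).
  exact: hc (set_mem (valP x)).
by apply: OlocM (sec_Oloc s x) (Oloc_cvarX l cx) => j; rewrite [j]ord1 eqxx.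
Qed.

Lemma twist_shift_const (V : opens (P1 F)) c (k l : int) (s : twist_sec (fun=> k) V) x y :
  s x * v c ^ l = s y * v c ^ l.
Proof. by rewrite (sec_const s x y). Qed.

(** Multiplication by a power of a coordinate trivializes a twisting sheaf over the
    chart of that coordinate. *)
Definition twist_shift (V : opens (P1 F)) c (hc : V `<=` @cvar_opens F 1 c j0)
    (k l n : int) (nE : n = k + l) (s : twist_sec (fun=> k) V) : twist_sec (fun=> n) V :=
  msec (twist_shift_const c l s) (twist_shift_loc s hc nE).

Lemma locally_free_twists : locally_free (om_dsum (OP1 F a) (OP1 F b)).
Proof.
move=> P; have [c cP] := cvar_notin P j0.
exists (@cvar_opens F 1 c j0) => //; exists 2%N.
pose fwd (V : opens (P1 F)) (h : V `<=` @cvar_opens F 1 c j0)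
    (s : om_dsum (OP1 F a) (OP1 F b) V) : om_free (P1 F) 2 V :=
  [ffun i : 'I_2 => if i == ord0 then twist_shift h (esym (subrr a)) s.1
     else twist_shift h (esym (subrr b)) s.2].
pose bwd (V : opens (P1 F)) (h : V `<=` @cvar_opens F 1 c j0)
    (t : om_free (P1 F) 2 V) : om_dsum (OP1 F a) (OP1 F b) V :=
  (twist_shift h (esym (add0r a)) (t ord0), twist_shift h (esym (add0r b)) (t ord_max)).
have fwdL V h : linear (fwd V h).
  move=> u s t; apply/ffunP => i; rewrite !ffunE; case: ifP => _.
    by apply: (@sec_eq F 1) => x; apply: etrans (mulrDl _ _ _) _; rewrite -mulrA.
  by apply: (@sec_eq F 1) => x; apply: etrans (mulrDl _ _ _) _; rewrite -mulrA.
exists (fun V h => mk_linear (fwdL V h)); split=> [V h|V W h k l s].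
  exists (bwd V h) => [s|t].
    rewrite [RHS]surjective_pairing; congr pair; apply: (@sec_eq F 1) => x.
      by rewrite /= !ffunE /= cvarXK.
    by rewrite /= !ffunE /= cvarXK.
  apply/ffunP => i; rewrite !ffunE; case: ifP => [/eqP->|i0].
    apply: (@sec_eq F 1) => x /=.
    by rewrite -mulrA -expfzDr ?fcvar_neq0// subrr expr0z mulr1.
  have -> : i = ord_max by case: i i0 => [[|[|?]] ?] //= _; apply: val_inj.
  apply: (@sec_eq F 1) => x /=.
  by rewrite -mulrA -expfzDr ?fcvar_neq0// subrr expr0z mulr1.
by apply/ffunP => i; rewrite !ffunE; case: ifP => _; apply: (@sec_eq F 1).
Qed.

End LocallyFree.

Theorem theorem7p1 (F : fieldType) (n : nat) (n_ge1 : (1 <= n)%N) :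
  (exists G : omodule (P1xP1 F), is_principal_parts 1 (OP1 F n%:Z) G) /\
  forall G : omodule (P1xP1 F), is_principal_parts 1 (OP1 F n%:Z) G ->
  [/\ locally_free (left_module G),
      locally_free (right_module G),
      ~ char_divides F n ->
        om_iso (left_module G)
               (om_dsum (OP1 F (n%:Z - 1)) (OP1 F (n%:Z - 1))) /\
        om_iso (right_module G)
               (om_dsum (OP1 F n%:Z) (OP1 F (n%:Z - 2)))
    & char_divides F n ->
        om_iso (left_module G)
               (om_dsum (OP1 F n%:Z) (OP1 F (n%:Z - 2))) /\
        om_iso (right_module G)
               (om_dsum (OP1 F n%:Z) (OP1 F (n%:Z - 2)))].
Proof.
split=> [|G /principal_parts_jets[f [g [gf fg]]]].
  by exists (jets F n%:Z); exact: jets_principal_parts.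
have L : om_iso (left_module G) (left_module (jets F n%:Z)).
  exact: pushforward_iso gf fg.
have R : om_iso (right_module G) (om_dsum (OP1 F n%:Z) (OP1 F (n%:Z - 2))).
  exact: om_iso_trans (pushforward_iso (pr2 F) gf fg) (right_jets F n%:Z).
have dvd : char_divides F n ->
    om_iso (left_module G) (om_dsum (OP1 F n%:Z) (OP1 F (n%:Z - 2))).
  move=> [c cF cn]; apply: om_iso_trans L (left_jets_dvd _).
  have nF : n%:R = 0 :> F by apply/eqP; rewrite -(dvdn_pcharf cF).
  by rewrite int_tofrac -[n%:Z%:~R]/(n%:R) nF mpolyC0 tofrac0.
have ndvd : ~ char_divides F n ->
    om_iso (left_module G) (om_dsum (OP1 F (n%:Z - 1)) (OP1 F (n%:Z - 1))).
  move=> ncn; apply: om_iso_trans L (left_jets_ndvd _).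
  apply/negP => n0; apply: ncn; have [c cF] := natf0_pchar n_ge1 n0.
  by exists c => //; rewrite (dvdn_pcharf cF).
split=> //.
- have [/dvd|/ndvd] := pselect (char_divides F n) => H;
    exact: locally_free_iso H (@locally_free_twists _ _ _).
- exact: locally_free_iso R (@locally_free_twists _ _ _).
- by move=> /ndvd.
- by move=> /dvd.
Qed.
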